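(* Let $\mathcal V$ be a multivector field on $X$, assume $X$ is invariant, let $A\subset X$ be an attractor and $A^\star:=\operatorname{Inv}(X\setminus A)$ its dual repeller. Then $$p_A(t)+p_{A^\star}(t)=p_X(t)+(1+t)q(t)$$ for some polynomial $q(t)$ with non-negative coefficients. Moreover, if $q\neq0$, then $C(A^\star,A)\neq\emptyset$.
   Context: $X$ is a finite $T_0$ topological space. For $A\subset X$, $\operatorname{cl}A$ is its closure and $\operatorname{mo}A:=\operatorname{cl}A\setminus A$. $A$ is locally closed if it is the intersection of an open and a closed subset of $X$. $H$ denotes relative singular homology. A multivector is a nonempty locally closed subset of $X$; a multivector field $\mathcal V$ on $X$ is a partition of $X$ into multivectors. For $x\in X$, $[x]$ denotes the element of $\mathcal V$ containing $x$. A multivector $V$ is critical if $H(\operatorname{cl}V,\operatorname{mo}V)\neq0$, regular otherwise. $A\subset X$ is $\mathcal V$-compatible if for every $x\in X$ either $[x]\cap A=\emptyset$ or $[x]\subset A$. Put $\Pi_{\mathcal V}(x):=[x]\cup\operatorname{cl}\{x\}$ and $\Pi_{\mathcal V}(A):=\bigcup_{x\in A}\Pi_{\mathcal V}(x)$. A full solution is a map $\varphi:\mathbb Z\to X$ with $\varphi(i+1)\in\Pi_{\mathcal V}(\varphi(i))$ for all $i$; it is essential if for every $t\in\mathbb Z$ with $[\varphi(t)]$ regular, the set $\{s\in\mathbb Z:\varphi(s)\notin[\varphi(t)]\}$ is unbounded below and unbounded above. $\operatorname{Inv}A$ is the set of $x\in A$ such that there is an essential full solution $\varphi$ with image in $A$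 and $\varphi(0)=x$; $A$ is invariant if $\operatorname{Inv}A=A$. An invariant set $A$ is an attractor if $\Pi_{\mathcal V}(A)=A$. For a full solution $\varphi$: $\operatorname{uim}^-\varphi:=\bigcap_{t\le0}\varphi((-\infty,t])$, $\operatorname{uim}^+\varphi:=\bigcap_{t\ge0}\varphi([t,\infty))$; the $\mathcal V$-hull $\langle A\rangle_{\mathcal V}$ is the intersection of all $\mathcal V$-compatible locally closed sets containing $A$; $\alpha(\varphi):=\langle\operatorname{uim}^-\varphi\rangle_{\mathcal V}$, $\omega(\varphi):=\langle\operatorname{uim}^+\varphi\rangle_{\mathcal V}$. For $A,B\subset X$ the connection set $C(A,B)$ is the set of $x\in X$ for which there is an essential full solution $\varphi$ in $X$ with $\varphi(0)=x$, $\alpha(\varphi)\subset A$, $\omega(\varphi)\subset B$. For a locally closed $A\subset X$, $\beta_i(A):=\operatorname{rank}H_i(\operatorname{cl}A,\operatorname{mo}A)$ and the Poincaré polynomial is $p_A(t):=\sum_{i\ge0}\beta_i(A)t^i$ (so $p_X(t)=\sum_i\operatorname{rank}H_i(X)t^i$). *)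

(* Defs.v *)
From Stdlib Require Import Reals ZArith List Arith Classical ClassicalEpsilon.
Import ListNotations.
Open Scope R_scope.

Record FinT0Space := {
  pt : Type;
  is_open : (pt -> Prop) -> Prop;
  open_ext : forall U V : pt -> Prop, (forall x, U x <-> V x) -> is_open U -> is_open V;
  open_full : is_open (fun _ => True);
  open_union : forall F : (pt -> Prop) -> Prop,
      (forall U, F U -> is_open U) -> is_open (fun x => exists U, F U /\ U x);
  open_inter : forall U V, is_open U -> is_open V -> is_open (fun x => U x /\ V x);
  pt_finite : exists l : list pt, forall x, In x l;
  pt_T0 : forall x y : pt, (forall U, is_open U -> (U x <-> U y)) -> x = y
}.

Definition is_closed (X : FinT0Space) (C : pt X -> Prop) : Prop :=
  is_open X (fun x => ~ C x).

Definition cl (X : FinT0Space) (A : pt X -> Prop) : pt X -> Prop :=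
  fun x => forall C, is_closed X C -> (forall y, A y -> C y) -> C x.

Definition mo (X : FinT0Space) (A : pt X -> Prop) : pt X -> Prop :=
  fun x => cl X A x /\ ~ A x.

Definition locally_closed (X : FinT0Space) (A : pt X -> Prop) : Prop :=
  exists U C, is_open X U /\ is_closed X C /\ forall x, A x <-> (U x /\ C x).

Definition in_simplex (n : nat) (t : nat -> R) : Prop :=
  (forall j, 0 <= t j) /\ (forall j, (n < j)%nat -> t j = 0) /\ sum_f_R0 t n = 1.

(* A singular n-simplex is a map Delta^n -> X continuous on Delta^n;
   we represent it by a total function, identified up to agreement on Delta^n. *)
Definition simp (X : FinT0Space) := (nat -> R) -> pt X.

Definition sing_continuous (X : FinT0Space) (n : nat) (s : simp X) : Prop :=
  forall U, is_open X U -> forall t, in_simplex n t -> U (s t) ->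
    exists eps, 0 < eps /\
      forall u, in_simplex n u -> (forall j, (j <= n)%nat -> Rabs (u j - t j) < eps) ->
        U (s u).

Definition agree (X : FinT0Space) (n : nat) (s s' : simp X) : Prop :=
  forall t, in_simplex n t -> s t = s' t.

Definition chain (X : FinT0Space) := list (Z * simp X).

Definition coef (X : FinT0Space) (n : nat) (c : chain X) (s : simp X) : Z :=
  fold_right (fun p acc =>
     ((if excluded_middle_informative (agree X n (snd p) s) then fst p else 0) + acc)%Z)
    0%Z c.

Definition chain_eq (X : FinT0Space) (n : nat) (c c' : chain X) : Prop :=
  forall s, coef X n c s = coef X n c' s.

Definition valid (X : FinT0Space) (n : nat) (c : chain X) : Prop :=
  Forall (fun p => sing_continuous X n (snd p)) c.

Definition supported (X : FinT0Space) (n : nat) (Y : pt X -> Prop) (c : chain X) : Prop :=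
  Forall (fun p => forall t, in_simplex n t -> Y (snd p t)) c.

Definition face (i : nat) (t : nat -> R) : nat -> R :=
  fun j => if (j <? i)%nat then t j else if (j =? i)%nat then 0 else t (j - 1)%nat.

(* boundary of an (n+1)-chain *)
Definition bd (X : FinT0Space) (n : nat) (c : chain X) : chain X :=
  flat_map (fun p =>
     map (fun i => ((if Nat.even i then fst p else - fst p)%Z,
                    fun t => snd p (face i t)))
         (seq 0 (S (S n)))) c.

Definition rel_cycle (X : FinT0Space) (n : nat) (Y Zs : pt X -> Prop) (c : chain X) : Prop :=
  valid X n c /\ supported X n Y c /\
  match n with
  | O => True
  | S m => exists e, valid X m e /\ supported X m Zs e /\ chain_eq X m (bd X m c) e
  end.

Definition rel_bdry (X : FinT0Space) (n : nat) (Y Zs : pt X -> Prop) (c : chain X) : Prop :=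
  exists d e, valid X (S n) d /\ supported X (S n) Y d /\
              valid X n e /\ supported X n Zs e /\
              chain_eq X n c (bd X n d ++ e).

Definition scale (X : FinT0Space) (k : Z) (c : chain X) : chain X :=
  map (fun p => ((k * fst p)%Z, snd p)) c.

Definition lincomb (X : FinT0Space) (ks : list Z) (fam : list (chain X)) : chain X :=
  flat_map (fun kc => scale X (fst kc) (snd kc)) (combine ks fam).

Definition hom_indep (X : FinT0Space) (n : nat) (Y Zs : pt X -> Prop)
  (fam : list (chain X)) : Prop :=
  Forall (rel_cycle X n Y Zs) fam /\
  forall ks : list Z, length ks = length fam ->
    rel_bdry X n Y Zs (lincomb X ks fam) -> Forall (fun k => k = 0%Z) ks.

Definition hom_rank (X : FinT0Space) (n : nat) (Y Zs : pt X -> Prop) (r : nat) : Prop :=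
  (exists fam, length fam = r /\ hom_indep X n Y Zs fam) /\
  ~ (exists fam, length fam = S r /\ hom_indep X n Y Zs fam).

Definition hom_nonzero (X : FinT0Space) (n : nat) (Y Zs : pt X -> Prop) : Prop :=
  exists c, rel_cycle X n Y Zs c /\ ~ rel_bdry X n Y Zs c.

Definition betti (X : FinT0Space) (A : pt X -> Prop) (i : nat) (b : nat) : Prop :=
  hom_rank X i (cl X A) (mo X A) b.

(* Multivector fields: partitions into locally closed sets, given by   *)
(* the equivalence relation  mv x y  <->  y \in [x].                   *)
Record MVField (X : FinT0Space) := {
  mv : pt X -> pt X -> Prop;
  mv_refl : forall x, mv x x;
  mv_sym : forall x y, mv x y -> mv y x;
  mv_trans : forall x y z, mv x y -> mv y z -> mv x z;
  mv_lc : forall x, locally_closed X (mv x)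
}.
Arguments mv {X} _ _ _.

Definition critical (X : FinT0Space) (V : pt X -> Prop) : Prop :=
  exists n, hom_nonzero X n (cl X V) (mo X V).

Definition regular (X : FinT0Space) (V : pt X -> Prop) : Prop := ~ critical X V.

Definition compatible (X : FinT0Space) (F : MVField X) (A : pt X -> Prop) : Prop :=
  forall x, (forall y, mv F x y -> ~ A y) \/ (forall y, mv F x y -> A y).

Definition Pi (X : FinT0Space) (F : MVField X) (x : pt X) : pt X -> Prop :=
  fun y => mv F x y \/ cl X (fun z => z = x) y.

Definition full_solution (X : FinT0Space) (F : MVField X) (phi : Z -> pt X) : Prop :=
  forall i, Pi X F (phi i) (phi (i + 1)%Z).

Definition essential (X : FinT0Space) (F : MVField X) (phi : Z -> pt X) : Prop :=
  full_solution X F phi /\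
  forall t, regular X (mv F (phi t)) ->
    (forall N, exists s, (s <= N)%Z /\ ~ mv F (phi t) (phi s)) /\
    (forall N, exists s, (N <= s)%Z /\ ~ mv F (phi t) (phi s)).

Definition Inv (X : FinT0Space) (F : MVField X) (A : pt X -> Prop) : pt X -> Prop :=
  fun x => A x /\ exists phi, essential X F phi /\ (forall i, A (phi i)) /\ phi 0%Z = x.

Definition invariant (X : FinT0Space) (F : MVField X) (A : pt X -> Prop) : Prop :=
  forall x, Inv X F A x <-> A x.

Definition attractor (X : FinT0Space) (F : MVField X) (A : pt X -> Prop) : Prop :=
  invariant X F A /\ forall y, (exists x, A x /\ Pi X F x y) <-> A y.

Definition uim_minus (X : FinT0Space) (phi : Z -> pt X) : pt X -> Prop :=
  fun x => forall t, (t <= 0)%Z -> exists s, (s <= t)%Z /\ phi s = x.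

Definition uim_plus (X : FinT0Space) (phi : Z -> pt X) : pt X -> Prop :=
  fun x => forall t, (0 <= t)%Z -> exists s, (t <= s)%Z /\ phi s = x.

Definition hull (X : FinT0Space) (F : MVField X) (A : pt X -> Prop) : pt X -> Prop :=
  fun x => forall S, compatible X F S -> locally_closed X S ->
    (forall y, A y -> S y) -> S x.

Definition alpha (X : FinT0Space) (F : MVField X) (phi : Z -> pt X) := hull X F (uim_minus X phi).
Definition omega (X : FinT0Space) (F : MVField X) (phi : Z -> pt X) := hull X F (uim_plus X phi).

Definition connection_set (X : FinT0Space) (F : MVField X) (A B : pt X -> Prop) : pt X -> Prop :=
  fun x => exists phi, essential X F phi /\ phi 0%Z = x /\
    (forall y, alpha X F phi y -> A y) /\ (forall y, omega X F phi y -> B y).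

(* Main.v *)
(* All homology is computed in free abelian groups on singular simplices, and every
   subcomplex that occurs consists of the chains carried by simplices whose image satisfies
   a hereditary condition; such subcomplexes form a distributive lattice, so that
   inclusions, intersections and sums of chain groups are read off from the images.

   Two facts about singular chains are needed.  Barycentric subdivision makes chains small
   for an open cover, which gives a chain-level Mayer-Vietoris gluing principle.  In a
   finite space the minimal neighbourhood of a point x is a cone with apex x.  Gluing over
   the minimal neighbourhoods (induction over the open sets) shows that for closed B and C
   every chain in B u C is homologous to a sum of chains in B and in C (closed excision),
   and that closed sets have finite Betti numbers vanishing in high degrees.

   On the dynamical side, invariance of X makes the dual repeller R open, and the closed
   set X - R is obtained from the attractor A by attaching regular multivectors one at a
   time, each step being homologically trivial by closed excision.  Hence
   H(cl R, mo R) = H(X, X - R) = H(X, A), and the Morse equation is the count of ranks in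
   the long exact sequence of (X, A), q being the rank of the connecting map.  Without
   connections, A and R are closed and cover X, so the connecting map vanishes. *)

(* The obstacle is excision: subdivision yields it for open covers only, while the pieces occurring
   here are closed sets. What helps is that a closed set meeting the minimal neighbourhood of [x]
   contains [x]; coning off to [x] therefore never leaves the closed set. Homology has integer
   coefficients, and Betti numbers are ranks, blind to torsion. No quotient group is formed: the
   rank of [Z] modulo [B] is taken for two subgroups given as predicates, and spanning means
   spanning after multiplication by a nonzero integer. Identities between boundary, subdivision and
   homotopy are proved for vertex lists, where every nonempty list is a cone over its tail, and are
   then pushed forward along singular simplices. A single group carries the chains of all degrees,
   with one generator for each class of functions that agree on the simplex. *)
From Stdlib Require Reals ZArith List Arith Lra Lia Psatz Classical ClassicalEpsilon.
From Stdlib Require FunctionalExtensionality PropExtensionality.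

(** * Geometry of the standard simplex and barycentric subdivision *)

Module SimplexGeometry.
Require Import Defs.
From Stdlib Require Import Reals ZArith List Arith Lra Lia Psatz Classical ClassicalEpsilon FunctionalExtensionality.
Import ListNotations.
Open Scope R_scope.

Notation vec := (nat -> R).

Lemma Rabs_le_elim x a : Rabs x <= a -> - a <= x <= a.
Proof. unfold Rabs; destruct Rcase_abs; lra. Qed.

Definition tail (t : vec) : vec := fun i => t (S i).

(** Defined for arbitrary weights, not only barycentric ones, so that [aff v] is linear in [t];
    composition of affine simplices ([aff_aff]) is then mere linearity. *)
Fixpoint aff (v : list vec) (t : vec) : vec :=
  match v with
  | [] => fun _ => 0
  | p :: v' => fun j => t 0%nat * p j + aff v' (tail t) j
  end.

Fixpoint mass (v : list vec) (t : vec) : R :=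
  match v with [] => 0 | _ :: v' => t 0%nat + mass v' (tail t) end.

Fixpoint del (i : nat) (v : list vec) : list vec :=
  match v, i with
  | [], _ => []
  | _ :: v', O => v'
  | p :: v', S i' => p :: del i' v'
  end.

Definition bary (v : list vec) : vec := aff v (fun _ => / INR (length v)).

Definition unitv (i : nat) : vec := fun j => if (j =? i)%nat then 1 else 0.
Definition basis (n : nat) : list vec := map unitv (seq 0 (S n)).

(* Barycentric subdivision of the affine simplex with vertex list [v]; meaningful only
   when [n] is the length of [v]. *)
Fixpoint pieces (n : nat) (v : list vec) : list (list vec) :=
  match n with
  | O => [[]]
  | S m => map (cons (bary v)) (flat_map (fun i => pieces m (del i v)) (seq 0 (S m)))
  end.

Lemma del_length i v : (i < length v)%nat -> length (del i v) = pred (length v).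
Proof.
  revert i; induction v as [|p v IH]; intros [|i] H; simpl in *; try lia.
  rewrite IH by lia; lia.
Qed.

Lemma In_del p i v : In p (del i v) -> In p v.
Proof.
  revert i; induction v as [|q v IH]; intros [|i] H; simpl in *; try tauto.
  destruct H as [H|H]; [tauto|right; eauto].
Qed.

Lemma del_map f i v : del i (map f v) = map f (del i v).
Proof.
  revert i; induction v as [|q v IH]; intros [|i]; simpl; auto; now rewrite IH.
Qed.

Lemma sum_face i t n : (i <= S n)%nat -> sum_f_R0 (face i t) (S n) = sum_f_R0 t n.
Proof.
  intros H. revert H; induction n as [|n IH]; intros H.
  - simpl; unfold face; destruct i as [|[|i]]; simpl; try lia; lra.
  - destruct (Nat.eq_dec i (S (S n))) as [->|Hi].
    + rewrite tech5. unfold face at 2.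
      replace (S (S n) <? S (S n))%nat with false by (symmetry; apply Nat.ltb_ge; lia).
      rewrite Nat.eqb_refl, Rplus_0_r. apply sum_eq; intros j Hj; unfold face.
      now replace (j <? S (S n))%nat with true by (symmetry; apply Nat.ltb_lt; lia).
    + rewrite tech5, IH, tech5 by lia; f_equal. unfold face.
      replace (S (S n) <? i)%nat with false by (symmetry; apply Nat.ltb_ge; lia).
      replace (S (S n) =? i)%nat with false by (symmetry; apply Nat.eqb_neq; lia).
      f_equal; lia.
Qed.

Lemma face_in n i t : (i <= S n)%nat -> in_simplex n t -> in_simplex (S n) (face i t).
Proof.
  intros H [H0 [H1 H2]]; repeat split.
  - intros j; unfold face; destruct (_ <? _)%nat; auto; destruct (_ =? _)%nat; auto; lra.
  - intros j Hj; unfold face.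
    destruct (Nat.ltb_spec j i); [lia|].
    destruct (Nat.eqb_spec j i); auto; apply H1; lia.
  - rewrite sum_face; auto.
Qed.

Lemma simplex_le1 n t j : in_simplex n t -> t j <= 1.
Proof.
  intros [H0 [H1 H2]]. destruct (le_lt_dec j n) as [Hj|Hj]; [|rewrite H1; auto; lra].
  rewrite <- H2; clear H1 H2; induction n as [|n IH].
  - replace j with 0%nat by lia; simpl; lra.
  - rewrite tech5; destruct (Nat.eq_dec j (S n)) as [->|Hn].
    + assert (0 <= sum_f_R0 t n) by (apply cond_pos_sum; auto). lra.
    + specialize (H0 (S n)); assert (t j <= sum_f_R0 t n) by (apply IH; lia); lra.
Qed.

Lemma sum_tail t n : sum_f_R0 t (S n) = t 0%nat + sum_f_R0 (tail t) n.
Proof. rewrite decomp_sum by lia; reflexivity. Qed.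

Lemma sum_unitv i n : (i <= n)%nat -> sum_f_R0 (unitv i) n = 1.
Proof.
  revert i; induction n as [|n IH]; intros i H.
  - replace i with 0%nat by lia; reflexivity.
  - rewrite sum_tail; destruct i as [|i].
    + unfold unitv at 1; simpl.
      rewrite (sum_eq _ (fun _ => 0)), sum_cte by (intros; reflexivity); lra.
    + unfold unitv at 1; simpl; rewrite Rplus_0_l, <- (IH i) by lia.
      apply sum_eq; reflexivity.
Qed.

Lemma unitv_in i n : (i <= n)%nat -> in_simplex n (unitv i).
Proof.
  intros H; repeat split; [| |now apply sum_unitv].
  - intros j; unfold unitv; destruct (_ =? _)%nat; lra.
  - intros j Hj; unfold unitv; destruct (Nat.eqb_spec j i); auto; lia.
Qed.

Lemma basis_length n : length (basis n) = S n.
Proof. unfold basis; now rewrite length_map, length_seq. Qed.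

Lemma basis_in n p : In p (basis n) -> in_simplex n p.
Proof.
  intros H; apply in_map_iff in H as [i [<- Hi]]; apply in_seq in Hi; apply unitv_in; lia.
Qed.

Lemma aff_lin v a x y : aff v (fun i => a * x i + y i) = fun j => a * aff v x j + aff v y j.
Proof.
  revert x y; induction v as [|p v IH]; intros x y; simpl;
    apply functional_extensionality; intros j; [lra|].
  change (tail (fun i => a * x i + y i)) with (fun i => a * tail x i + tail y i).
  rewrite IH; lra.
Qed.

Lemma aff_zero v : aff v (fun _ => 0) = fun _ => 0.
Proof.
  induction v as [|p v IH]; auto; simpl.
  change (tail (fun _ => 0)) with (fun _ : nat => 0); rewrite IH.
  apply functional_extensionality; intros; lra.
Qed.

Lemma aff_map_lin f w t : (forall a x y, f (fun i => a * x i + y i) = fun j => a * f x j + f y j) ->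
  f (fun _ => 0) = (fun _ => 0) -> aff (map f w) t = f (aff w t).
Proof.
  intros Hl H0; revert t; induction w as [|p w IH]; intros t; simpl; auto.
  now rewrite IH, Hl.
Qed.

Lemma aff_aff v w t : aff (map (aff v) w) t = aff v (aff w t).
Proof. apply aff_map_lin; [apply aff_lin|apply aff_zero]. Qed.

Lemma bary_map_aff v w : bary (map (aff v) w) = aff v (bary w).
Proof. unfold bary; now rewrite length_map, aff_aff. Qed.

Lemma tail_face i t : tail (face (S i) t) = face i (tail t).
Proof.
  apply functional_extensionality; intros j; unfold tail, face.
  change (S j <? S i)%nat with (j <? i)%nat; change (S j =? S i)%nat with (j =? i)%nat.
  destruct (Nat.ltb_spec j i); auto; destruct (Nat.eqb_spec j i); auto.
  f_equal; lia.
Qed.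

(** A face map gives weight 0 to vertex [i], which amounts to deleting it. This matches the singular
    boundary with the boundary of vertex lists. *)
Lemma aff_face i v t : (i < length v)%nat -> aff v (face i t) = aff (del i v) t.
Proof.
  revert i t; induction v as [|p v IH]; intros i t H; [simpl in H; lia|].
  destruct i as [|i]; simpl.
  - apply functional_extensionality; intros j.
    replace (tail (face 0 t)) with t; [unfold face; simpl; lra|].
    apply functional_extensionality; intros k; unfold tail, face; simpl; f_equal; lia.
  - rewrite tail_face, IH by (simpl in H; lia); reflexivity.
Qed.

Lemma aff_seq_unitv a m t j :
  aff (map unitv (seq a m)) t j = if andb (a <=? j)%nat (j <? a + m)%nat then t (j - a)%nat else 0.
Proof.
  revert a t; induction m as [|m IH]; intros a t; simpl.
  - destruct (Nat.leb_spec a j), (Nat.ltb_spec j (a + 0)); simpl; auto; lia.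
  - rewrite IH; unfold unitv, tail.
    destruct (Nat.eqb_spec j a), (Nat.leb_spec (S a) j), (Nat.ltb_spec j (S a + m)),
      (Nat.leb_spec a j), (Nat.ltb_spec j (a + S m)); simpl; try lia; try lra.
    + subst; replace (a - a)%nat with 0%nat by lia; lra.
    + replace (j - a)%nat with (S (j - S a)) by lia; lra.
Qed.

Lemma aff_basis n t : in_simplex n t -> aff (basis n) t = t.
Proof.
  intros [_ [H _]]; apply functional_extensionality; intros j.
  unfold basis; rewrite aff_seq_unitv; simpl.
  destruct (Nat.ltb_spec j (S n)); [f_equal; lia|rewrite H; auto; lia].
Qed.

Lemma tail_unitv i : tail (unitv (S i)) = unitv i.
Proof. reflexivity. Qed.

Lemma map_aff_seq v a m : (a + m = length v)%nat ->
  map (aff v) (map unitv (seq a m)) = skipn a v.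
Proof.
  revert a m; induction v as [|p v IH]; intros a m H; simpl in H.
  - replace m with 0%nat by lia; replace a with 0%nat by lia; reflexivity.
  - destruct a as [|a].
    + destruct m as [|m]; [lia|]; simpl; f_equal.
      * apply functional_extensionality; intros j.
        change (tail (unitv 0)) with (fun _ : nat => 0); rewrite aff_zero; unfold unitv; simpl; lra.
      * transitivity (skipn 0 v); [|reflexivity].
        rewrite <- (IH 0%nat m) by lia; rewrite <- seq_shift, !map_map; apply map_ext; intros i; simpl.
        apply functional_extensionality; intros j.
        rewrite tail_unitv; unfold unitv at 1; simpl; lra.
    + simpl; rewrite <- (IH a m) by lia; rewrite <- seq_shift, !map_map; apply map_ext; intros i; simpl.
      apply functional_extensionality; intros j.
      rewrite tail_unitv; unfold unitv at 1; simpl; lra.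
Qed.

Lemma map_aff_basis v n : length v = S n -> map (aff v) (basis n) = v.
Proof. intros H; apply (map_aff_seq v 0 (S n)); lia. Qed.

(** Convexity in one coordinate. It serves for positivity, for the vanishing of coordinates beyond
    the dimension ([lo = hi = 0]), and for smallness of simplices. *)
Lemma aff_bounds v t c lo hi :
  (forall i, (i < length v)%nat -> 0 <= t i) -> (forall p, In p v -> lo <= p c <= hi) ->
  lo * mass v t <= aff v t c <= hi * mass v t.
Proof.
  revert t; induction v as [|p v IH]; intros t Ht Hv; simpl; [lra|].
  assert (H1 := Ht 0%nat ltac:(simpl; lia)).
  assert (H2 := Hv p (or_introl eq_refl)).
  assert (lo * mass v (tail t) <= aff v (tail t) c <= hi * mass v (tail t)).
  { apply IH; [intros i Hi; apply Ht; simpl; lia|intros q Hq; apply Hv; now right]. }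
  nra.
Qed.

Lemma sum_aff v t n : (forall p, In p v -> sum_f_R0 p n = 1) ->
  sum_f_R0 (aff v t) n = mass v t.
Proof.
  revert t; induction v as [|p v IH]; intros t Hv; simpl.
  - rewrite sum_cte; lra.
  - rewrite sum_plus, <- (IH (tail t)) by (intros q Hq; apply Hv; now right).
    f_equal; rewrite (sum_eq (fun j => t 0%nat * p j) (fun j => p j * t 0%nat)) by (intros; ring).
    rewrite <- scal_sum, (Hv p) by (now left); ring.
Qed.

Lemma mass_simplex v n t : length v = S n -> mass v t = sum_f_R0 t n.
Proof.
  revert n t; induction v as [|p v IH]; intros n t H; simpl in *; [lia|].
  destruct n as [|n].
  - destruct v; simpl in *; [lra|lia].
  - rewrite sum_tail, (IH n) by lia; reflexivity.
Qed.

Lemma aff_in v n m t : length v = S m -> (forall p, In p v -> in_simplex n p) ->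
  in_simplex m t -> in_simplex n (aff v t).
Proof.
  intros Hl Hv [H0 [H1 H2]].
  assert (Hm : mass v t = 1) by (rewrite (mass_simplex v m); auto).
  repeat split.
  - intros j; assert (H := aff_bounds v t j 0 1). rewrite Hm in H.
    assert (0 * 1 <= aff v t j <= 1 * 1); [|lra].
    apply H; auto; intros p Hp; specialize (Hv p Hp); split; [apply Hv|].
    now apply simplex_le1 with n.
  - intros j Hj; assert (H := aff_bounds v t j 0 0). rewrite Hm in H.
    assert (0 * 1 <= aff v t j <= 0 * 1); [|lra].
    apply H; auto; intros p Hp; specialize (Hv p Hp).
    destruct Hv as [_ [Hv _]]; rewrite Hv; auto; lra.
  - rewrite sum_aff; auto; intros p Hp; apply (Hv p Hp).
Qed.

Lemma mass_const v c : mass v (fun _ => c) = INR (length v) * c.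
Proof.
  induction v as [|p v IH]; [simpl; lra|].
  change (c + mass v (fun _ => c) = INR (S (length v)) * c); rewrite IH, S_INR; lra.
Qed.

Lemma bary_bounds v c lo hi : v <> [] -> (forall p, In p v -> lo <= p c <= hi) ->
  lo <= bary v c <= hi.
Proof.
  intros Hn Hv; unfold bary.
  assert (Hp : 0 < INR (length v)) by (apply lt_0_INR; destruct v; [tauto|simpl; lia]).
  assert (H := aff_bounds v (fun _ => / INR (length v)) c lo hi).
  rewrite mass_const, Rinv_r, !Rmult_1_r in H by lra.
  apply H; auto; intros; apply Rlt_le, Rinv_0_lt_compat; auto.
Qed.

Lemma bary_in v n : v <> [] -> (forall p, In p v -> in_simplex n p) -> in_simplex n (bary v).
Proof.
  intros Hn Hv.
  assert (Hp : 0 < INR (length v)) by (apply lt_0_INR; destruct v; [tauto|simpl; lia]).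
  assert (Hm : mass v (fun _ => / INR (length v)) = 1) by (rewrite mass_const, Rinv_r; lra).
  repeat split.
  - intros j; apply (bary_bounds v j 0 1); auto.
    intros p H; split; [apply (Hv p H)|now apply simplex_le1 with n; apply Hv].
  - intros j Hj; assert (0 <= bary v j <= 0); [|lra].
    apply bary_bounds; auto.
    intros p H; destruct (Hv p H) as [_ [E _]]; rewrite E; auto; lra.
  - unfold bary; rewrite sum_aff; auto; intros p H; apply (Hv p H).
Qed.

Lemma aff_const_dist w w0 a c d : 0 <= w0 -> (forall q, In q w -> Rabs (q c - a) <= d) ->
  Rabs (aff w (fun _ => w0) c - a * (INR (length w) * w0)) <= INR (length w) * w0 * d.
Proof.
  intros H0; induction w as [|q w IH]; intros Hw.
  - simpl; rewrite Rmult_0_l, Rmult_0_r, Rminus_0_r, Rabs_R0; lra.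
  - assert (Hq := Hw q (or_introl eq_refl)).
    specialize (IH ltac:(intros; apply Hw; now right)).
    change (aff (q :: w) (fun _ => w0) c) with (w0 * q c + aff w (fun _ => w0) c).
    change (length (q :: w)) with (S (length w)); rewrite S_INR.
    replace (w0 * q c + aff w (fun _ => w0) c - a * ((INR (length w) + 1) * w0))
      with (w0 * (q c - a) + (aff w (fun _ => w0) c - a * (INR (length w) * w0))) by ring.
    eapply Rle_trans; [apply Rabs_triang|].
    rewrite Rabs_mult, (Rabs_pos_eq w0) by auto. nra.
Qed.

(** The vertex [p] has distance 0 from itself, which saves one summand; this is the origin of the
    contraction factor [1 - / INR (length v)] of subdivision. *)
Lemma aff_const_dist_vertex w w0 p c d : 0 <= w0 -> In p w ->
  (forall q, In q w -> Rabs (q c - p c) <= d) ->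
  Rabs (aff w (fun _ => w0) c - p c * (INR (length w) * w0)) <= (INR (length w) - 1) * w0 * d.
Proof.
  intros H0; induction w as [|q w IH]; intros Hp Hw; [destruct Hp|].
  assert (Hw' : forall q0, In q0 w -> Rabs (q0 c - p c) <= d) by (intros; apply Hw; now right).
  assert (Hq := Hw q (or_introl eq_refl)).
  change (aff (q :: w) (fun _ => w0) c) with (w0 * q c + aff w (fun _ => w0) c).
  change (length (q :: w)) with (S (length w)); rewrite S_INR.
  replace (w0 * q c + aff w (fun _ => w0) c - p c * ((INR (length w) + 1) * w0))
    with (w0 * (q c - p c) + (aff w (fun _ => w0) c - p c * (INR (length w) * w0))) by ring.
  eapply Rle_trans; [apply Rabs_triang|].
  rewrite Rabs_mult, (Rabs_pos_eq w0) by auto.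
  destruct Hp as [->|Hp].
  - assert (H := aff_const_dist w w0 (p c) c d H0 Hw').
    rewrite Rminus_diag, Rabs_R0; nra.
  - specialize (IH Hp Hw'); nra.
Qed.

Lemma bary_dist v p c d : In p v -> (forall q, In q v -> Rabs (q c - p c) <= d) ->
  Rabs (bary v c - p c) <= (1 - / INR (length v)) * d.
Proof.
  intros Hp Hv.
  assert (Hl : 0 < INR (length v)) by (apply lt_0_INR; destruct v; [destruct Hp|simpl; lia]).
  assert (H0 : 0 <= / INR (length v)) by (apply Rlt_le, Rinv_0_lt_compat; auto).
  assert (H := aff_const_dist_vertex v _ p c d H0 Hp Hv).
  rewrite Rmult_minus_distr_r, Rinv_r, Rmult_1_r, Rmult_1_l in H by lra.
  exact H.
Qed.

Lemma pieces_spec n v w : length v = n -> In w (pieces n v) ->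
  match n with
  | O => w = []
  | S m => exists i w', (i <= m)%nat /\ In w' (pieces m (del i v)) /\ w = bary v :: w'
  end.
Proof.
  destruct n as [|m]; intros Hl H.
  - simpl in H; intuition.
  - cbn [pieces] in H; apply in_map_iff in H as [w' [<- H]].
    apply in_flat_map in H as [i [Hi H]]; apply in_seq in Hi.
    exists i, w'; repeat split; auto; lia.
Qed.

Lemma In_pieces m v i w : (i <= m)%nat -> In w (pieces m (del i v)) ->
  In (bary v :: w) (pieces (S m) v).
Proof.
  intros Hi Hw; cbn [pieces]; apply in_map, in_flat_map; exists i; split; auto.
  apply in_seq; lia.
Qed.

Lemma pieces_length n v w : length v = n -> In w (pieces n v) -> length w = n.
Proof.
  revert v w; induction n as [|n IH]; intros v w Hl H; apply pieces_spec in H; auto.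
  - now subst w.
  - destruct H as [i [w' [Hi [H ->]]]]; simpl; f_equal; apply IH with (del i v); auto.
    rewrite del_length; lia.
Qed.

(** The vertices of a piece are barycentres of faces of [v], so they inherit every property stable
    under barycentres. *)
Lemma pieces_ind_pt (P : vec -> Prop) n v w :
  (forall u, u <> [] -> (forall p, In p u -> P p) -> P (bary u)) ->
  length v = n -> (forall p, In p v -> P p) -> In w (pieces n v) -> forall p, In p w -> P p.
Proof.
  intros HP; revert v w; induction n as [|n IH]; intros v w Hl Hv H p Hp; apply pieces_spec in H; auto.
  - subst w; destruct Hp.
  - destruct H as [i [w' [Hi [H ->]]]]; destruct Hp as [<-|Hp].
    + apply HP; auto; intros ->; simpl in Hl; lia.
    + apply IH with (v := del i v) (w := w'); auto; [rewrite del_length; lia|].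
      intros q Hq; apply Hv; eapply In_del; eauto.
Qed.

Lemma pieces_in k n v w : length v = n -> (forall p, In p v -> in_simplex k p) ->
  In w (pieces n v) -> forall p, In p w -> in_simplex k p.
Proof. apply pieces_ind_pt; intros u; apply bary_in. Qed.

Lemma pieces_bounds c lo hi n v w : length v = n -> (forall p, In p v -> lo <= p c <= hi) ->
  In w (pieces n v) -> forall p, In p w -> lo <= p c <= hi.
Proof.
  apply (pieces_ind_pt (fun p => lo <= p c <= hi)); intros u Hu H; apply bary_bounds; auto.
Qed.

Definition spread (d : R) (v : list vec) : Prop :=
  forall p q c, In p v -> In q v -> Rabs (p c - q c) <= d.

(** The new vertex [bary v] is close to every vertex of [v], hence by convexity to every other
    vertex of the piece. The factor for [N] vertices also serves faces with fewer vertices, since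
    [1 - / INR n] grows with [n]; this uniformity lets the induction pass to faces. *)
Lemma pieces_spread N n v w d : 0 <= d -> length v = n -> (n <= N)%nat -> spread d v ->
  In w (pieces n v) -> spread ((1 - / INR N) * d) w.
Proof.
  intros Hd; revert v w; induction n as [|n IH]; intros v w Hl HN Hv H; apply pieces_spec in H; auto.
  - subst w; intros p q c [].
  - destruct H as [i [w' [Hi [H ->]]]].
    assert (IH' : spread ((1 - / INR N) * d) w').
    { apply IH with (del i v); auto; [rewrite del_length; lia|lia|].
      intros p q c Hp Hq; apply Hv; eapply In_del; eauto. }
    assert (Hr : (1 - / INR (length v)) * d <= (1 - / INR N) * d).
    { apply Rmult_le_compat_r; auto.
      assert (/ INR N <= / INR (length v)); [|lra].
      apply Rinv_le_contravar; [apply lt_0_INR; lia|apply le_INR; lia]. }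
    assert (Hb : forall q c, In q w' -> Rabs (bary v c - q c) <= (1 - / INR N) * d).
    { intros q c Hq.
      assert (H1 : bary v c - (1 - / INR N) * d <= q c <= bary v c + (1 - / INR N) * d).
      { apply pieces_bounds with (n := n) (v := del i v) (w := w'); auto; [rewrite del_length; lia|].
        intros p Hp; apply In_del in Hp.
        assert (H2 := bary_dist v p c d Hp (fun q Hq => Hv q p c Hq Hp)).
        apply Rabs_le_elim in H2; lra. }
      apply Rabs_le; lra. }
    assert (H0 : 0 <= (1 - / INR N) * d).
    { apply Rmult_le_pos; auto.
      assert (/ INR N <= / 1); [|lra].
      apply Rinv_le_contravar; [lra|]; change 1 with (INR 1); apply le_INR; lia. }
    intros p q c [<-|Hp] [<-|Hq]; auto.
    + rewrite Rminus_diag, Rabs_R0; auto.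
    + rewrite Rabs_minus_sym; auto.
Qed.

(* The number of subdivisions needed to reach [P] may vary from piece to piece. *)
Inductive eventually (P : list vec -> Prop) (n : nat) (v : list vec) : Prop :=
| eventually_now : P v -> eventually P n v
| eventually_later : (forall w, In w (pieces n v) -> eventually P n w) -> eventually P n v.

(* A simplex violating [eventually] has a piece violating it; iterating yields nested
   simplices shrinking to a point, a neighbourhood of which satisfies [P]. *)
Lemma subdivision_small (P : list vec -> Prop) n :
  (forall x, in_simplex n x -> exists eps, 0 < eps /\
     forall v, length v = S n -> (forall p, In p v -> in_simplex n p) ->
       (forall p c, In p v -> Rabs (p c - x c) < eps) -> P v) ->
  forall v, length v = S n -> (forall p, In p v -> in_simplex n p) -> eventually P (S n) v.
Proof.
  intros HP v0 Hl0 Hv0; apply NNPP; intros Hbad.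
  set (inv v := length v = S n /\ (forall p, In p v -> in_simplex n p) /\ ~ eventually P (S n) v).
  assert (Hstep : forall v, exists w, inv v -> inv w /\ In w (pieces (S n) v)).
  { intros v; destruct (classic (inv v)) as [[Hl [Hv Hb]]|H]; [|exists v; tauto].
    apply NNPP; intros Hn; apply Hb, eventually_later; intros w Hw; apply NNPP; intros Hw'.
    apply Hn; exists w; intros _; split; [split; [|split]|]; auto.
    - now apply pieces_length with v.
    - now apply pieces_in with (n := S n) (v := v). }
  destruct (choice _ Hstep) as [next Hnext].
  set (V := fix V k := match k with O => v0 | S k => next (V k) end).
  assert (HV : forall k, inv (V k)).
  { induction k as [|k IH]; simpl; [split; auto|]; now apply Hnext. }
  set (r := 1 - / INR (S n)).
  assert (Hr : 0 <= r < 1).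
  { unfold r; assert (0 < / INR (S n)) by (apply Rinv_0_lt_compat, lt_0_INR; lia).
    assert (/ INR (S n) <= / 1); [|lra].
    apply Rinv_le_contravar; [lra|]; change 1 with (INR 1); apply le_INR; lia. }
  assert (Hspr : forall k, spread (r ^ k) (V k)).
  { induction k as [|k IH].
    - simpl; intros p q c Hp Hq.
      assert (in_simplex n p) by now apply Hv0. assert (in_simplex n q) by now apply Hv0.
      assert (p c <= 1) by now apply simplex_le1 with n. assert (q c <= 1) by now apply simplex_le1 with n.
      assert (0 <= p c) by apply H. assert (0 <= q c) by apply H0.
      apply Rabs_le; lra.
    - change (r ^ S k) with (r * r ^ k); destruct (HV k) as [Hl [Hv _]].
      apply pieces_spread with (n := S n) (v := V k); auto; [apply pow_le; lra|].
      apply Hnext, HV. }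
  set (x k := hd (fun _ => 0) (V k)).
  assert (Hx : forall k, In (x k) (V k)).
  { intros k; unfold x; destruct (HV k) as [Hl _]; destruct (V k); simpl in *; [lia|tauto]. }
  (* Later simplices stay in the coordinate box of radius [r ^ k] around [x k], by convexity; hence
     each coordinate of [x] is a Cauchy sequence. *)
  assert (Hnest : forall c k m p, In p (V (k + m)%nat) -> Rabs (p c - x k c) <= r ^ k).
  { intros c k m p Hp.
    assert (x k c - r ^ k <= p c <= x k c + r ^ k); [|apply Rabs_le; lra].
    revert p Hp; induction m as [|m IH]; intros p Hp.
    - rewrite Nat.add_0_r in Hp; assert (H := Hspr k p (x k) c Hp (Hx k)); apply Rabs_le_elim in H; lra.
    - rewrite Nat.add_succ_r in Hp; simpl in Hp.
      destruct (HV (k + m)%nat) as [Hl _].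
      apply pieces_bounds with (n := S n) (v := V (k + m)%nat) (w := next (V (k + m)%nat)); auto.
      apply Hnext, HV. }
  assert (Hcv : forall c, exists l, Un_cv (fun k => x k c) l).
  { intros c; destruct (R_complete (fun k => x k c)) as [l Hlim]; [|now exists l].
    intros eps Heps; destruct (pow_lt_1_zero r) with (y := eps / 2) as [N HN];
      [rewrite Rabs_pos_eq; lra|lra|].
    exists N; intros a b Ha Hb; unfold Rdist.
    specialize (HN N (le_n N)); rewrite Rabs_pos_eq in HN by (apply pow_le; lra).
    assert (H1 := Hnest c N (a - N)%nat (x a)); assert (H2 := Hnest c N (b - N)%nat (x b)).
    replace (N + (a - N))%nat with a in H1 by lia; replace (N + (b - N))%nat with b in H2 by lia.
    specialize (H1 (Hx a)); specialize (H2 (Hx b)); apply Rabs_le_elim in H1, H2.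
    apply Rabs_def1; lra. }
  destruct (choice _ Hcv) as [L HL].
  assert (Hd : forall c k, Rabs (x k c - L c) <= r ^ k).
  { intros c k; apply Rnot_lt_le; intros Hlt.
    destruct (HL c (Rabs (x k c - L c) - r ^ k)) as [N HN]; [lra|].
    specialize (HN (k + N)%nat ltac:(lia)); unfold Rdist in HN.
    assert (H1 := Hnest c k N (x (k + N)%nat) (Hx _)).
    revert Hlt HN H1; unfold Rabs; repeat destruct Rcase_abs; lra. }
  assert (HxS : forall k, in_simplex n (x k)) by (intros k; apply (HV k), Hx).
  assert (small : forall eps, 0 < eps -> exists k, r ^ k < eps).
  { intros eps Heps; destruct (pow_lt_1_zero r) with (y := eps) as [N HN]; [rewrite Rabs_pos_eq; lra|lra|].
    exists N; specialize (HN N (le_n N)); rewrite Rabs_pos_eq in HN by (apply pow_le; lra); auto. }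
  assert (HLS : in_simplex n L).
  { repeat split.
    - intros j; apply Rnot_lt_le; intros Hlt; destruct (small (- L j)) as [k Hk]; [lra|].
      assert (H1 := Hd j k); apply Rabs_le_elim in H1; assert (0 <= x k j) by apply (HxS k); lra.
    - intros j Hj; apply cond_eq; intros eps Heps; destruct (small eps Heps) as [k Hk].
      assert (H1 := Hd j k); destruct (HxS k) as [_ [H2 _]]; rewrite H2 in H1 by auto.
      rewrite Rabs_minus_sym in H1; lra.
    - apply cond_eq; intros eps Heps.
      destruct (small (eps / INR (S n))) as [k Hk]; [apply Rdiv_lt_0_compat; auto; apply lt_0_INR; lia|].
      destruct (HxS k) as [_ [_ H2]]; rewrite <- H2, <- minus_sum.
      eapply Rle_lt_trans; [apply Rsum_abs|].
      eapply Rle_lt_trans; [apply sum_Rle with (Bn := fun _ => r ^ k); intros j _; rewrite Rabs_minus_sym; apply Hd|].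
      rewrite sum_cte; apply Rmult_lt_compat_r with (r := INR (S n)) in Hk; [|apply lt_0_INR; lia].
      unfold Rdiv in Hk; rewrite Rmult_assoc, Rinv_l in Hk; [lra|apply not_0_INR; lia]. }
  destruct (HP L HLS) as [eps [Heps Hsmall]].
  destruct (small (eps / 2)) as [k Hk]; [lra|].
  destruct (HV k) as [Hl [Hv Hb]]; apply Hb, eventually_now, Hsmall; auto.
  intros p c Hp.
  assert (H1 := Hspr k p (x k) c Hp (Hx k)); assert (H2 := Hd c k); apply Rabs_le_elim in H1, H2.
  apply Rabs_def1; lra.
Qed.
End SimplexGeometry.

Module SingularSimplices.
Require Import Defs.
From Stdlib Require Import Reals ZArith List Arith Lra Lia Psatz Classical ClassicalEpsilon FunctionalExtensionality PropExtensionality.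
Import ListNotations SimplexGeometry.
Open Scope R_scope.

Section Simplices.
Variable X : FinT0Space.
Implicit Types (s : simp X) (U W : pt X -> Prop).

Definition image (n : nat) s : pt X -> Prop := fun x => exists t, in_simplex n t /\ s t = x.

(* The representative of the class of [s] under [agree X n]: constant off the simplex. *)
Definition nf (n : nat) s : simp X :=
  fun t => if excluded_middle_informative (in_simplex n t) then s t else s (unitv 0).

Lemma nf_in n s t : in_simplex n t -> nf n s t = s t.
Proof. intros H; unfold nf; destruct excluded_middle_informative; tauto. Qed.

Lemma nf_agree n s : agree X n (nf n s) s.
Proof. intros t Ht; now apply nf_in. Qed.

Lemma agree_nf n s s' : agree X n s s' -> nf n s = nf n s'.
Proof.
  intros H; apply functional_extensionality; intros t; unfold nf.
  destruct excluded_middle_informative; apply H; auto; apply unitv_in; lia.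
Qed.

Lemma nf_eq_agree n s s' : nf n s = nf n s' -> agree X n s s'.
Proof. intros H t Ht; rewrite <- (nf_in n s), H, nf_in; auto. Qed.

Lemma nf_idem n s : nf n (nf n s) = nf n s.
Proof. apply agree_nf, nf_agree. Qed.

Lemma nf_precomp n m s f : (forall t, in_simplex m t -> in_simplex n (f t)) ->
  nf m (fun t => nf n s (f t)) = nf m (fun t => s (f t)).
Proof. intros H; apply agree_nf; intros t Ht; apply nf_in; auto. Qed.

Lemma image_agree n s s' : agree X n s s' -> image n s = image n s'.
Proof.
  intros H; apply functional_extensionality; intros x; apply propositional_extensionality.
  split; intros [t [Ht E]]; exists t; split; auto; [rewrite <- H|rewrite H]; auto.
Qed.

Lemma image_nonempty n s : image n s (s (unitv 0)).
Proof. exists (unitv 0); split; auto; apply unitv_in; lia. Qed.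

Lemma continuous_agree n s s' : agree X n s s' -> sing_continuous X n s -> sing_continuous X n s'.
Proof.
  intros H Hs U HU t Ht Hst; destruct (Hs U HU t Ht) as [eps [He Hn]]; [now rewrite H|].
  exists eps; split; auto; intros u Hu Hut; rewrite <- H; auto.
Qed.

Lemma continuous_const n a : sing_continuous X n (fun _ => a).
Proof. intros U _ t _ Ha; exists 1; split; [lra|auto]. Qed.

Lemma continuous_nf n s : sing_continuous X n s -> sing_continuous X n (nf n s).
Proof. apply continuous_agree; intros t Ht; symmetry; now apply nf_in. Qed.

Lemma image_nf n s : image n (nf n s) = image n s.
Proof. apply image_agree, nf_agree. Qed.

Lemma continuous_face n s i : (i <= S n)%nat -> sing_continuous X (S n) s ->
  sing_continuous X n (fun t => s (face i t)).
Proof.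
  intros Hi Hs U HU t Ht Hst; destruct (Hs U HU (face i t)) as [eps [He Hn]]; auto.
  { now apply face_in. }
  exists eps; split; auto; intros u Hu Hut; apply Hn; [now apply face_in|].
  intros j Hj; unfold face.
  destruct (Nat.ltb_spec j i); [apply Hut; lia|].
  destruct (Nat.eqb_spec j i); [rewrite Rminus_0_r, Rabs_R0; auto|apply Hut; lia].
Qed.

Lemma image_face n s i x : (i <= S n)%nat -> image n (fun t => s (face i t)) x -> image (S n) s x.
Proof. intros Hi [t [Ht E]]; exists (face i t); split; auto; now apply face_in. Qed.

Lemma aff_close v t u c eps : 0 <= eps -> (forall p, In p v -> 0 <= p c <= 1) ->
  (forall i, (i < length v)%nat -> Rabs (u i - t i) <= eps) ->
  Rabs (aff v u c - aff v t c) <= INR (length v) * eps.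
Proof.
  intros He; revert t u; induction v as [|p v IH]; intros t u Hv H.
  - simpl; rewrite Rminus_0_r, Rabs_R0; lra.
  - assert (H1 := Hv p (or_introl eq_refl)); assert (H2 := H 0%nat ltac:(simpl; lia)).
    change (length (p :: v)) with (S (length v)) in *; rewrite S_INR.
    change (aff (p :: v) u c - aff (p :: v) t c)
      with (u 0%nat * p c + aff v (tail u) c - (t 0%nat * p c + aff v (tail t) c)).
    assert (H3 := IH (tail t) (tail u) ltac:(intros; apply Hv; now right)
      ltac:(intros i Hi; apply (H (S i)); lia)).
    apply Rabs_le_elim in H2, H3; apply Rabs_le; nra.
Qed.

Lemma continuous_aff n m s v : length v = S m -> (forall p, In p v -> in_simplex n p) ->
  sing_continuous X n s -> sing_continuous X m (fun t => s (aff v t)).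
Proof.
  intros Hl Hv Hs U HU t Ht Hst; destruct (Hs U HU (aff v t)) as [eps [He Hn]]; auto.
  { apply aff_in with m; auto. }
  assert (Hp : 0 < INR (length v)) by (apply lt_0_INR; lia).
  assert (Hq : 0 < eps / (2 * INR (length v))) by (apply Rdiv_lt_0_compat; lra).
  exists (eps / (2 * INR (length v))); split; auto.
  intros u Hu Hut; apply Hn; [apply aff_in with m; auto|].
  intros j Hj; apply Rle_lt_trans with (INR (length v) * (eps / (2 * INR (length v)))).
  - apply aff_close; [lra| |].
    + intros p Hpv; split; [apply (Hv p Hpv)|apply simplex_le1 with n; auto].
    + intros i Hi; apply Rlt_le, Hut; lia.
  - replace (INR (length v) * (eps / (2 * INR (length v)))) with (eps / 2) by (field; lra); lra.
Qed.

Lemma image_aff n m s v x : length v = S m -> (forall p, In p v -> in_simplex n p) ->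
  image m (fun t => s (aff v t)) x -> image n s x.
Proof. intros Hl Hv [t [Ht E]]; exists (aff v t); split; auto; apply aff_in with m; auto. Qed.

(** Pointwise substitute for a Lebesgue number: each point of the simplex has a neighbourhood mapped
    into [U] or into [W], and affine simplices lying in it are small. *)
Lemma continuous_subdivision n s U W : sing_continuous X n s ->
  is_open X U -> is_open X W -> (forall x, image n s x -> U x \/ W x) ->
  eventually (fun v => (forall x, image n (fun t => s (aff v t)) x -> U x) \/
                       (forall x, image n (fun t => s (aff v t)) x -> W x)) (S n) (basis n).
Proof.
  intros Hs HU HW Hc; apply subdivision_small; [|apply basis_length|apply basis_in].
  assert (G : forall V, is_open X V -> forall x, in_simplex n x -> V (s x) ->
     exists eps, 0 < eps /\ forall v, length v = S n -> (forall p, In p v -> in_simplex n p) ->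
     (forall p c, In p v -> Rabs (p c - x c) < eps) -> (forall y, image n (fun t => s (aff v t)) y -> V y)).
  { intros V HV x Hx HVx; destruct (Hs V HV x Hx HVx) as [eps [He Hn]].
    exists (eps / 2); split; [lra|]; intros v Hl Hv Hd y [t [Ht <-]].
    apply Hn; [apply aff_in with n; auto|]; intros j _.
    assert (H1 : x j - eps / 2 <= aff v t j <= x j + eps / 2).
    { assert (H := aff_bounds v t j (x j - eps / 2) (x j + eps / 2)).
      rewrite (mass_simplex v n) in H by auto; destruct Ht as [Ht0 [_ Ht1]]; rewrite Ht1, !Rmult_1_r in H.
      apply H; auto; intros p Hp; specialize (Hd p j Hp); apply Rabs_def2 in Hd; lra. }
    apply Rabs_def1; lra. }
  intros x Hx; destruct (Hc (s x)) as [Hs0|Hs0]; [now exists x|..].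
  - destruct (G U HU x Hx Hs0) as [eps [He H]]; exists eps; split; auto; intros; left; eapply H; eauto.
  - destruct (G W HW x Hx Hs0) as [eps [He H]]; exists eps; split; auto; intros; right; eapply H; eauto.
Qed.

(* The cone over [s] with apex [x] sitting over the vertex [0]; it is continuous as soon
   as every neighbourhood of [x] contains the image of [s]. *)
Definition cone (x : pt X) s : simp X :=
  fun t => if excluded_middle_informative (t 0%nat = 1) then x
           else s (fun j => t (S j) / (1 - t 0%nat)).

Lemma cone_base_in n t : in_simplex (S n) t -> t 0%nat <> 1 ->
  in_simplex n (fun j => t (S j) / (1 - t 0%nat)).
Proof.
  intros Ht H1; assert (H := simplex_le1 _ _ 0 Ht).
  assert (H2 : 0 < / (1 - t 0%nat)) by (apply Rinv_0_lt_compat; lra).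
  destruct Ht as [H0 [Hz Hs]]; rewrite sum_tail in Hs; repeat split.
  - intros j; specialize (H0 (S j)); unfold Rdiv; nra.
  - intros j Hj; rewrite Hz by lia; unfold Rdiv; lra.
  - change (sum_f_R0 (fun j => tail t j * / (1 - t 0%nat)) n = 1).
    rewrite <- scal_sum; replace (sum_f_R0 (tail t) n) with (1 - t 0%nat) by lra.
    apply Rinv_l; lra.
Qed.

Lemma cone_agree n x s s' : agree X n s s' -> agree X (S n) (cone x s) (cone x s').
Proof.
  intros H t Ht; unfold cone; destruct excluded_middle_informative; auto.
  apply H, cone_base_in; auto.
Qed.

Lemma image_cone n x s y : image (S n) (cone x s) y -> y = x \/ image n s y.
Proof.
  intros [t [Ht <-]]; unfold cone; destruct excluded_middle_informative; auto.
  right; eexists; split; [|reflexivity]; apply cone_base_in; auto.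
Qed.

Lemma cone_face0 n x s t : in_simplex n t -> cone x s (face 0 t) = s t.
Proof.
  intros Ht; unfold cone, face; simpl; destruct excluded_middle_informative; [lra|].
  f_equal; apply functional_extensionality; intros j; rewrite Nat.sub_0_r; field.
Qed.

Lemma cone_faceS x s i t : cone x s (face (S i) t) = cone x (fun u => s (face i u)) t.
Proof.
  unfold cone; change (face (S i) t 0%nat) with (t 0%nat).
  destruct excluded_middle_informative; auto; f_equal.
  apply functional_extensionality; intros j.
  change (face (S i) t (S j)) with (tail (face (S i) t) j); rewrite tail_face.
  unfold face, tail; destruct (_ <? _)%nat; auto; destruct (_ =? _)%nat; auto.
  unfold Rdiv; ring.
Qed.

Lemma cone_face1_vertex x s t : in_simplex 0 t -> cone x s (face 1 t) = x.
Proof.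
  intros [_ [_ H]]; unfold cone, face; simpl in *; destruct excluded_middle_informative; tauto.
Qed.

(** An open set containing the apex contains the whole cone by hypothesis, so nothing happens there;
    away from the apex the projection to the base is continuous. *)
Lemma continuous_cone n x s : sing_continuous X n s ->
  (forall U, is_open X U -> U x -> forall y, image n s y -> U y) ->
  sing_continuous X (S n) (cone x s).
Proof.
  intros Hs Hx U HU t Ht HUt.
  destruct (classic (U x)) as [HUx|HUx].
  { exists 1; split; [lra|]; intros u Hu _.
    destruct (image_cone n x s (cone x s u)) as [->|H]; auto; [now exists u|].
    apply (Hx U); auto. }
  unfold cone in HUt; destruct excluded_middle_informative as [H1|H1]; [tauto|].
  destruct (Hs U HU _ (cone_base_in n t Ht H1) HUt) as [eps [He Hn]].
  assert (Hle := simplex_le1 _ _ 0 Ht).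
  set (a := 1 - t 0%nat) in *; assert (Ha : 0 < a) by (unfold a; lra).
  assert (Ha1 : a <= 1) by (unfold a; destruct Ht as [H0 _]; specialize (H0 0%nat); lra).
  assert (Ht0 : t 0%nat = 1 - a) by (unfold a; lra).
  (* The bound [a / 2] forces [b > a / 2] for the new denominator [b]. With [D = eps * (a * a) / 8]
     the numerator of the difference is at most [2 * D], which is less than [eps * (a * b)]. *)
  exists (Rmin (a / 2) (eps * (a * a) / 8)).
  assert (Haa : 0 < a * a) by (apply Rmult_lt_0_compat; auto).
  split; [apply Rmin_pos; [lra|]; apply Rdiv_lt_0_compat; [apply Rmult_lt_0_compat; auto|lra]|].
  intros u Hu Hut.
  assert (Hlt : forall j, (j <= S n)%nat -> Rabs (u j - t j) < a / 2 /\ Rabs (u j - t j) < eps * (a * a) / 8).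
  { intros j Hj; specialize (Hut j Hj); split; eapply Rlt_le_trans; eauto; [apply Rmin_l|apply Rmin_r]. }
  destruct (Hlt 0%nat ltac:(lia)) as [Hu0 Hu0']; apply Rabs_def2 in Hu0, Hu0'.
  unfold cone; destruct excluded_middle_informative as [H2|H2]; [lra|].
  set (b := 1 - u 0%nat) in *; assert (Hu00 : u 0%nat = 1 - b) by (unfold b; lra).
  apply Hn; [now apply (cone_base_in n u)|]; intros j Hj.
  destruct (Hlt (S j) ltac:(lia)) as [_ Huj]; apply Rabs_def2 in Huj.
  assert (Htj := simplex_le1 _ _ (S j) Ht).
  assert (Htj0 : 0 <= t (S j)) by apply Ht.
  assert (Hb : a / 2 < b) by lra.
  replace (u (S j) / b - t (S j) / a)
    with (((u (S j) - t (S j)) * a + t (S j) * (a - b)) / (a * b)) by (field; lra).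
  assert (Hab : 0 < a * b) by (apply Rmult_lt_0_compat; lra).
  unfold Rdiv at 1; rewrite Rabs_mult, (Rabs_pos_eq (/ (a * b))) by (apply Rlt_le, Rinv_0_lt_compat; auto).
  apply Rmult_lt_reg_r with (a * b); auto.
  rewrite Rmult_assoc, Rinv_l, Rmult_1_r by lra.
  set (D := eps * (a * a) / 8) in *.
  assert (HD : 0 < D) by lra.
  assert (HDe : D * 8 = eps * (a * a)) by (unfold D; lra).
  apply Rle_lt_trans with (2 * D).
  - apply Rabs_le; rewrite Ht0, Hu00 in *. split; nra.
  - assert (eps * (a * a) / 2 < eps * (a * b)) by nra. lra.
Qed.
End Simplices.
End SingularSimplices.

(** * Finite topological spaces *)

Module FiniteSpaces.
Require Import Defs.
From Stdlib Require Import Reals ZArith List Arith Lia Classical ClassicalEpsilon FunctionalExtensionality PropExtensionality.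
Import ListNotations.

Section Spaces.
Variable X : FinT0Space.
Notation pset := (pt X -> Prop).
Implicit Types (U W A B C : pset) (x y z : pt X).

Lemma pset_ext A B : (forall x, A x <-> B x) -> A = B.
Proof. intros H; apply functional_extensionality; intros x; now apply propositional_extensionality. Qed.

(** The specialization order: [y] lies in every neighbourhood of [x], equivalently [x] lies in the
    closure of [y]. Open and closed sets are its upper and lower sets. *)
Definition minopen x : pset := fun y => forall U, is_open X U -> U x -> U y.

Lemma minopen_refl x : minopen x x.
Proof. intros U _ H; exact H. Qed.

Lemma minopen_sub x U : is_open X U -> U x -> forall y, minopen x y -> U y.
Proof. intros HU Hx y H; now apply H. Qed.

(** Each excluded point is excluded by one open set, and finitely many such sets are intersected. *)
Lemma minopen_open x : is_open X (minopen x).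
Proof.
  destruct (pt_finite X) as [l Hl].
  assert (G : forall l, exists U, is_open X U /\ U x /\ forall y, In y l -> U y -> minopen x y).
  { clear; induction l as [|z l [U [HU [Ux IH]]]].
    - exists (fun _ => True); split; [apply open_full|]; split; auto; intros y [].
    - destruct (classic (minopen x z)) as [Hz|Hz].
      + exists U; split; auto; split; auto; intros y [<-|Hy]; auto.
      + apply not_all_ex_not in Hz as [V HV].
        assert (is_open X V /\ V x /\ ~ V z) as [HV1 [HV2 HV3]] by tauto.
        exists (fun y => U y /\ V y); split; [now apply open_inter|]; split; auto.
        intros y [<-|Hy] [H1 H2]; [tauto|auto]. }
  destruct (G l) as [U [HU [Ux H]]].
  apply open_ext with U; auto; intros y; split; [auto|now apply minopen_sub].
Qed.

Lemma open_iff U : is_open X U <-> (forall x, U x -> forall y, minopen x y -> U y).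
Proof.
  split; [intros HU x; now apply minopen_sub|intros H].
  apply open_ext with (fun y => exists V, (exists x, U x /\ V = minopen x) /\ V y).
  - intros y; split; [intros [V [[x [Ux ->]] Vy]]; eauto|].
    intros Uy; exists (minopen y); split; [now exists y|apply minopen_refl].
  - apply open_union; intros V [x [_ ->]]; apply minopen_open.
Qed.

Lemma minopen_trans x y z : minopen x y -> minopen y z -> minopen x z.
Proof. intros H1 H2; apply (proj1 (open_iff (minopen x)) (minopen_open x) y); auto. Qed.

Lemma minopen_antisym x y : minopen x y -> minopen y x -> x = y.
Proof. intros H1 H2; apply pt_T0; intros U HU; split; intros H; [apply H1|apply H2]; auto. Qed.

Lemma closed_iff C : is_closed X C <-> (forall x y, C y -> minopen x y -> C x).
Proof.
  unfold is_closed; rewrite open_iff; split.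
  - intros H x y Cy Hxy; apply NNPP; intros Cx; exact (H x Cx y Hxy Cy).
  - intros H x Cx y Hxy Cy; apply Cx; eauto.
Qed.

Lemma cl_iff A x : cl X A x <-> exists y, A y /\ minopen x y.
Proof.
  split.
  - intros H; apply (H (fun x => exists y, A y /\ minopen x y)).
    + apply closed_iff; intros u v [y [Ay Hv]] Huv; exists y; split; auto; eapply minopen_trans; eauto.
    + intros y Ay; exists y; split; auto; apply minopen_refl.
  - intros [y [Ay H]] C HC HA; eapply closed_iff; eauto.
Qed.

Lemma cl_incl A x : A x -> cl X A x.
Proof. intros H; apply cl_iff; exists x; split; auto; apply minopen_refl. Qed.

Lemma cl_point x y : cl X (fun z => z = x) y <-> minopen y x.
Proof. rewrite cl_iff; split; [intros [z [-> H]]; auto|intros H; now exists x]. Qed.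

Lemma cl_closed A : is_closed X (cl X A).
Proof.
  apply closed_iff; intros x y; rewrite !cl_iff; intros [z [Az Hz]] Hxy.
  exists z; split; auto; eapply minopen_trans; eauto.
Qed.

Lemma closed_cl C : is_closed X C -> cl X C = C.
Proof.
  intros HC; apply pset_ext; intros x; split; [|apply cl_incl].
  intros H; now apply (H C).
Qed.

Lemma closed_full : is_closed X (fun _ => True).
Proof. apply closed_iff; auto. Qed.

(** Counts occurrences in an enumeration that may have repetitions; strict monotonicity is what the
    induction uses. *)
Definition card (l : list (pt X)) A : nat :=
  length (filter (fun x => if excluded_middle_informative (A x) then true else false) l).

Lemma card_le l A B : (forall x, A x -> B x) -> (card l A <= card l B)%nat.
Proof.
  intros H; unfold card; induction l as [|z l IH]; simpl; auto.
  destruct (excluded_middle_informative (A z)), (excluded_middle_informative (B z)); simpl; try lia.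
  now apply H in a.
Qed.

Lemma card_lt l A B x : (forall x, A x -> B x) -> In x l -> B x -> ~ A x -> (card l A < card l B)%nat.
Proof.
  intros H Hx HB HA; induction l as [|z l IH]; [destruct Hx|].
  assert (H1 := card_le l A B H); unfold card in *; simpl.
  destruct Hx as [->|Hx].
  - destruct (excluded_middle_informative (A x)), (excluded_middle_informative (B x)); simpl; try tauto; lia.
  - specialize (IH Hx); destruct (excluded_middle_informative (A z)), (excluded_middle_informative (B z)); simpl; try lia.
    now apply H in a.
Qed.

Lemma pset_wf_ind (Phi : pset -> Prop) :
  (forall A, (forall B, (forall x, B x -> A x) -> (exists x, A x /\ ~ B x) -> Phi B) -> Phi A) ->
  forall A, Phi A.
Proof.
  intros H A; destruct (pt_finite X) as [l Hl].
  remember (card l A) as n eqn:En; revert A En.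
  induction n as [n IH] using lt_wf_ind; intros A ->; apply H.
  intros B HBA [x [Ax Bx]]; apply (IH (card l B)); auto; apply card_lt with x; auto.
Qed.

Lemma minimal_exists U x0 : U x0 -> exists x, U x /\ forall y, U y -> minopen y x -> y = x.
Proof.
  revert x0; apply (pset_wf_ind (fun U => forall x0, U x0 -> exists x, U x /\ forall y, U y -> minopen y x -> y = x)).
  clear U; intros U IH x0 Ux0.
  destruct (classic (exists y, U y /\ minopen y x0 /\ y <> x0)) as [[y [Uy [Hy Hne]]]|H].
  - destruct (IH (fun z => U z /\ minopen z x0 /\ z <> x0)) with (x0 := y) as [x [[Ux [Hx Hxne]] Hm]]; auto.
    + tauto.
    + exists x0; split; auto; tauto.
    + exists x; split; auto; intros z Uz Hz; apply Hm; auto; split; auto; split.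
      * eapply minopen_trans; eauto.
      * intros ->; apply Hxne, minopen_antisym; auto.
  - exists x0; split; auto; intros y Uy Hy; apply NNPP; intros Hn; apply H; eauto.
Qed.

(* A nonempty open set is [minopen x] together with the smaller open set obtained by
   removing [x], for [x] minimal among the points whose minimal neighbourhoods it contains. *)
Lemma open_ind (Phi : pset -> Prop) :
  Phi (fun _ => False) ->
  (forall x, Phi (minopen x)) ->
  (forall U W, is_open X U -> is_open X W -> Phi U -> Phi W -> Phi (fun x => U x /\ W x) ->
     Phi (fun x => U x \/ W x)) ->
  forall U, is_open X U -> Phi U.
Proof.
  intros H0 H1 H2 U; pattern U; apply pset_wf_ind; clear U; intros U IH HU.
  destruct (classic (exists x, U x)) as [[x0 Ux0]|Hne].
  2: { replace U with (fun _ : pt X => False); auto; apply pset_ext; intros x; split; [tauto|eauto]. }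
  destruct (minimal_exists U x0 Ux0) as [x [Ux Hm]].
  assert (HW : is_open X (fun y => U y /\ y <> x)).
  { apply open_iff; intros y [Uy Hy] z Hz; split; [now apply Hz|].
    intros ->; apply Hy; apply Hm; auto. }
  replace U with (fun y => minopen x y \/ (U y /\ y <> x)).
  2: { apply pset_ext; intros y; split; [intros [H|H]; [now apply H|tauto]|].
       intros Uy; destruct (classic (y = x)) as [->|]; [left; apply minopen_refl|auto]. }
  apply H2; auto; [apply minopen_open| |].
  - apply IH; auto; [tauto|]; exists x; tauto.
  - apply IH; [intros y [H _]; now apply H|exists x; tauto|].
    apply open_inter; auto; apply minopen_open.
Qed.
End Spaces.
End FiniteSpaces.

(** * Attractors and dual repellers *)

Module AttractorRepeller.
Require Import Defs.
From Stdlib Require Import Reals ZArith List Arith Lia Classical ClassicalEpsilon FunctionalExtensionality.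
Import FiniteSpaces.

Section Dynamics.
Variables (X : FinT0Space) (F : MVField X).
Notation pset := (pt X -> Prop).
Implicit Types (x y p : pt X) (phi psi : Z -> pt X) (B : pset).

Lemma Pi_mv x y : mv F x y -> Pi X F x y.
Proof. now left. Qed.

Lemma Pi_cl x y : minopen X y x -> Pi X F x y.
Proof. intros H; right; now apply cl_point. Qed.

Lemma mv_eq x y : mv F x y -> mv F x = mv F y.
Proof.
  intros H; apply pset_ext; intros z; split; intros Hz.
  - apply mv_trans with x; auto; now apply mv_sym.
  - now apply mv_trans with y.
Qed.

Definition forward_inv B : Prop := forall x y, B x -> Pi X F x y -> B y.

Lemma forward_inv_iff B : forward_inv B <-> is_closed X B /\ compatible X F B.
Proof.
  split.
  - intros H; split.
    + apply closed_iff; intros x y By Hxy; apply (H y); auto; now apply Pi_cl.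
    + intros x; destruct (classic (B x)) as [Bx|Bx]; [right|left]; intros y Hy.
      * now apply (H x); [|apply Pi_mv].
      * intros By; apply Bx, (H y); auto; now apply Pi_mv, mv_sym.
  - intros [Hc Hm] x y Bx [H|H].
    + destruct (Hm x) as [Hx|Hx]; [destruct (Hx x (mv_refl _ F x) Bx)|auto].
    + apply cl_point in H; rewrite closed_iff in Hc; eauto.
Qed.

Lemma forward_inv_orbit B phi : forward_inv B -> full_solution X F phi ->
  forall s t, (s <= t)%Z -> B (phi s) -> B (phi t).
Proof.
  intros HB Hphi s t Hst Hs; replace t with (s + Z.of_nat (Z.to_nat (t - s)))%Z by lia.
  induction (Z.to_nat (t - s)) as [|n IH]; [now rewrite Z.add_0_r|].
  replace (s + Z.of_nat (S n))%Z with (s + Z.of_nat n + 1)%Z by lia.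
  apply (HB _ _ IH), Hphi.
Qed.

Definition fwd_essential psi : Prop := forall p, regular X (mv F p) ->
  forall N, exists s, (N <= s)%Z /\ ~ mv F p (psi s).
Definition bwd_essential phi : Prop := forall p, regular X (mv F p) ->
  forall N, exists s, (s <= N)%Z /\ ~ mv F p (phi s).

(** If [phi N] lies outside a multivector, [N] itself witnesses the escape; so visited regular
    multivectors may be replaced by all regular ones. The condition then separates into one on each
    end, which [splice] can recombine. *)
Lemma essential_iff phi :
  essential X F phi <-> full_solution X F phi /\ bwd_essential phi /\ fwd_essential phi.
Proof.
  split.
  - intros [Hf He]; split; auto; split; intros p Hp N.
    + destruct (classic (mv F p (phi N))) as [H|H]; [|exists N; split; [lia|exact H]].
      rewrite (mv_eq _ _ H) in Hp |- *; apply (He N); auto.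
    + destruct (classic (mv F p (phi N))) as [H|H]; [|exists N; split; [lia|exact H]].
      rewrite (mv_eq _ _ H) in Hp |- *; apply (He N); auto.
  - intros [Hf [Hb Hw]]; split; [exact Hf|]; intros t Ht; split; [now apply Hb|now apply Hw].
Qed.

Definition splice phi psi : Z -> pt X :=
  fun i => if (i <=? 0)%Z then phi i else psi (i - 1)%Z.

Lemma splice_neg phi psi i : (i <= 0)%Z -> splice phi psi i = phi i.
Proof. intros H; unfold splice; now rewrite (proj2 (Z.leb_le i 0) H). Qed.

Lemma splice_pos phi psi i : (0 < i)%Z -> splice phi psi i = psi (i - 1)%Z.
Proof. intros H; unfold splice; now rewrite (proj2 (Z.leb_gt i 0) H). Qed.

Lemma splice_essential phi psi : essential X F phi ->
  (forall i, (0 <= i)%Z -> Pi X F (psi i) (psi (i + 1)%Z)) -> fwd_essential psi ->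
  Pi X F (phi 0%Z) (psi 0%Z) -> essential X F (splice phi psi).
Proof.
  intros Hphi Hpsi Hw H0; apply essential_iff in Hphi as [Hf [Hb _]]; apply essential_iff.
  split; [|split].
  - intros i; destruct (Z_lt_le_dec i 0) as [Hi|Hi].
    + rewrite !splice_neg by lia; apply Hf.
    + destruct (Z.eq_dec i 0) as [->|Hi0]; [exact H0|].
      rewrite !splice_pos by lia; replace (i + 1 - 1)%Z with (i - 1 + 1)%Z by lia.
      apply Hpsi; lia.
  - intros p Hp N; destruct (Hb p Hp (Z.min N 0)) as [s [Hs Hn]].
    exists s; split; [lia|]; rewrite splice_neg; auto; lia.
  - intros p Hp N; destruct (Hw p Hp (Z.max N 0)) as [s [Hs Hn]].
    exists (s + 1)%Z; split; [lia|]; rewrite splice_pos by lia.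
    now replace (s + 1 - 1)%Z with s by lia.
Qed.

Variable A : pset.
Hypothesis hX : invariant X F (fun _ => True).
Hypothesis hA : attractor X F A.

Definition repeller : pset := Inv X F (fun x => ~ A x).

Lemma solution_through x : exists phi, essential X F phi /\ phi 0%Z = x.
Proof. destruct (proj2 (hX x) I) as [_ [phi [H1 [_ H2]]]]; eauto. Qed.

Lemma attractor_fwd : forward_inv A.
Proof. intros x y Ax Hxy; apply hA; eauto. Qed.

Lemma attractor_closed : is_closed X A.
Proof. apply forward_inv_iff, attractor_fwd. Qed.

Lemma repeller_disjoint x : repeller x -> ~ A x.
Proof. now intros [H _]. Qed.

Lemma past_off_attractor phi : full_solution X F phi -> ~ A (phi 0%Z) ->
  forall i, (i <= 0)%Z -> ~ A (phi i).
Proof.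
  intros Hf H0 i Hi HA; apply H0; apply (forward_inv_orbit A phi attractor_fwd Hf i); auto.
Qed.

(* Backward solutions always exist because [X] is invariant, and they avoid [A] because
   [A] is forward invariant. *)
Lemma repeller_of_future x psi : ~ A x -> Pi X F x (psi 0%Z) ->
  (forall i, (0 <= i)%Z -> Pi X F (psi i) (psi (i + 1)%Z) /\ ~ A (psi i)) ->
  fwd_essential psi -> repeller x.
Proof.
  intros HAx H0 Hpsi Hw; destruct (solution_through x) as [phi [Hphi Ephi]].
  split; auto; exists (splice phi psi); split; [|split].
  - apply splice_essential; auto; [intros i Hi; apply Hpsi; auto|now rewrite Ephi].
  - intros i; destruct (Z_le_gt_dec i 0) as [Hi|Hi].
    + rewrite splice_neg by lia; apply past_off_attractor; auto; [apply Hphi|now rewrite Ephi].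
    + rewrite splice_pos by lia; apply Hpsi; lia.
  - rewrite splice_neg by lia; auto.
Qed.

Lemma repeller_bwd x y : repeller y -> Pi X F x y -> repeller x.
Proof.
  intros [HAy [psi [Hpsi [HApsi E]]]] Hxy.
  apply essential_iff in Hpsi as [Hf [_ Hw]].
  apply repeller_of_future with psi; auto.
  - intros HA; apply HAy; apply (attractor_fwd x); auto.
  - now rewrite E.
Qed.

Lemma corepeller_fwd : forward_inv (fun x => ~ repeller x).
Proof. intros x y Hx Hxy Hy; apply Hx, (repeller_bwd x y); auto. Qed.

Lemma corepeller_closed : is_closed X (fun x => ~ repeller x).
Proof. apply forward_inv_iff, corepeller_fwd. Qed.

Lemma repeller_open : is_open X repeller.
Proof.
  apply open_ext with (fun x => ~ ~ repeller x); [intros x; tauto|].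
  exact corepeller_closed.
Qed.

Lemma repeller_compatible : compatible X F repeller.
Proof.
  destruct (proj1 (forward_inv_iff _) corepeller_fwd) as [_ H].
  intros x; destruct (H x) as [Hx|Hx]; [right|left]; intros y Hy; auto.
  apply NNPP; intros Hn; exact (Hx y Hy Hn).
Qed.

(** In a critical multivector a constant solution is essential. *)
Lemma critical_repeller x : ~ A x -> critical X (mv F x) -> repeller x.
Proof.
  intros HA Hc; split; auto; exists (fun _ => x); split; [|split]; auto.
  split; [intros i; apply Pi_mv, mv_refl|]; intros t Ht; destruct (Ht Hc).
Qed.

(** Alternating moves inside a multivector ([via]) and into the closure of a point, landing in
    another multivector ([next]), produce a forward solution that never settles in one multivector
    and never enters [A]. *)
Lemma escaping_repeller (N : pset) (next via : pt X -> pt X) x0 :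
  (forall x, N x -> ~ A x) ->
  (forall x, N x -> mv F x (via x) /\ minopen X (next x) (via x) /\ N (next x) /\ ~ mv F x (next x)) ->
  N x0 -> repeller x0.
Proof.
  intros HNA Hstep H0.
  set (xs := fix xs k := match k with O => x0 | S k => next (xs k) end).
  assert (HN : forall k, N (xs k)) by (induction k as [|k IH]; simpl; auto; now apply Hstep).
  set (z n := if Nat.even n then xs (Nat.div2 n) else via (xs (Nat.div2 n))).
  assert (Hz0 : forall k, z (2 * k)%nat = xs k).
  { intros k; unfold z; now rewrite Nat.even_even, Nat.div2_double. }
  assert (Hz1 : forall k, z (S (2 * k)) = via (xs k)).
  { intros k; unfold z; now rewrite <- Nat.add_1_r, Nat.even_odd, Nat.add_1_r, Nat.div2_succ_double. }
  assert (Hpar : forall n, exists k, n = (2 * k)%nat \/ n = S (2 * k)).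
  { intros n; destruct (Nat.Even_or_Odd n) as [[k Hk]|[k Hk]]; exists k; lia. }
  assert (HPi : forall n, Pi X F (z n) (z (S n))).
  { intros n; destruct (Hpar n) as [k [->| ->]].
    - rewrite Hz0, Hz1; apply Pi_mv, (proj1 (Hstep _ (HN k))).
    - replace (S (S (2 * k))) with (2 * S k)%nat by lia; rewrite Hz0, Hz1.
      apply Pi_cl, (proj1 (proj2 (Hstep _ (HN k)))). }
  assert (HzA : forall n, ~ A (z n)).
  { intros n; destruct (Hpar n) as [k [->| ->]].
    - rewrite Hz0; apply HNA, HN.
    - rewrite Hz1; intros H; apply (HNA _ (HN k)), (attractor_fwd (via (xs k))); auto.
      apply Pi_mv, mv_sym, (proj1 (Hstep _ (HN k))). }
  (* The future starts at [z 1], because [x0] is [z 0]. *)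
  apply repeller_of_future with (fun i => z (S (Z.to_nat i))).
  - now apply HNA.
  - change x0 with (xs 0%nat); rewrite <- Hz0; apply HPi.
  - intros i Hi; split; auto; replace (Z.to_nat (i + 1)) with (S (Z.to_nat i)) by lia; apply HPi.
  - intros p _ M; set (k := Z.to_nat M).
    (* Of two consecutive points of [xs] at least one lies outside the class of [p], since they lie
       in different multivectors. *)
    destruct (classic (mv F p (xs (S k)))) as [H1|H1].
    + exists (Z.of_nat (2 * k + 3)); split; [lia|].
      replace (S (Z.to_nat (Z.of_nat (2 * k + 3)))) with (2 * S (S k))%nat by lia; rewrite Hz0.
      intros H2; apply (Hstep (xs (S k)) (HN _)), mv_trans with p; auto; now apply mv_sym.
    + exists (Z.of_nat (2 * k + 1)); split; [lia|].
      replace (S (Z.to_nat (Z.of_nat (2 * k + 1)))) with (2 * S k)%nat by lia; now rewrite Hz0.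
Qed.

(* Between [A] and the complement of the dual repeller only regular multivectors occur,
   and they can be attached one at a time keeping the set closed: otherwise one could
   leave multivectors forever without entering [A]. *)
Lemma filtration_step B x : forward_inv B -> (forall y, A y -> B y) -> ~ B x -> ~ repeller x ->
  exists p, ~ B p /\ ~ repeller p /\ regular X (mv F p) /\ is_closed X (fun y => B y \/ mv F p y).
Proof.
  intros HB HAB Bx Rx; apply NNPP; intros Hno; apply Rx.
  set (N y := ~ B y /\ ~ repeller y).
  assert (Hstep : forall y, exists vu : pt X * pt X, N y ->
    mv F y (fst vu) /\ minopen X (snd vu) (fst vu) /\ N (snd vu) /\ ~ mv F y (snd vu)).
  { intros y; destruct (classic (N y)) as [[By Ry]|H]; [|exists (y, y); tauto].
    destruct (classic (is_closed X (fun z => B z \/ mv F y z))) as [Hc|Hc].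
    - exfalso; apply Hno; exists y; repeat split; auto.
      intros Hcr; apply Ry, critical_repeller; auto.
    (* Failure of closedness yields an exit: a point [u] in the closure of some [v] in the
       multivector of [y], outside both [B] and that multivector. The repeller is closed under
       predecessors, so [u] is again outside it. *)
    - rewrite closed_iff in Hc; apply not_all_ex_not in Hc as [u Hc]; apply not_all_ex_not in Hc as [v Hc].
      assert (H : (B v \/ mv F y v) /\ minopen X u v /\ ~ (B u \/ mv F y u)) by tauto; clear Hc.
      destruct H as [[Bv|Hv] [Huv Hu]].
      + exfalso; apply Hu; left; apply (HB v); auto; now apply Pi_cl.
      + exists (v, u); intros _; unfold N; simpl; split; [exact Hv|]; split; [exact Huv|].
        split; [split; [tauto|]|tauto].
        intros Ru; apply Ry, (repeller_bwd y v); [|now apply Pi_mv].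
        apply (repeller_bwd v u); auto; now apply Pi_cl. }
  destruct (choice _ Hstep) as [g Hg].
  apply (escaping_repeller N (fun y => snd (g y)) (fun y => fst (g y))); auto; [|split; auto].
  intros y [By _] Ay; auto.
Qed.

(** An induction principle in place of an explicit filtration. It is used homologically
    ([acyclic_corepeller]) and dynamically ([past_meets_repeller]). *)
Lemma filtration_ind (Phi : pset -> Prop) :
  Phi A ->
  (forall B p, forward_inv B -> Phi B -> regular X (mv F p) -> ~ B p ->
     is_closed X (fun y => B y \/ mv F p y) -> Phi (fun y => B y \/ mv F p y)) ->
  Phi (fun x => ~ repeller x).
Proof.
  intros H0 H1.
  (* The well-founded induction runs on the complement [D] of [B], which shrinks with every attached
     multivector. *)
  assert (G : forall D B, (forall y, D y <-> ~ B y) -> forward_inv B -> (forall y, A y -> B y) ->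
    (forall y, B y -> ~ repeller y) -> Phi B -> Phi (fun x => ~ repeller x)).
  { intros D; pattern D; apply pset_wf_ind; clear D; intros D IH B HD HB HAB HBR HPhi.
    destruct (classic (exists x, ~ B x /\ ~ repeller x)) as [[x [Bx Rx]]|Hno].
    - destruct (filtration_step B x HB HAB Bx Rx) as [p [Bp [Rp [Hreg Hcl]]]].
      apply (IH (fun y => ~ (B y \/ mv F p y))) with (B := fun y => B y \/ mv F p y).
      + intros y Hy; apply HD; tauto.
      + exists p; split; [now apply HD|]; intros H; apply H; right; apply mv_refl.
      + intros y; tauto.
      + apply forward_inv_iff; split; auto; intros y.
        destruct (proj1 (forward_inv_iff B) HB) as [_ Hm].
        destruct (Hm y) as [Hy|Hy]; [|right; auto].
        destruct (classic (mv F p y)) as [Hpy|Hpy]; [right|left]; intros z Hz.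
        * right; now apply mv_trans with y.
        * intros [H|H]; [now apply (Hy z)|]; apply Hpy, mv_trans with z; auto; now apply mv_sym.
      + auto.
      + intros y [By|Hy]; auto; intros Ry; apply Rp, (repeller_bwd p y); auto; now apply Pi_mv.
      + apply H1; auto.
    - replace (fun x => ~ repeller x) with B; auto; apply pset_ext; intros y; split; auto.
      intros Ry; apply NNPP; intros By; apply Hno; eauto. }
  apply (G (fun y => ~ A y) A); auto; [tauto|apply attractor_fwd|].
  intros y Ay Ry; exact (repeller_disjoint y Ry Ay).
Qed.

(** Before time [s] the orbit stays in the repeller, after time [t] it stays in [A]. Both sets are
    compatible and locally closed, so passing to hulls leads to no new points. *)
Lemma connection_of_orbit phi s t : essential X F phi -> repeller (phi s) -> A (phi t) ->
  connection_set X F repeller A (phi 0%Z).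
Proof.
  intros Hphi Hs Ht; assert (Hf : full_solution X F phi) by apply Hphi.
  exists phi; split; auto; split; auto; split; intros y Hy; apply Hy.
  - apply repeller_compatible.
  - exists repeller, (fun _ => True); split; [apply repeller_open|].
    split; [apply closed_full|intros; tauto].
  - intros z Hz; destruct (Hz (Z.min s 0)) as [r [Hr <-]]; [lia|].
    apply NNPP; intros Hn.
    exact (forward_inv_orbit _ phi corepeller_fwd Hf r s ltac:(lia) Hn Hs).
  - apply forward_inv_iff, attractor_fwd.
  - exists (fun _ => True), A; split; [apply open_full|].
    split; [apply attractor_closed|intros; tauto].
  - intros z Hz; destruct (Hz (Z.max t 0)) as [r [Hr <-]]; [lia|].
    apply (forward_inv_orbit _ phi attractor_fwd Hf t r); auto; lia.
Qed.

(** Backward in time the orbit leaves each regular multivector again and again, and a point outside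
    a forward invariant [B] has its whole past outside [B]. So the orbit leaves every stage of the
    filtration. *)
Lemma past_meets_repeller phi : essential X F phi -> ~ A (phi 0%Z) -> exists s, repeller (phi s).
Proof.
  intros Hphi H0; apply essential_iff in Hphi as [Hf [Hb _]].
  assert (H : forall N, exists s, (s <= N)%Z /\ ~ ~ repeller (phi s)).
  { apply (filtration_ind (fun B => forall N, exists s, (s <= N)%Z /\ ~ B (phi s))).
    - intros N; exists (Z.min N 0); split; [lia|]; apply past_off_attractor; auto; lia.
    - intros B p HB IH Hp _ _ N; destruct (IH N) as [s [Hs HBs]]; destruct (Hb p Hp s) as [r [Hr Hn]].
      exists r; split; [lia|]; intros [H|H]; auto.
      apply HBs, (forward_inv_orbit B phi HB Hf r); auto. }
  destruct (H 0%Z) as [s [_ Hs]]; exists s; now apply NNPP.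
Qed.

(** The past of an orbit starting off [A] meets the repeller. If its future met [A] it would be a
    connection; hence it avoids [A] altogether and lies in the invariant part of the complement. *)
Lemma no_connection_cover : ~ (exists x, connection_set X F repeller A x) ->
  forall x, A x \/ repeller x.
Proof.
  intros Hno x; apply NNPP; intros Hx; apply Hno.
  destruct (solution_through x) as [phi [Hphi E]].
  destruct (past_meets_repeller phi) as [s Hs]; auto; [rewrite E; tauto|].
  destruct (classic (exists t, A (phi t))) as [[t Ht]|Hn].
  - exists (phi 0%Z); apply connection_of_orbit with s t; auto.
  - exfalso; apply Hx; right; split; [tauto|]; exists phi; split; auto; split; auto.
    intros i Hi; apply Hn; eauto.
Qed.

(** Passing from [y] to a point [x] of its closure is an admissible move. Were [y] in the repeller
    and [x] in [A], the past through [y] followed by the future through [x] would be a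
    connection. *)
Lemma no_connection_closed : ~ (exists x, connection_set X F repeller A x) ->
  is_closed X repeller.
Proof.
  intros Hno; apply closed_iff; intros x y Ry Hxy.
  destruct (no_connection_cover Hno x) as [Ax|Rx]; auto; exfalso; apply Hno.
  destruct (solution_through x) as [psi [Hpsi Ex]]; destruct (solution_through y) as [phi [Hphi Ey]].
  assert (Hs : essential X F (splice phi psi)).
  { apply essential_iff in Hpsi as [Hf [_ Hw]]; apply splice_essential; auto.
    rewrite Ex, Ey; now apply Pi_cl. }
  eexists; apply connection_of_orbit with (s := 0%Z) (t := 1%Z); [exact Hs| |].
  - rewrite splice_neg by lia; now rewrite Ey.
  - rewrite splice_pos by lia; replace (1 - 1)%Z with 0%Z by lia; now rewrite Ex.
Qed.
End Dynamics.
End AttractorRepeller.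

(** * Ranks and homology of pairs of subcomplexes *)

From HB Require structures.
From mathcomp Require all_boot all_order all_algebra ring ssrZ zify boolp freeg.

Module RankTheory.
From mathcomp Require Import all_boot all_order all_algebra.
From Stdlib Require Import Classical.
Set Implicit Arguments. Unset Strict Implicit. Unset Printing Implicit Defensive.
Import Order.TTheory GRing.Theory Num.Theory.
Local Open Scope ring_scope.

(** The last row of the Smith form of a matrix with one more row than columns is zero; the last unit
    vector is pulled back through [L]. *)
Lemma int_left_kernel m (M : 'M[int]_(m.+1, m)) :
  exists k : 'rV[int]_m.+1, k != 0 /\ k *m M = 0.
Proof.
have [L uL [R uR [d _ ->]]] := int_Smith_normal_form M.
exists (delta_mx 0 ord_max *m invmx L); split.
  apply/eqP => E.
  have : delta_mx (0 : 'I_1) ord_max *m invmx L *m L = 0 by rewrite E mul0mx.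
  rewrite mulmxKV // => /matrixP /(_ 0 ord_max).
  by rewrite !mxE !eqxx.
rewrite !mulmxA mulmxKV //.
suff -> : delta_mx (0 : 'I_1) ord_max *m
   (\matrix_(i < m.+1, j < m) (d`_i *+ (i == j :> nat))) = 0 by rewrite mul0mx.
apply/matrixP => i j; rewrite !mxE big1 // => k _; rewrite !mxE.
case: (k =P ord_max) => [->|]; last by rewrite andbF mul0r.
by rewrite /= gtn_eqF ?mulr0n ?mulr0.
Qed.

Definition subgroup (G : zmodType) (S : G -> Prop) : Prop :=
  S 0 /\ forall x y, S x -> S y -> S (x - y).

Section Subgroup.
Variables (G : zmodType) (S : G -> Prop).
Hypothesis sS : subgroup S.

Lemma sub0 : S 0. Proof. exact: sS.1. Qed.
Lemma subB x y : S x -> S y -> S (x - y). Proof. exact: sS.2. Qed.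
Lemma subN x : S x -> S (- x).
Proof. by move=> Sx; rewrite -sub0r; apply: subB => //; apply: sub0. Qed.
Lemma subD x y : S x -> S y -> S (x + y).
Proof. by move=> Sx Sy; rewrite -[y]opprK; apply: subB => //; apply: subN. Qed.
Lemma subMn x n : S x -> S (x *+ n).
Proof.
by move=> Sx; elim: n => [|n IH]; [apply: sub0 | rewrite mulrS; apply: subD].
Qed.
Lemma subMz x (k : int) : S x -> S (x *~ k).
Proof. by move=> Sx; case: k => n; rewrite ?NegzE ?mulrNz; [|apply: subN]; apply: subMn. Qed.
Lemma sub_sum (I : Type) (r : seq I) (P : pred I) (f : I -> G) :
  (forall i, P i -> S (f i)) -> S (\sum_(i <- r | P i) f i).
Proof. by move=> Sf; apply: big_ind => //; [apply: sub0 | apply: subD]. Qed.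
Lemma subDl x y : S y -> S (x + y) -> S x.
Proof. by move=> Sy Sxy; rewrite -(addrK y x); apply: subB. Qed.
End Subgroup.

Definition sumg (G : zmodType) (A B : G -> Prop) : G -> Prop :=
  fun x => exists a b, [/\ A a, B b & x = a + b].
Definition capg (G : zmodType) (A B : G -> Prop) : G -> Prop :=
  fun x => A x /\ B x.

Lemma subgroup_sum (G : zmodType) (A B : G -> Prop) :
  subgroup A -> subgroup B -> subgroup (sumg A B).
Proof.
move=> sA sB; split; first by exists 0, 0; rewrite addr0; split=> //; apply: sub0.
move=> _ _ [a [b [Aa Bb ->]]] [a' [b' [Aa' Bb' ->]]].
by exists (a - a'), (b - b'); split; [apply: subB|apply: subB|rewrite opprD addrACA].
Qed.

Lemma subgroup_cap (G : zmodType) (A B : G -> Prop) :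
  subgroup A -> subgroup B -> subgroup (capg A B).
Proof.
move=> sA sB; split; first by split; apply: sub0.
by move=> x y [? ?] [? ?]; split; apply: subB.
Qed.

Section Rank.
Variable G : zmodType.
Implicit Types Z B K : G -> Prop.

Definition indep Z B r (f : 'I_r -> G) : Prop :=
  (forall i, Z (f i)) /\
  forall k : 'I_r -> int, B (\sum_i f i *~ k i) -> forall i, k i = 0.

(** The rank of the quotient of [Z] by [B], expressed through representatives in the same shape as
    [hom_rank]. *)
Definition has_rank Z B r : Prop :=
  (exists f : 'I_r -> G, indep Z B f) /\ ~ exists f : 'I_r.+1 -> G, indep Z B f.

(** Spanning over the rationals, with the denominator [m] cleared. *)
Definition spans Z B r (g : 'I_r -> G) : Prop :=
  forall z, Z z -> exists (m : int) (k : 'I_r -> int),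
    m != 0 /\ B (z *~ m - \sum_i g i *~ k i).

Lemma indep_pred Z B r :
  (exists f : 'I_r.+1 -> G, indep Z B f) -> exists f : 'I_r -> G, indep Z B f.
Proof.
case=> f [Zf If]; exists (fun i => f (widen_ord (leqnSn r) i)); split=> // k Bk i.
pose k' (j : 'I_r.+1) := if unlift ord_max j is Some j' then k j' else 0.
have kE j : k' (widen_ord (leqnSn r) j) = k j.
  rewrite /k'; have -> : widen_ord (leqnSn r) j = lift ord_max j.
    by apply: val_inj; rewrite /= /bump leqNgt ltn_ord.
  by rewrite liftK.
rewrite -kE; apply: If; rewrite big_ord_recr /= {2}/k' unlift_none mulr0z addr0.
by under eq_bigr do rewrite kE.
Qed.

Lemma indep_le Z B r r' : (r <= r')%N ->
  (exists f : 'I_r' -> G, indep Z B f) -> exists f : 'I_r -> G, indep Z B f.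
Proof.
move=> /subnK <-; elim: (r' - r)%N => // n IH H; apply: IH.
by apply: indep_pred; rewrite -addSn.
Qed.

Lemma rank_exists Z B N :
  (~ exists f : 'I_N.+1 -> G, indep Z B f) ->
  exists2 r, (r <= N)%N & has_rank Z B r.
Proof.
elim: N => [|N IH] H.
  exists 0%N => //; split=> //.
  by exists (fun _ => 0); split=> [[]//|k _ []].
case: (classic (exists f : 'I_N.+1 -> G, indep Z B f)) => H'.
  by exists N.+1.
by have [r rN Hr] := IH H'; exists r => //; apply: leqW.
Qed.

Lemma rank_unique Z B r r' : has_rank Z B r -> has_rank Z B r' -> r = r'.
Proof.
move=> [H1 H2] [H3 H4]; apply/eqP; rewrite eqn_leq leqNgt [X in _ && X]leqNgt.
apply/andP; split; apply/negP => H.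
  by apply: H4; apply: indep_le H1.
by apply: H2; apply: indep_le H3.
Qed.

(** The coefficients of [r + 1] elements form a matrix with a nonzero left kernel vector; scaled by
    the nonzero factors [m], it is a nontrivial relation modulo [B]. *)
Lemma spans_bound Z B r (g : 'I_r -> G) : subgroup B -> spans Z B g ->
  ~ exists f : 'I_r.+1 -> G, indep Z B f.
Proof.
move=> sB Sg [f [Zf If]].
have H i : exists mk : int * {ffun 'I_r -> int},
    mk.1 != 0 /\ B (f i *~ mk.1 - \sum_j g j *~ mk.2 j).
  have [m [k [m0 Bk]]] := Sg _ (Zf i).
  exists (m, [ffun j => k j]); split=> //=.
  by under eq_bigr do rewrite ffunE.
have [mk Hmk] := fin_all_exists H.
have [c [c0 cM]] := int_left_kernel (\matrix_(i, j) (mk i).2 j).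
have : c = 0; last by move/eqP; apply/negP.
apply/matrixP => i0 i; rewrite {i0}ord1 [RHS]mxE.
suff: (mk i).1 * c 0 i = 0.
  by move/eqP; rewrite mulf_eq0 (negPf (Hmk i).1) => /eqP.
apply: (If (fun i => (mk i).1 * c 0 i)).
have -> : \sum_i f i *~ ((mk i).1 * c 0 i) =
   \sum_i (f i *~ (mk i).1 - \sum_j g j *~ (mk i).2 j) *~ c 0 i.
  under [RHS]eq_bigr => j _ do rewrite mulrzBl -mulrzA mulrz_suml.
  rewrite sumrB exchange_big /= [X in _ - X]big1 ?subr0 // => j _.
  transitivity (g j *~ (c *m \matrix_(i, j) (mk i).2 j) 0 j).
    by rewrite mxE mulrz_sumr; apply: eq_bigr => l _; rewrite mxE -mulrzA mulrC.
  by rewrite cM mxE mulr0z.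
by apply: sub_sum => // j _; apply: subMz => //; apply: (Hmk j).2.
Qed.

(** By maximality, adjoining [z] creates a relation. Its coefficient at [z] cannot vanish, because
    the old family is independent. *)
Lemma rank_spans Z B r : subgroup Z -> subgroup B -> has_rank Z B r ->
  exists2 g : 'I_r -> G, indep Z B g & spans Z B g.
Proof.
move=> sZ sB [[g [Zg Ig]] Hn]; exists g => // z Zz.
apply: NNPP => Nz; apply: Hn.
pose f (i : 'I_r.+1) := if unlift ord_max i is Some j then g j else z.
have fw i : f (widen_ord (leqnSn r) i) = g i.
  rewrite /f; have -> : widen_ord (leqnSn r) i = lift ord_max i.
    by apply: val_inj; rewrite /= /bump leqNgt ltn_ord.
  by rewrite liftK.
have fm : f ord_max = z by rewrite /f unlift_none.
exists f; split=> [i|k Bk].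
  by rewrite /f; case: unliftP.
rewrite big_ord_recr /= fm in Bk.
have k0 : k ord_max = 0.
  apply: NNPP => k0; apply: Nz.
  exists (k ord_max), (fun i => - k (widen_ord (leqnSn r) i)).
  split; first by apply/eqP.
  rewrite -sumrN; under eq_bigr do rewrite mulrNz opprK -fw.
  by rewrite addrC.
move=> i; case: (unliftP ord_max i) => [j|] -> //.
have -> : lift ord_max j = widen_ord (leqnSn r) j.
  by apply: val_inj; rewrite /= /bump leqNgt ltn_ord.
apply: (Ig (fun j => k (widen_ord (leqnSn r) j))).
move: Bk; rewrite k0 mulr0z addr0.
by under eq_bigr do rewrite fw.
Qed.

Lemma indep_cat Z K B a b (f : 'I_a -> G) (g : 'I_b -> G) :
  (forall x, K x -> Z x) -> subgroup K -> (forall x, B x -> K x) ->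
  indep K B f -> indep Z K g ->
  indep Z B (fun i => match split i with inl j => f j | inr j => g j end).
Proof.
move=> KZ sK BK [Kf If] [Zg Ig]; split=> [i|k].
  by case: (split i) => j; [apply: KZ|].
have spl j : split (lshift b j : 'I_(a + b)) = inl j by apply: (unsplitK (inl j)).
have spr j : split (rshift a j : 'I_(a + b)) = inr j by apply: (unsplitK (inr j)).
rewrite big_split_ord /=.
under eq_bigr do rewrite spl.
under [X in _ + X]eq_bigr do rewrite spr.
move=> Bk.
have kr j : k (rshift a j) = 0.
  apply: (Ig (fun j => k (rshift a j))).
  rewrite -[X in K X]addr0 -[X in _ + X](subrr (\sum_(i < a) f i *~ k (lshift b i))) addrCA.
  rewrite addrA; apply: subB => //; first exact: BK.
  by apply: sub_sum => // i _; apply: subMz.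
rewrite [X in _ + X]big1 ?addr0 in Bk; last by move=> j _; rewrite kr mulr0z.
by move=> i; rewrite -(splitK i); case: (split i) => j /=; [apply: (If (fun j => k (lshift b j)))|].
Qed.

Lemma spans_cat Z K B a b (f : 'I_a -> G) (g : 'I_b -> G) :
  subgroup K -> subgroup B -> spans K B f -> spans Z K g ->
  spans Z B (fun i => match split i with inl j => f j | inr j => g j end).
Proof.
move=> sK sB Sf Sg z /Sg [m [k [m0 Kz]]].
have [m' [k' [m'0 Bz]]] := Sf _ Kz.
exists (m * m'), (fun i => match split i with inl j => k' j | inr j => k j * m' end).
split; first by rewrite mulf_neq0.
have spl j : split (lshift b j : 'I_(a + b)) = inl j by apply: (unsplitK (inl j)).
have spr j : split (rshift a j : 'I_(a + b)) = inr j by apply: (unsplitK (inr j)).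
rewrite big_split_ord /=.
under eq_bigr do rewrite spl.
under [X in _ - (_ + X)]eq_bigr do rewrite spr mulrzA.
move: Bz; rewrite -mulrz_suml mulrzA mulrzBl -addrA -opprD.
by rewrite [X in B (_ - X)]addrC.
Qed.

(** Rank is additive along the chain [B], [K], [Z]: both independent and rationally spanning
    families concatenate. *)
Lemma rank_add Z K B a b :
  (forall x, K x -> Z x) -> (forall x, B x -> K x) ->
  subgroup Z -> subgroup K -> subgroup B ->
  has_rank K B a -> has_rank Z K b -> has_rank Z B (a + b).
Proof.
move=> KZ BK sZ sK sB Ra Rb.
have [f If Sf] := rank_spans sK sB Ra; have [g Ig Sg] := rank_spans sZ sK Rb.
split; first by eexists; apply: indep_cat If Ig.
by apply: spans_bound (spans_cat sK sB Sf Sg).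
Qed.

Lemma rank_split Z K B r :
  (forall x, K x -> Z x) -> (forall x, B x -> K x) ->
  subgroup Z -> subgroup K -> subgroup B -> has_rank Z B r ->
  exists a b, [/\ has_rank K B a, has_rank Z K b & r = (a + b)%N].
Proof.
move=> KZ BK sZ sK sB R.
have [a _ Ra] : exists2 a, (a <= r)%N & has_rank K B a.
  apply: rank_exists => [[f [Kf If]]]; apply: R.2; exists f; split=> // i; exact: KZ.
have [b _ Rb] : exists2 b, (b <= r)%N & has_rank Z K b.
  by apply: rank_exists => [[f [Zf If]]]; apply: R.2; exists f; split=> // k /BK; apply: If.
exists a, b; split=> //; apply: rank_unique R _; exact: rank_add Ra Rb.
Qed.

Lemma rank0 Z B : subgroup B -> (forall x, Z x -> B x) -> has_rank Z B 0.
Proof.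
move=> sB ZB; split; first by exists (fun _ => 0); split=> [[]//|k _ []].
apply: (spans_bound (g := fun=> 0)) => // z Zz; exists 1, (fun=> 0); split=> //.
by rewrite big_ord0 subr0; apply: ZB.
Qed.
End Rank.

Section RankIso.
Variables (G G' : zmodType) (f : {additive G -> G'}).
Variables (Z B : G -> Prop) (Z' B' : G' -> Prop).
Hypotheses (sZ : subgroup Z) (sB' : subgroup B').
Hypotheses (fZ : forall x, Z x -> Z' (f x)) (fB : forall x, Z x -> (B x <-> B' (f x))).
Hypothesis fsurj : forall y, Z' y -> exists2 x, Z x & B' (y - f x).

(** The section hypotheses say that [f] induces an isomorphism of quotients; independent families
    are carried across by choosing representatives. *)
Lemma indep_iso r :
  (exists g : 'I_r -> G, indep Z B g) <-> (exists g : 'I_r -> G', indep Z' B' g).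
Proof.
split=> [[g [Zg Ig]]|[g [Zg Ig]]].
  exists (f \o g); split=> [i|k Bk]; first exact: fZ.
  apply: Ig; apply/fB; first by apply: sub_sum => // i _; apply: subMz.
  by rewrite raddf_sum; under eq_bigr do rewrite raddfMz.
have H i : exists x, Z x /\ B' (g i - f x).
  by have [x] := fsurj (Zg i); exists x.
have [h Hh] := fin_all_exists H.
exists h; split=> [i|k Bk]; first by have [] := Hh i.
apply: Ig.
have /fB : Z (\sum_i h i *~ k i).
  by apply: sub_sum => // i _; apply: subMz => //; have [] := Hh i.
case=> /(_ Bk) B1 _; rewrite -[X in B' X](subrK (f (\sum_i h i *~ k i))).
apply: subD => //; rewrite raddf_sum -sumrB; apply: sub_sum => // i _.
by rewrite raddfMz -mulrzBl; apply: subMz => //; have [] := Hh i.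
Qed.

Lemma rank_iso r : has_rank Z B r <-> has_rank Z' B' r.
Proof. by split=> [] [H1 H2]; split; first [exact/indep_iso | move/indep_iso]. Qed.
End RankIso.
End RankTheory.

(** * Relative homology of subcomplexes and the long exact sequence *)

Module PairHomology.
From mathcomp Require Import all_boot all_order all_algebra zify.
From Stdlib Require Import Classical ClassicalEpsilon.
Set Implicit Arguments. Unset Strict Implicit. Unset Printing Implicit Defensive.
Import Order.TTheory GRing.Theory Num.Theory.
Import RankTheory.
Local Open Scope ring_scope.

Section Homology.
Variables (G : zmodType) (d : nat -> {additive G -> G}).
Hypothesis dd : forall n x, d n (d n.+1 x) = 0.
Implicit Types P Q A B : nat -> G -> Prop.

(** One ambient group serves all degrees, as singular simplices of all dimensions have the same
    type; the grading lives in the predicates [P n]. *)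
Definition subcomplex P : Prop :=
  (forall n, subgroup (P n)) /\ forall n x, P n.+1 x -> P n (d n x).

Definition incl Q P : Prop := forall n x, Q n x -> P n x.

Definition cyc P Q n x : Prop :=
  P n x /\ match n with 0 => True | m.+1 => Q m (d m x) end.
Definition bdr P Q n x : Prop := exists y, P n.+1 y /\ Q n (x - d n y).

Definition hrank P Q n r : Prop := has_rank (cyc P Q n) (bdr P Q n) r.

Definition acyclic P Q : Prop := forall n x, cyc P Q n x -> bdr P Q n x.

Definition zeroc : nat -> G -> Prop := fun _ x => x = 0.
Definition sumc P Q : nat -> G -> Prop := fun n => sumg (P n) (Q n).
Definition capc P Q : nat -> G -> Prop := fun n => capg (P n) (Q n).

Lemma zeroc_sub : subcomplex zeroc.
Proof.
split=> [n|n x ->]; last exact: raddf0.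
by split=> // x y -> ->; rewrite subr0.
Qed.

Lemma sumc_sub P Q : subcomplex P -> subcomplex Q -> subcomplex (sumc P Q).
Proof.
move=> [sP dP] [sQ dQ]; split=> [n|n _ [a [b [Pa Qb ->]]]].
  exact: subgroup_sum.
by exists (d n a), (d n b); split; [exact: dP|exact: dQ|exact: raddfD].
Qed.

Lemma capc_sub P Q : subcomplex P -> subcomplex Q -> subcomplex (capc P Q).
Proof.
move=> [sP dP] [sQ dQ]; split=> [n|n x [Px Qx]]; first exact: subgroup_cap.
by split; [exact: dP|exact: dQ].
Qed.

Lemma incl0 P : subcomplex P -> incl zeroc P.
Proof. by move=> [sP _] n x ->; apply: sub0. Qed.

Lemma cyc_subgroup P Q n : subcomplex P -> subcomplex Q -> subgroup (cyc P Q n).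
Proof.
move=> [sP _] [sQ _]; split.
  by split; [exact: sub0 | case: n => // n; rewrite raddf0; apply: sub0].
move=> x y [Px Qx] [Py Qy]; split; first exact: subB.
by case: n Px Qx Py Qy => // n *; rewrite raddfB; apply: subB.
Qed.

Lemma bdr_subgroup P Q n : subcomplex P -> subcomplex Q -> subgroup (bdr P Q n).
Proof.
move=> [sP _] [sQ _]; split.
  by exists 0; split; [exact: sub0 | rewrite raddf0 subr0; apply: sub0].
move=> x y [x' [Px Qx]] [y' [Py Qy]]; exists (x' - y'); split; first exact: subB.
by rewrite raddfB opprD opprK addrACA -[- y + _]opprK opprD opprK; apply: subB.
Qed.

Lemma bdr_cyc P Q n : subcomplex P -> subcomplex Q -> incl Q P ->
  forall x, bdr P Q n x -> cyc P Q n x.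
Proof.
move=> cP cQ QP x [y [Py Qy]]; split.
  by rewrite -[x](subrK (d n y)); apply: subD; [exact: cP.1|exact: QP|exact: cP.2].
case: n x y Py Qy => // n x y Py Qy.
by rewrite -[x](subrK (d n.+1 y)) raddfD dd addr0; apply: cQ.2.
Qed.

Lemma bdr_incl P P' Q Q' n : incl P P' -> incl Q Q' ->
  forall x, bdr P Q n x -> bdr P' Q' n x.
Proof. by move=> PP QQ x [y [Py Qy]]; exists y; split; [apply: PP|apply: QQ]. Qed.

Lemma cyc_incl P P' Q Q' n : incl P P' -> incl Q Q' ->
  forall x, cyc P Q n x -> cyc P' Q' n x.
Proof.
by move=> PP QQ x [Px Qx]; split; [apply: PP | case: n x Px Qx => // n x _; apply: QQ].
Qed.

Lemma bdr_r P Q n x : subcomplex P -> Q n x -> bdr P Q n x.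
Proof. by move=> cP Qx; exists 0; split; [apply: sub0; apply: cP.1 | rewrite raddf0 subr0]. Qed.

Lemma hrank_incl P Q P' Q' n r :
  subcomplex P -> subcomplex Q -> subcomplex P' -> subcomplex Q' ->
  incl P P' -> incl Q Q' ->
  (forall x, cyc P Q n x -> bdr P' Q' n x -> bdr P Q n x) ->
  (forall x, cyc P' Q' n x -> exists2 y, cyc P Q n y & bdr P' Q' n (x - y)) ->
  hrank P Q n r <-> hrank P' Q' n r.
Proof.
move=> cP cQ cP' cQ' PP QQ inj surj.
apply: (rank_iso (f := idfun)) => //.
- exact: cyc_subgroup.
- exact: bdr_subgroup.
- exact: cyc_incl.
- by move=> x Zx; split; [exact: bdr_incl | exact: inj].
Qed.

(** The second isomorphism theorem: P modulo its intersection with Q equals P + Q modulo Q as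
    complexes. Topology enters only when P + Q is compared with the chains of a union. *)
Lemma hrank_excision P Q n r : subcomplex P -> subcomplex Q ->
  hrank P (capc P Q) n r <-> hrank (sumc P Q) Q n r.
Proof.
move=> cP cQ.
have cPQ := sumc_sub cP cQ; have cI := capc_sub cP cQ.
apply: hrank_incl => //.
- by move=> m x Px; exists x, 0; rewrite addr0; split=> //; apply: sub0; apply: cQ.1.
- by move=> m x [].
- move=> x [Px _] [_ [[p [q [Pp Qq ->]]] Qx]]; exists p; split=> //; split.
    by apply: (subB (cP.1 n)) => //; apply: cP.2.
  move: Qx; rewrite raddfD opprD addrA => Qx.
  by rewrite -[_ - _](subrK (d n q)); apply: (subD (cQ.1 n)) => //; apply: cQ.2.
- move=> _ [[p [q [Pp Qq ->]]] Qx]; exists p; last first.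
    by rewrite addrAC subrr add0r; apply: bdr_r.
  split=> //; case: n p q Pp Qq Qx => // n p q Pp Qq Qx; split; first exact: cP.2.
  by apply: (subDl (cQ.1 n) (cQ.2 _ _ Qq)); rewrite -raddfD.
Qed.

(** The exact sequence of the triple [Q], [P], [P'], made explicit by correcting chains by
    boundaries. *)
Lemma hrank_acyclic_l P P' Q n r :
  subcomplex P -> subcomplex P' -> subcomplex Q -> incl Q P -> incl P P' ->
  acyclic P' P -> hrank P Q n r <-> hrank P' Q n r.
Proof.
move=> cP cP' cQ QP PP ac; apply: hrank_incl => //.
- move=> x [Px _] [y [Py Qy]].
  have Pdy : P n (d n y).
    by rewrite -[d n y](subKr x); apply: (subB (cP.1 n)) => //; apply: QP.
  have [z [Pz Pyz]] : bdr P' P n.+1 y by apply: ac.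
  by exists (y - d n.+1 z); split=> //; rewrite raddfB dd subr0.
- move=> x [Px Qx].
  have [z [Pz Pxz]] : bdr P' P n x.
    by apply: ac; split=> //; case: n Px Qx => // n _; apply: QP.
  exists (x - d n z); last by exists z; split=> //; rewrite subKr subrr; apply: sub0; apply: cQ.1.
  by split=> //; case: n x z Px Qx Pz Pxz => // n x z Px Qx Pz Pxz; rewrite raddfB dd subr0.
Qed.

Lemma hrank_acyclic_r P Q Q' n r :
  subcomplex P -> subcomplex Q -> subcomplex Q' -> incl Q Q' -> incl Q' P ->
  acyclic Q' Q -> hrank P Q n r <-> hrank P Q' n r.
Proof.
move=> cP cQ cQ' QQ QP ac; apply: hrank_incl => //.
- move=> x [Px Qx] [y [Py Qy]].
  have [z [Qz Qyz]] : bdr Q' Q n (x - d n y).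
    apply: ac; split=> //; case: n x y Px Qx Py Qy => // n x y Px Qx Py Qy.
    by rewrite raddfB dd subr0.
  exists (y + z); split; last by rewrite raddfD opprD addrA.
  by apply: (subD (cP.1 _)) => //; apply: QP.
- move=> x [Px]; case: n x Px => [|n] x Px Qx.
    by exists x => //; rewrite subrr; apply: bdr_r => //; apply: sub0; apply: cQ'.1.
  have [z [Qz Qxz]] : bdr Q' Q n (d n x).
    by apply: ac; split=> //; case: n x Px Qx => // n x Px Qx; rewrite dd; apply: sub0; apply: cQ.1.
  exists (x - z); last by rewrite subKr; apply: bdr_r.
  by split; [apply: (subB (cP.1 _)) => //; apply: QP | rewrite raddfB].
Qed.

Lemma acyclic_excision P Q : subcomplex P -> subcomplex Q ->
  acyclic P (capc P Q) -> acyclic (sumc P Q) Q.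
Proof.
move=> cP cQ ac n _ [[p [q [Pp Qq ->]]] Qx].
have [z [Pz [Pw Qw]]] : bdr P (capc P Q) n p.
  apply: ac; split=> //; case: n p q Pp Qq Qx => // n p q Pp Qq Qx; split; first exact: cP.2.
  by apply: (subDl (cQ.1 n) (cQ.2 _ _ Qq)); rewrite -raddfD.
exists z; split; first by exists z, 0; rewrite addr0; split=> //; apply: sub0; apply: cQ.1.
by rewrite addrAC; apply: (subD (cQ.1 n)).
Qed.

Lemma acyclic_trans P Q A : subcomplex P -> subcomplex Q -> subcomplex A ->
  incl A Q -> incl Q P -> acyclic P Q -> acyclic Q A -> acyclic P A.
Proof.
move=> cP cQ cA AQ QP ac1 ac2 n x [Px Ax].
have [y [Py Qy]] : bdr P Q n x.
  by apply: ac1; split=> //; case: n Px Ax => // n _; apply: AQ.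
have [z [Qz Az]] : bdr Q A n (x - d n y).
  apply: ac2; split=> //; case: n x y Px Ax Py Qy => // n x y Px Ax Py Qy.
  by rewrite raddfB dd subr0.
exists (y + z); split; first by apply: (subD (cP.1 _)) => //; apply: QP.
by rewrite raddfD opprD addrA.
Qed.

Lemma acyclic_refl P : subcomplex P -> acyclic P P.
Proof. by move=> cP n x [Px _]; apply: bdr_r. Qed.

(* The long exact sequence of a pair, cut into three rank identities: [conn] is
   the image of the connecting map in degree [n]. *)
Section LongExactSequence.
Variables P Q : nat -> G -> Prop.
Hypotheses (cP : subcomplex P) (cQ : subcomplex Q) (QP : incl Q P).

Definition conn n : G -> Prop := capg (cyc Q zeroc n) (bdr P zeroc n).

Let c0 := zeroc_sub.
Let sZQ n : subgroup (cyc Q zeroc n) := cyc_subgroup n cQ c0.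
Let sZP n : subgroup (cyc P zeroc n) := cyc_subgroup n cP c0.
Let sZR n : subgroup (cyc P Q n) := cyc_subgroup n cP cQ.
Let sBQ n : subgroup (bdr Q zeroc n) := bdr_subgroup n cQ c0.
Let sBP n : subgroup (bdr P zeroc n) := bdr_subgroup n cP c0.
Let sBR n : subgroup (bdr P Q n) := bdr_subgroup n cP cQ.
Let sconn n : subgroup (conn n) := subgroup_cap (sZQ n) (sBP n).

Lemma conn_cyc n x : conn n x -> cyc Q zeroc n x. Proof. by case. Qed.
Lemma bdr_conn n x : bdr Q zeroc n x -> conn n x.
Proof.
by move=> Bx; split; [apply: bdr_cyc Bx => //; apply: incl0|apply: bdr_incl Bx].
Qed.

(** Modulo boundaries of [P], the group [K n] is the image of H_n(Q) in H_n(P). Modulo relative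
    boundaries, [L n] is the image of H_n(P) in H_n(P,Q). *)
Let K n : G -> Prop := sumg (cyc Q zeroc n) (bdr P zeroc n).
Let L n : G -> Prop := sumg (cyc P zeroc n) (Q n).

Let sK n : subgroup (K n). Proof. exact: subgroup_sum. Qed.
Let sL n : subgroup (L n). Proof. by apply: subgroup_sum => //; apply: cQ.1. Qed.

Let K_iso n r : has_rank (cyc Q zeroc n) (conn n) r <-> has_rank (K n) (bdr P zeroc n) r.
Proof.
apply: (rank_iso (f := idfun)) => //.
- by move=> x Zx; exists x, 0; rewrite addr0; split=> //; apply: sub0.
- by move=> x Zx; split=> [[]|].
- by move=> _ [a [b [Za Bb ->]]]; exists a => //; rewrite addrAC subrr add0r.
Qed.

Let L_iso n r : has_rank (cyc P zeroc n) (K n) r <-> has_rank (L n) (bdr P Q n) r.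
Proof.
apply: (rank_iso (f := idfun)) => //.
- by move=> x Zx; exists x, 0; rewrite addr0; split=> //; apply: sub0; apply: cQ.1.
- move=> x Zx; split=> [[a [b [Za [y [Py /eqP]]]]]|[y [Py Qy]]].
    rewrite subr_eq0 => /eqP -> ->; exists y; split=> //=.
    by rewrite addrK; apply: Za.1.
  exists (x - d n y), (d n y); rewrite subrK; split=> //; last first.
    by exists y; split=> //; rewrite /zeroc subrr.
  split=> //; case: n x y Zx Py Qy => // n x y Zx Py Qy.
  by rewrite raddfB dd subr0; apply: Zx.2.
- by move=> _ [a [b [Za Qb ->]]]; exists a => //=; rewrite addrAC subrr add0r; apply: bdr_r.
Qed.

(** The isomorphism is induced by the differential: a relative cycle whose boundary bounds in [Q]
    differs from an absolute cycle by a chain of [Q]. *)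
Let conn_iso n r :
  has_rank (cyc P Q n.+1) (L n.+1) r <-> has_rank (conn n) (bdr Q zeroc n) r.
Proof.
apply: (rank_iso (f := d n)) => //.
- move=> x [Px Qx]; split; last by exists x; split=> //; rewrite /zeroc subrr.
  by split=> //; case: n x Px Qx => // n x Px Qx; apply: dd.
- move=> x [Px Qx]; split=> [[a [b [Za Qb ->]]]|[y [Qy /eqP]]].
    by exists b; split=> //; rewrite raddfD Za.2 add0r /zeroc subrr.
  rewrite subr_eq0 => /eqP E; exists (x - y), y; rewrite subrK; split=> //.
  split; first by apply: (subB (cP.1 _)) => //; apply: QP.
  by rewrite raddfB E /zeroc subrr.
- move=> y [[Qy _] [x [Px /eqP]]]; rewrite subr_eq0 => /eqP E; exists x; first by split; rewrite -?E.
  by rewrite E subrr; apply: sub0.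
Qed.

Let conn0 r : has_rank (cyc P Q 0) (L 0) r <-> r = 0%N.
Proof.
have R0 : has_rank (cyc P Q 0) (L 0) 0.
  by apply: rank0 => // x [Px _]; exists x, 0; rewrite addr0; split=> //; apply: sub0; apply: cQ.1.
by split=> [R|->//]; apply: rank_unique R R0.
Qed.

Let KZ n x : K n x -> cyc P zeroc n x.
Proof.
move=> [a [b [Za Bb ->]]]; apply: (subD (sZP n)).
  exact: cyc_incl Za.
by apply: bdr_cyc Bb => //; apply: incl0.
Qed.
Let BK n x : bdr P zeroc n x -> K n x.
Proof. by move=> Bx; exists 0, x; rewrite add0r; split=> //; apply: sub0. Qed.
Let LZ n x : L n x -> cyc P Q n x.
Proof.
move=> [a [b [Za Qb ->]]]; apply: (subD (sZR n)).
  by apply: cyc_incl Za => //; apply: incl0.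
by split; [apply: QP | case: n Za Qb => // n _; apply: cQ.2].
Qed.
Let BL n x : bdr P Q n x -> L n x.
Proof.
move=> [y [Py Qy]]; exists (d n y), (x - d n y); split=> //; last by rewrite addrC subrK.
by split; [apply: cP.2 | case: n y {Qy x} Py => // n y Py; apply: dd].
Qed.

(** With [i] and [j] the ranks of the images in H_n(P) and H_n(P,Q), exactness gives
    [a n = q n + i], [x n = i + j] and [s n = j + p], where [p] is [q] one degree lower. In the sum
    [i] and [j] cancel. *)
Lemma les_rank (a x s : nat -> nat) :
  (forall n, hrank Q zeroc n (a n)) -> (forall n, hrank P zeroc n (x n)) ->
  (forall n, hrank P Q n (s n)) ->
  exists q : nat -> nat, (forall n, has_rank (conn n) (bdr Q zeroc n) (q n)) /\
    forall n, (a n + s n = x n + q n + (if n is m.+1 then q m else 0))%N.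
Proof.
move=> Ra Rx Rs.
have H n : exists q i, [/\ has_rank (conn n) (bdr Q zeroc n) q,
   has_rank (cyc Q zeroc n) (conn n) i & a n = q + i]%N.
  by apply: rank_split (Ra n) => //; [exact: conn_cyc|exact: bdr_conn].
have Hq n : exists q, has_rank (conn n) (bdr Q zeroc n) q by have [q [i []]] := H n; exists q.
have [q Rq] := choice _ Hq.
exists q; split=> // n.
have [q' [i [R1 Ri ->]]] := H n; rewrite (rank_unique R1 (Rq n)).
have [i' [j [/K_iso R2 Rj ->]]] := rank_split (@KZ n) (@BK n) (sZP n) (sK n) (sBP n) (Rx n).
rewrite -(rank_unique Ri R2).
have [j' [p [/L_iso R3 Rp ->]]] := rank_split (@LZ n) (@BL n) (sZR n) (sL n) (sBR n) (Rs n).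
rewrite -(rank_unique Rj R3).
have -> : p = if n is m.+1 then q m else 0%N.
  case: n {H q' i R1 Ri i' j R2 Rj j' R3} Rp => [/conn0 //|n /conn_iso Rp]; exact: rank_unique Rp (Rq n).
by lia.
Qed.

Definition finite_type A B : Prop :=
  exists f : nat -> nat, (forall n, hrank A B n (f n)) /\
    exists N, forall n, (N <= n)%N -> f n = 0%N.

Lemma finite_type_pair : finite_type Q zeroc -> finite_type P zeroc -> finite_type P Q.
Proof.
move=> [a [Ra [N aN]]] [x [Rx [N' xN]]].
have H n : exists j, has_rank (L n) (bdr P Q n) j /\ (j <= x n)%N.
  have [i' [j [_ /L_iso Rj ->]]] := rank_split (@KZ n) (@BK n) (sZP n) (sK n) (sBP n) (Rx n).
  by exists j; rewrite leq_addl.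
have H' n : exists p, has_rank (cyc P Q n) (L n) p /\ (p <= (if n is m.+1 then a m else 0))%N.
  case: n => [|n]; first by exists 0%N; split=> //; apply/conn0.
  have [q [i [/conn_iso R _ ->]]] := rank_split (@conn_cyc n) (@bdr_conn n) (sZQ n) (sconn n) (sBQ n) (Ra n).
  by exists q; rewrite leq_addr.
have H'' n : exists s, hrank P Q n s /\ (s <= x n + (if n is m.+1 then a m else 0))%N.
  have [j [Rj jx]] := H n; have [p [Rp px]] := H' n.
  by exists (j + p)%N; split; [exact: rank_add (@LZ n) (@BL n) (sZR n) (sL n) (sBR n) Rj Rp | apply: leq_add].
have [s Hs] := choice _ H''; exists s.
split; first by move=> n; have [] := Hs n.
(* The bound is shifted by one because degree [n] of the pair involves degree [n - 1] of [Q]. *)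
exists (maxn N N').+1 => n nN; have [_] := Hs n.
rewrite xN; last by lia.
case: n nN {Hs} => // n nN; rewrite aN; last by lia.
by rewrite leqn0 => /eqP.
Qed.

Lemma finite_type_total : finite_type Q zeroc -> finite_type P Q -> finite_type P zeroc.
Proof.
move=> [a [Ra [N aN]]] [s [Rs [N' sN]]].
have H'' n : exists x, hrank P zeroc n x /\ (x <= a n + s n)%N.
  have [q [i [_ /K_iso Ri Ei]]] := rank_split (@conn_cyc n) (@bdr_conn n) (sZQ n) (sconn n) (sBQ n) (Ra n).
  have [j [p [/L_iso Rj _ Ej]]] := rank_split (@LZ n) (@BL n) (sZR n) (sL n) (sBR n) (Rs n).
  exists (i + j)%N; split; first exact: rank_add (@KZ n) (@BK n) (sZP n) (sK n) (sBP n) Ri Rj.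
  by rewrite Ei Ej leq_add // ?leq_addl ?leq_addr.
have [x Hx] := choice _ H''; exists x.
split; first by move=> n; have [] := Hx n.
exists (maxn N N') => n; rewrite geq_max => /andP[nN nN'].
have [_] := Hx n.
by rewrite aN // sN // leqn0 => /eqP.
Qed.

(** Up to homology [P] is the direct sum of [Q] and [A]. A chain with boundary in [Q] becomes
    [u + v]; the boundary of [v] lies in both summands, hence is zero, and [u] bounds inside [Q]. *)
Lemma conn_zero A n : subcomplex A -> incl A P -> (forall m x, Q m x -> A m x -> x = 0) ->
  acyclic P (sumc Q A) -> has_rank (conn n) (bdr Q zeroc n) 0.
Proof.
move=> cA AP QA0 ac; apply: rank0 => // z [[Qz _] [y [Py /eqP]]].
rewrite subr_eq0 => /eqP Ez.
have Qdy : Q n (d n y) by rewrite -Ez.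
have [w [Pw [u [v [Qu Av E]]]]] : bdr P (sumc Q A) n.+1 y.
  by apply: ac; split=> //; exists (d n y), 0; rewrite addr0; split=> //; apply: sub0; apply: cA.1.
have Ed : d n y = d n u + d n v by rewrite -raddfD -E raddfB dd subr0.
exists u; split=> //; rewrite Ez Ed addrC addKr.
apply: QA0 _ (cA.2 _ _ Av).
by rewrite -[d n v](addKr (d n u)) -Ed addrC; apply: (subB (cQ.1 n)) => //; apply: cQ.2.
Qed.
End LongExactSequence.
End Homology.
End PairHomology.

(** * Free groups and singular chains *)

Module FreeGroups.
From HB Require Import structures.
From mathcomp Require Import all_boot all_order all_algebra.
From mathcomp Require Import boolp.
From mathcomp Require Import freeg.
From Stdlib Require Import Classical ClassicalEpsilon.
Set Implicit Arguments. Unset Strict Implicit. Unset Printing Implicit Defensive.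
Import Order.TTheory GRing.Theory Num.Theory.
Import RankTheory.
Local Open Scope ring_scope.

(** The wrapper [classic] supplies equality tests classically, so that functions can serve as basis
    elements. *)
Definition free (T : Type) := {freeg {classic T} / int}.
HB.instance Definition _ T := GRing.Lmodule.on (free T).

Definition gen (T : Type) (x : T) : free T := << (x : {classic T}) >>.
Definition cf (T : Type) (x : T) (u : free T) : int := coeff (x : {classic T}) u.
HB.instance Definition _ T (x : T) :=
  GRing.isAdditive.Build (free T) int (cf x) (coeff_is_additive (x : {classic T})).
Definition ext (T T' : Type) (f : T -> free T') (u : free T) : free T' :=
  fglift (f : {classic T} -> free T') u.
HB.instance Definition _ T T' (f : T -> free T') :=
  GRing.isAdditive.Build (free T) (free T') (ext f)
    (@lift_is_additive _ {classic T} (free T') f).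

Definition supp (T : Type) (P : T -> Prop) (u : free T) : Prop :=
  forall x, cf x u != 0 -> P x.

Section Theory.
Variables (T : Type).
Implicit Types (x y : T) (u v : free T) (P Q : T -> Prop).

Lemma cf_gen x y : cf y (gen x) = (asbool (x = y))%:R.
Proof. by rewrite /cf /gen coeffU mul1r. Qed.

Lemma cf_eq u v : (forall x, cf x u = cf x v) -> u = v.
Proof. by move=> H; apply/eqP/freeg_eqP => x; apply: H. Qed.

Lemma ext_gen T' (f : T -> free T') x : ext f (gen x) = f x.
Proof. by rewrite /ext /gen liftU scale1r. Qed.

Lemma supp_subgroup P : subgroup (supp P).
Proof.
split=> [x|u v Pu Pv x]; first by rewrite raddf0 eqxx.
rewrite raddfB /=; case: (eqVneq (cf x u) 0) => [->|/Pu //].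
by rewrite sub0r oppr_eq0 => /Pv.
Qed.

Lemma supp0 P : supp P 0. Proof. exact: sub0 (supp_subgroup P). Qed.
Lemma suppB P u v : supp P u -> supp P v -> supp P (u - v).
Proof. exact: (subB (supp_subgroup P)). Qed.
Lemma suppMz P u (k : int) : supp P u -> supp P (u *~ k).
Proof. exact: (subMz (supp_subgroup P)). Qed.
Lemma supp_sum P (I : Type) (r : seq I) (C : pred I) (f : I -> free T) :
  (forall i, C i -> supp P (f i)) -> supp P (\sum_(i <- r | C i) f i).
Proof. exact: (sub_sum (supp_subgroup P)). Qed.

Lemma supp_gen P x : P x -> supp P (gen x).
Proof. by move=> Px y; rewrite cf_gen; case: asboolP => [<-|]. Qed.

(** Additive statements about chains are checked on generators; most identities below are proved in
    this way. *)
Lemma supp_ind P (S : free T -> Prop) : subgroup S ->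
  (forall x, P x -> S (gen x)) -> forall u, supp P u -> S u.
Proof.
move=> sS Sg u Pu; rewrite -[u]freeg_sumE big_seq.
apply: sub_sum => // x; rewrite mem_dom => xu.
rewrite -[coeff x u]intz -freegU_mulz; apply: subMz => //; exact: Sg (Pu _ xu).
Qed.

Lemma supp_cond P Q u : (forall x, P x -> Q x) -> supp P u -> supp Q u.
Proof. by move=> PQ Pu x /Pu /PQ. Qed.

Lemma supp_or P Q u : supp (fun x => P x \/ Q x) u ->
  exists v w, [/\ supp P v, supp Q w & u = v + w].
Proof.
pose S u := exists v w, [/\ supp P v, supp Q w & u = v + w].
move=> Pu; apply: (supp_ind (S := S) _ _ Pu).
  split=> [|? ? [v [w [Pv Qw ->]]] [v' [w' [Pv' Qw' ->]]]].
    by exists 0, 0; rewrite addr0; split=> //; exact: supp0.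
  exists (v - v'), (w - w'); split; last by rewrite opprD addrACA.
    exact: suppB.
  exact: suppB.
move=> x [Px|Qx].
  exists (gen x), 0; rewrite addr0; split=> //; first exact: supp_gen.
  exact: supp0.
exists 0, (gen x); rewrite add0r; split=> //; last exact: supp_gen.
exact: supp0.
Qed.

Lemma eq_on_supp T' P (f g : {additive free T -> free T'}) u :
  (forall x, P x -> f (gen x) = g (gen x)) -> supp P u -> f u = g u.
Proof.
move=> H Pu; apply: (supp_ind (S := fun u => f u = g u) _ H Pu).
split=> [|v w E F]; first by rewrite !raddf0.
by rewrite !raddfB E F.
Qed.

End Theory.

Lemma supp_map T T' (P : T -> Prop) (Q : T' -> Prop) (f : {additive free T -> free T'}) u :
  (forall x, P x -> supp Q (f (gen x))) -> supp P u -> supp Q (f u).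
Proof.
move=> H Pu; apply: (supp_ind (S := fun u => supp Q (f u)) _ H Pu).
split=> [|v w E F]; first by rewrite raddf0; exact: supp0.
by rewrite raddfB; exact: suppB.
Qed.
End FreeGroups.

(** * Affine chains, barycentric subdivision and its homotopy *)

Module LinearChains.
From mathcomp Require Import all_boot all_order all_algebra ring.
Set Implicit Arguments. Unset Strict Implicit. Unset Printing Implicit Defensive.
Import Order.TTheory GRing.Theory Num.Theory.
Import RankTheory FreeGroups SimplexGeometry.
Local Open Scope ring_scope.

(* Chains of affine simplices, given by their vertex lists.  The empty list is the
   generator in degree [-1], i.e. the complex is augmented; this makes the cone formula
   uniform. *)
Ltac zmod := apply: cf_eq => ?; rewrite !(raddfB, raddfD, raddfN) /=; ring.

Notation lchain := (free (list vec)).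
Implicit Types (v w : list vec) (x y : lchain) (f : vec -> vec).

Definition lbd_gen v : lchain :=
  \sum_(i < length v) gen (del i v) *~ (-1) ^+ i.
Definition lbd : {additive lchain -> lchain} := ext lbd_gen.

Definition lcone (b : vec) : {additive lchain -> lchain} := ext (fun v => gen (b :: v)).
Definition lmap f : {additive lchain -> lchain} := ext (fun v => gen (map f v)).

Definition of_length (m : nat) v : Prop := length v = m.

Lemma lconeE b v : lcone b (gen v) = gen (b :: v). Proof. exact: ext_gen. Qed.
Lemma lmapE f v : lmap f (gen v) = gen (map f v). Proof. exact: ext_gen. Qed.
Lemma lbdE v : lbd (gen v) = lbd_gen v. Proof. exact: ext_gen. Qed.

Lemma lbd_cone_gen b v : lbd (gen (b :: v)) = gen v - lcone b (lbd (gen v)).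
Proof.
rewrite !lbdE /lbd_gen big_ord_recl /=; congr (_ + _).
rewrite raddf_sum -sumrN; apply: eq_bigr => i _ /=.
by rewrite raddfMz lconeE exprS mulN1r mulrNz.
Qed.

Lemma lbd_cone b x : lbd (lcone b x) = x - lcone b (lbd x).
Proof.
apply: (supp_ind (P := fun _ => True)
  (S := fun x => lbd (lcone b x) = x - lcone b (lbd x))) => //; last first.
  by move=> v _; rewrite lconeE lbd_cone_gen.
split=> [|u w E F]; cbv beta in *; first by rewrite !raddf0 addr0.
by rewrite !raddfB E F; zmod.
Qed.

(** The cone formula and induction on the list replace the usual cancellation in a double sum of
    signs. *)
Lemma lbd_lbd x : lbd (lbd x) = 0.
Proof.
apply: (supp_ind (P := fun _ => True) (S := fun x => lbd (lbd x) = 0)) => //.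
  by split=> [|u w E F]; cbv beta in *; rewrite ?raddf0 // !raddfB E F subrr.
move=> v _; elim: v => [|b v IH].
  by rewrite lbdE /lbd_gen big_ord0 raddf0.
by rewrite lbd_cone_gen raddfB lbd_cone IH raddf0 subr0 subrr.
Qed.

Lemma lbd_length m x : supp (of_length m.+1) x -> supp (of_length m) (lbd x).
Proof.
apply: supp_map => v Hv; rewrite lbdE; apply: supp_sum => i _; apply: suppMz.
apply: supp_gen; rewrite /of_length del_length; first by rewrite Hv.
exact/ssrnat.ltP.
Qed.

Lemma lbd_map f x : lbd (lmap f x) = lmap f (lbd x).
Proof.
apply: (supp_ind (P := fun _ => True) (S := fun x => lbd (lmap f x) = lmap f (lbd x))) => //.
  by split=> [|u w E F]; cbv beta in *; rewrite ?raddf0 // !raddfB E F.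
move=> v _; rewrite lmapE !lbdE /lbd_gen raddf_sum List.length_map.
by apply: eq_bigr => i _; rewrite raddfMz lmapE del_map.
Qed.

Lemma lcone_map f b x : lcone (f b) (lmap f x) = lmap f (lcone b x).
Proof.
apply: (supp_ind (P := fun _ => True)
  (S := fun x => lcone (f b) (lmap f x) = lmap f (lcone b x))) => //.
  by split=> [|u w E F]; cbv beta in *; rewrite ?raddf0 // !raddfB E F.
by move=> v _; rewrite lmapE !lconeE lmapE.
Qed.

(** The cone from the barycentre over the subdivided boundary. The parameter [m] stands for the
    length of [v] and makes the recursion structural. *)
Fixpoint sd_rec (m : nat) v : lchain :=
  if m is m'.+1 then lcone (bary v) (ext (sd_rec m') (lbd_gen v)) else gen v.
Definition sd : {additive lchain -> lchain} := ext (fun v => sd_rec (length v) v).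

(** The chain inside the cone is chosen so that the cone formula, with the homotopy identity in
    lower dimension, yields [sd_homotopy]. *)
Fixpoint ht_rec (m : nat) v : lchain :=
  if m is m'.+1 then lcone (bary v) (gen v - ext (ht_rec m') (lbd_gen v)) else 0.
Definition ht : {additive lchain -> lchain} := ext (fun v => ht_rec (length v) v).

Lemma sdE v : sd (gen v) = sd_rec (length v) v. Proof. exact: ext_gen. Qed.
Lemma htE v : ht (gen v) = ht_rec (length v) v. Proof. exact: ext_gen. Qed.

Lemma sd0 v : length v = 0%N -> sd (gen v) = gen v.
Proof. by move=> H; rewrite sdE H. Qed.

Lemma ht0 v : length v = 0%N -> ht (gen v) = 0.
Proof. by move=> H; rewrite htE H. Qed.

Lemma sdS m v : length v = m.+1 -> sd (gen v) = lcone (bary v) (sd (lbd (gen v))).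
Proof.
move=> H; rewrite sdE H [LHS]/=; congr (lcone _ _).
have /lbd_length := supp_gen (H : of_length m.+1 v); rewrite lbdE.
move=> Hs; apply: (eq_on_supp (f := (ext (sd_rec m) : {additive lchain -> lchain})) (g := sd) _ Hs) => w Hw.
by rewrite sdE Hw; exact: ext_gen.
Qed.

Lemma htS m v : length v = m.+1 ->
  ht (gen v) = lcone (bary v) (gen v - ht (lbd (gen v))).
Proof.
move=> H; rewrite htE H [LHS]/=; congr (lcone _ (_ - _)).
have /lbd_length := supp_gen (H : of_length m.+1 v); rewrite lbdE.
move=> Hs; apply: (eq_on_supp (f := (ext (ht_rec m) : {additive lchain -> lchain})) (g := ht) _ Hs) => w Hw.
by rewrite htE Hw; exact: ext_gen.
Qed.

Lemma sd_homotopy m x : supp (of_length m) x -> lbd (ht x) = x - sd x - ht (lbd x).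
Proof.
have sS : subgroup (fun x => lbd (ht x) = x - sd x - ht (lbd x)).
  split=> [|u w E F]; cbv beta in *; first by rewrite !raddf0 !addr0.
  by rewrite !raddfB E F; zmod.
elim: m x => [|m IH] x; move: x; apply: supp_ind sS _ => v Hv.
  rewrite ht0 // sd0 // (subrr (gen v)) lbdE /lbd_gen Hv big_ord0 !raddf0 addr0 //.
have Hl : supp (of_length m) (lbd (gen v)) by apply: lbd_length; apply: supp_gen.
rewrite (htS Hv) (sdS Hv) lbd_cone raddfB /= (IH _ Hl) lbd_lbd raddf0 subr0 subKr.
by rewrite addrAC.
Qed.

Lemma sd_pieces m v : length v = m -> supp (fun w => List.In w (pieces m v)) (sd (gen v)).
Proof.
elim: m v => [|m IH] v H.
  by rewrite sd0 //; apply: supp_gen; left; case: v H.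
rewrite (sdS H) lbdE /lbd_gen H raddf_sum raddf_sum; apply: supp_sum => i _ /=.
rewrite !raddfMz; apply: suppMz.
have Hi : length (del i v) = m by rewrite del_length H //; apply/ssrnat.ltP.
apply: supp_map (IH _ Hi) => w Hw; rewrite lconeE; apply: supp_gen.
by apply: (@In_pieces _ _ i) => //; apply/ssrnat.leP; rewrite -ltnS.
Qed.

Lemma ht_vertices (P : vec -> Prop) m v :
  (forall u, u <> nil -> (forall p, List.In p u -> P p) -> P (bary u)) ->
  length v = m -> (forall p, List.In p v -> P p) ->
  supp (fun w => length w = m.+1 /\ forall p, List.In p w -> P p) (ht (gen v)).
Proof.
move=> HP; elim: m v => [|m IH] v H Hv; first by rewrite ht0 //; apply: supp0.
rewrite (htS H) raddfB; apply: suppB.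
  rewrite lconeE; apply: supp_gen; split; first by rewrite /= H.
  by move=> p [<-|]; [apply: HP => // E; rewrite E in H|exact: Hv].
rewrite lbdE /lbd_gen H !raddf_sum; apply: supp_sum => i _ /=.
rewrite !raddfMz; apply: suppMz.
have Hi : length (del i v) = m by rewrite del_length H //; apply/ssrnat.ltP.
have Hi' p : List.In p (del i v) -> P p by move/In_del; apply: Hv.
apply: supp_map (IH _ Hi Hi') => w [Hw Pw]; rewrite lconeE; apply: supp_gen.
split=> [|p [<-|]]; [by rewrite /= Hw| |exact: Pw].
by apply: HP => // E; rewrite E in H.
Qed.

Section Naturality.
Variable f : vec -> vec.
Hypothesis f_bary : forall v, bary (map f v) = f (bary v).

(** Used with [f] an affine map: subdivision of a singular simplex is defined on the standard
    simplex, and naturality transports it to each piece. *)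
Lemma sd_map m x : supp (of_length m) x -> sd (lmap f x) = lmap f (sd x).
Proof.
have sS : subgroup (fun x => sd (lmap f x) = lmap f (sd x)).
  by split=> [|u w E F]; cbv beta in *; rewrite ?raddf0 // !raddfB E F.
elim: m x => [|m IH] x; move: x; apply: supp_ind sS _ => v Hv.
  by rewrite lmapE !sd0 ?List.length_map // lmapE.
have Hl : supp (of_length m) (lbd (gen v)) by apply: lbd_length; apply: supp_gen.
rewrite (sdS Hv) lmapE (@sdS m) ?List.length_map // f_bary -lmapE lbd_map IH //.
by rewrite lcone_map.
Qed.

Lemma ht_map m x : supp (of_length m) x -> ht (lmap f x) = lmap f (ht x).
Proof.
have sS : subgroup (fun x => ht (lmap f x) = lmap f (ht x)).
  by split=> [|u w E F]; cbv beta in *; rewrite ?raddf0 // !raddfB E F.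
elim: m x => [|m IH] x; move: x; apply: supp_ind sS _ => v Hv.
  by rewrite lmapE !ht0 ?List.length_map // raddf0.
have Hl : supp (of_length m) (lbd (gen v)) by apply: lbd_length; apply: supp_gen.
rewrite (htS Hv) lmapE (@htS m) ?List.length_map // f_bary -lmapE lbd_map IH //.
by rewrite -raddfB lcone_map.
Qed.
End Naturality.
End LinearChains.

(** * Singular chains and their subdivision *)

Module SingularChains.
From mathcomp Require Import all_boot all_order all_algebra ring.
From Stdlib Require Import Classical ClassicalEpsilon FunctionalExtensionality.
Require Import Defs.
Set Implicit Arguments. Unset Strict Implicit. Unset Printing Implicit Defensive.
Import Order.TTheory GRing.Theory Num.Theory.
Import RankTheory PairHomology FreeGroups SimplexGeometry SingularSimplices LinearChains.
Local Open Scope ring_scope.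

Section Chains.
Variable X : FinT0Space.
Notation schain := (free (simp X)).
Notation pset := (pt X -> Prop).
Implicit Types (s : simp X) (x y : schain) (P Q : pset -> Prop).

Definition sbd_gen n s : schain :=
  \sum_(i < n.+2) gen (nf X n (fun t => s (face i t))) *~ (-1) ^+ i.
Definition sbd n : {additive schain -> schain} := ext (sbd_gen n).

(** Pushes affine [n]-chains forward along [s]. Boundary, subdivision and homotopy of [s] are images
    under it of the universal ones on the standard simplex. *)
Definition ev n s : {additive lchain -> schain} :=
  ext (fun v => gen (nf X n (fun t => s (aff v t)))).

Lemma sbdE n s : sbd n (gen s) = sbd_gen n s. Proof. exact: ext_gen. Qed.
Lemma evE n s v : ev n s (gen v) = gen (nf X n (fun t => s (aff v t))).
Proof. exact: ext_gen. Qed.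

Lemma face_in_ord n (i : 'I_n.+2) t : in_simplex n t -> in_simplex n.+1 (face i t).
Proof. by apply: face_in; apply/ssrnat.leP; rewrite -ltnS. Qed.

Lemma sbd_nf n s : sbd n (gen (nf X n.+1 s)) = sbd n (gen s).
Proof.
rewrite !sbdE; apply: eq_bigr => i _; congr (gen _ *~ _).
by apply: nf_precomp => t; apply: face_in_ord.
Qed.

Lemma sbd_ev n s (x : lchain) : supp (of_length n.+2) x ->
  sbd n (ev n.+1 s x) = ev n s (lbd x).
Proof.
move=> Hx; apply: (supp_ind (S := fun x : lchain => sbd n (ev n.+1 s x) = ev n s (lbd x)) _ _ Hx).
  by split=> [|u w E F]; cbv beta in *; rewrite ?raddf0 // !raddfB E F.
move=> v Hv; rewrite evE sbd_nf sbdE lbdE /sbd_gen /lbd_gen Hv raddf_sum.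
apply: eq_bigr => i _; rewrite raddfMz evE; congr (gen (nf X n _) *~ _).
apply: functional_extensionality => t; rewrite aff_face //.
by rewrite Hv; apply/ssrnat.ltP.
Qed.

Lemma ev_basis n s : ev n s (gen (basis n)) = gen (nf X n s).
Proof.
rewrite evE; congr gen; apply: agree_nf => t Ht; by rewrite aff_basis.
Qed.

Lemma basis_supp n : supp (of_length n.+1) (gen (basis n)).
Proof. by apply: supp_gen; apply: basis_length. Qed.

Lemma sbd_basis n s : sbd n (gen s) = ev n s (lbd (gen (basis n.+1))).
Proof. by rewrite -sbd_nf -ev_basis sbd_ev //; apply: basis_supp. Qed.

Lemma sbd_sbd n x : sbd n (sbd n.+1 x) = 0.
Proof.
apply: (supp_ind (P := fun _ => True) (S := fun x => sbd n (sbd n.+1 x) = 0)) => //.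
  by split=> [|u w E F]; cbv beta in *; rewrite ?raddf0 // !raddfB E F subr0.
move=> s _; rewrite sbd_basis sbd_ev; first by rewrite lbd_lbd raddf0.
by apply: lbd_length; apply: basis_supp.
Qed.

Lemma ev_aff n s v (x : lchain) :
  ev n (fun t => s (aff v t)) x = ev n s (lmap (aff v) x).
Proof.
apply: (supp_ind (P := fun _ => True)
  (S := fun x : lchain => ev n (fun t => s (aff v t)) x = ev n s (lmap (aff v) x))) => //.
  by split=> [|u w E F]; cbv beta in *; rewrite ?raddf0 // !raddfB E F.
move=> w _; rewrite lmapE !evE; congr (gen (nf X n _)).
by apply: functional_extensionality => t; rewrite aff_aff.
Qed.

Definition vertices_in n m (v : list vec) : Prop :=
  length v = m.+1 /\ forall p, List.In p v -> in_simplex n p.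

(** Normalization changes [s] only off the simplex, whence the condition on the vertices. *)
Lemma ev_nf n m s (x : lchain) : supp (vertices_in n m) x -> ev m (nf X n s) x = ev m s x.
Proof.
move=> Hx; apply: (supp_ind (S := fun x : lchain => ev m (nf X n s) x = ev m s x) _ _ Hx).
  by split=> [|u w E F]; cbv beta in *; rewrite ?raddf0 // !raddfB E F.
move=> v [Hl Hv]; rewrite !evE; congr gen; apply: nf_precomp => t Ht.
exact: (aff_in v n m t Hl Hv Ht).
Qed.

Definition ssd n : {additive schain -> schain} :=
  ext (fun s => ev n s (sd (gen (basis n)))).
Definition sht n : {additive schain -> schain} :=
  ext (fun s => ev n.+1 s (ht (gen (basis n)))).

Lemma ssdE n s : ssd n (gen s) = ev n s (sd (gen (basis n))). Proof. exact: ext_gen. Qed.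
Lemma shtE n s : sht n (gen s) = ev n.+1 s (ht (gen (basis n))). Proof. exact: ext_gen. Qed.

Lemma sd_vertices n m v : vertices_in n m v -> supp (vertices_in n m) (sd (gen v)).
Proof.
move=> [Hl Hv]; apply: supp_cond (sd_pieces Hl) => w Hw; split.
  exact: pieces_length Hl Hw.
exact: pieces_in Hl Hv Hw.
Qed.

Lemma ht_vertices_in n m v : vertices_in n m v -> supp (vertices_in n m.+1) (ht (gen v)).
Proof. by move=> [Hl Hv]; apply: ht_vertices => // u; apply: bary_in. Qed.

Lemma basis_vertices n : vertices_in n n (basis n).
Proof. by split; [apply: basis_length|apply: basis_in]. Qed.

Lemma ssd_ev n s (x : lchain) : supp (of_length n.+1) x -> ssd n (ev n s x) = ev n s (sd x).
Proof.
move=> Hx; apply: (supp_ind (S := fun x : lchain => ssd n (ev n s x) = ev n s (sd x)) _ _ Hx).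
  by split=> [|u w E F]; cbv beta in *; rewrite ?raddf0 // !raddfB E F.
move=> v Hv; rewrite evE ssdE ev_nf; last exact/sd_vertices/basis_vertices.
rewrite ev_aff -(@sd_map _ (bary_map_aff v) n.+1); last exact: basis_supp.
by rewrite lmapE; congr (ev _ _ (_ (gen _))); apply: map_aff_basis.
Qed.

Lemma sht_ev n s (x : lchain) : supp (of_length n.+1) x -> sht n (ev n s x) = ev n.+1 s (ht x).
Proof.
move=> Hx; apply: (supp_ind (S := fun x : lchain => sht n (ev n s x) = ev n.+1 s (ht x)) _ _ Hx).
  by split=> [|u w E F]; cbv beta in *; rewrite ?raddf0 // !raddfB E F.
move=> v Hv; rewrite evE shtE ev_nf; last exact/ht_vertices_in/basis_vertices.
rewrite ev_aff -(@ht_map _ (bary_map_aff v) n.+1); last exact: basis_supp.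
by rewrite lmapE; congr (ev _ _ (_ (gen _))); apply: map_aff_basis.
Qed.

Definition prev_ht n x : schain := if n is m.+1 then sht m (sbd m x) else 0.

Lemma ssd_homotopy_gen n s :
  sbd n (sht n (gen s)) = gen (nf X n s) - ssd n (gen s) - prev_ht n (gen s).
Proof.
rewrite shtE sbd_ev; last first.
  by apply: supp_cond (ht_vertices_in (basis_vertices n)) => v [].
rewrite (sd_homotopy (m := n.+1)); last exact: basis_supp.
rewrite !raddfB /= ev_basis -ssdE; congr (_ - _).
case: n => [|n] /=.
  (* In degree 0 the augmented boundary is the empty list, on which [ht] vanishes; this agrees with
     the unaugmented convention of [prev_ht]. *)
  by rewrite lbdE /lbd_gen /= big_ord_recl big_ord0 /= mulr1z addr0 ht0 ?raddf0.
rewrite sbd_basis sht_ev //; apply: lbd_length; exact: basis_supp.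
Qed.

Definition good P n s : Prop :=
  [/\ nf X n s = s, sing_continuous X n s & P (image X n s)].
Definition chains P : nat -> schain -> Prop := fun n => supp (good P n).

Definition hereditary P : Prop := forall I J : pset, (forall a, I a -> J a) -> P J -> P I.

Lemma good_nf P n s : sing_continuous X n s -> P (image X n s) -> good P n (nf X n s).
Proof. by move=> Cs Ps; split; rewrite ?nf_idem ?image_nf //; apply: continuous_nf. Qed.

Lemma chains_sub P : hereditary P -> subcomplex sbd (chains P).
Proof.
move=> hP; split=> [n|n x Hx]; first exact: supp_subgroup.
apply: (supp_map (Q := good P n) _ Hx) => s [Ns Cs Ps]; rewrite sbdE /sbd_gen; apply: supp_sum => i _; apply: suppMz.
have Hi : (i <= S n)%coq_nat by apply/ssrnat.leP; rewrite -ltnS.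
apply: supp_gen; apply: good_nf; first exact: (continuous_face X n s i Hi Cs).
exact: (hP _ _ (fun a => image_face X n s i a Hi) Ps).
Qed.

Lemma chains_incl P Q : (forall I, P I -> Q I) -> incl (chains P) (chains Q).
Proof. by move=> PQ n x; apply: supp_cond => s [? ? ?]; split=> //; apply: PQ. Qed.

Lemma chains_cap P Q : chains (fun I => P I /\ Q I) = capc (chains P) (chains Q).
Proof.
apply: functional_extensionality => n; apply: functional_extensionality => x.
apply: boolp.propext; split=> [Hx|[Hx Hy] s Hs].
  by split; apply: supp_cond Hx => s [? ? []].
by have [? ? ?] := Hx s Hs; have [_ _ ?] := Hy s Hs.
Qed.

Lemma chains_cup P Q : chains (fun I => P I \/ Q I) = sumc (chains P) (chains Q).
Proof.
apply: functional_extensionality => n; apply: functional_extensionality => x.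
apply: boolp.propext; split=> [Hx|[a [b [Ha Hb ->]]]].
  have /supp_or [v [w [Hv Hw ->]]] : supp (fun s => good P n s \/ good Q n s) x.
    by apply: supp_cond Hx => s [? ? []]; [left|right].
  by exists v, w.
apply: (subD (supp_subgroup _)).
  by apply: supp_cond Ha => s [? ? ?]; split=> //; left.
by apply: supp_cond Hb => s [? ? ?]; split=> //; right.
Qed.

Lemma chains_empty : chains (fun I => forall a, ~ I a) = @zeroc schain.
Proof.
apply: functional_extensionality => n; apply: functional_extensionality => x.
apply: boolp.propext; split=> [Hx|->]; last exact: supp0.
apply: cf_eq => s; rewrite raddf0; apply/eqP/negPn/negP => /Hx [_ _ H].
exact: H (image_nonempty X n s).
Qed.

Lemma ev_good P n m s (x : lchain) : hereditary P -> sing_continuous X n s -> P (image X n s) ->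
  supp (vertices_in n m) x -> chains P m (ev m s x).
Proof.
move=> hP Cs Ps Hx; apply: (supp_map (Q := good P m) _ Hx) => v [Hl Hv]; rewrite evE; apply: supp_gen; apply: good_nf.
  exact: (continuous_aff X n m s v Hl Hv Cs).
exact: (hP _ _ (fun a => image_aff X n m s v a Hl Hv) Ps).
Qed.

Lemma ssd_chains P n x : hereditary P -> chains P n x -> chains P n (ssd n x).
Proof.
move=> hP Hx; apply: (supp_map (Q := good P n) _ Hx) => s [Ns Cs Ps]; rewrite ssdE; apply: (ev_good hP Cs Ps).
exact/sd_vertices/basis_vertices.
Qed.

Lemma sht_chains P n x : hereditary P -> chains P n x -> chains P n.+1 (sht n x).
Proof.
move=> hP Hx; apply: (supp_map (Q := good P n.+1) _ Hx) => s [Ns Cs Ps]; rewrite shtE; apply: (ev_good hP Cs Ps).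
exact/ht_vertices_in/basis_vertices.
Qed.

Lemma ssd_homotopy P n x : chains P n x -> sbd n (sht n x) = x - ssd n x - prev_ht n x.
Proof.
move=> Hx; apply: (supp_ind (S := fun x => sbd n (sht n x) = x - ssd n x - prev_ht n x) _ _ Hx).
  split=> [|u w E F]; cbv beta in *; first by rewrite /prev_ht; case: n {Hx} => [|n]; rewrite !raddf0 ?addr0 // oppr0 addr0.
  rewrite !raddfB E F {E F} /prev_ht; case: n {Hx} => [|n]; rewrite ?raddfB; zmod.
by move=> s [Ns _ _]; rewrite ssd_homotopy_gen Ns.
Qed.

(** Purely formal: the boundary is applied to the homotopy identity, which is then used again one
    degree lower. *)
Lemma sbd_ssd P n x : hereditary P -> chains P n.+1 x -> sbd n (ssd n.+1 x) = ssd n (sbd n x).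
Proof.
move=> hP Hx.
have E := ssd_homotopy Hx.
have -> : ssd n.+1 x = x - sbd n.+1 (sht n.+1 x) - prev_ht n.+1 x by rewrite E; zmod.
have Hdx := (chains_sub hP).2 _ _ Hx.
rewrite !raddfB sbd_sbd /= (ssd_homotopy Hdx).
have -> : prev_ht n (sbd n x) = 0.
  by case: n x {Hx E Hdx} => //= n x; rewrite sbd_sbd raddf0.
zmod.
Qed.

Lemma ssd_cyc P Q n x : hereditary P -> hereditary Q -> cyc sbd (chains P) (chains Q) n x ->
  cyc sbd (chains P) (chains Q) n (ssd n x).
Proof.
move=> hP hQ [Px Qx]; split; first exact: ssd_chains.
case: n Px Qx => // n Px Qx; rewrite (sbd_ssd hP Px); exact: ssd_chains.
Qed.

(** The homotopy from subdivision to the identity preserves both subcomplexes. *)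
Lemma ssd_bdr P Q n x : hereditary P -> hereditary Q ->
  cyc sbd (chains P) (chains Q) n x -> bdr sbd (chains P) (chains Q) n (ssd n x) ->
  bdr sbd (chains P) (chains Q) n x.
Proof.
move=> hP hQ [Px Qx] [y [Py Qy]]; exists (y + sht n x); split.
  by apply: (subD (supp_subgroup _)) => //; apply: sht_chains.
rewrite raddfD /= (ssd_homotopy Px).
have -> : x - (sbd n y + (x - ssd n x - prev_ht n x)) = ssd n x - sbd n y + prev_ht n x by zmod.
apply: (subD (supp_subgroup _)) => //.
by case: n x y Px Qx Py Qy => [|n] x y Px Qx Py Qy; [exact: supp0|exact: sht_chains].
Qed.

Lemma ssd_iter_bdr P Q n k x : hereditary P -> hereditary Q ->
  cyc sbd (chains P) (chains Q) n x ->
  (cyc sbd (chains P) (chains Q) n (iter k (ssd n) x) ->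
   bdr sbd (chains P) (chains Q) n (iter k (ssd n) x)) ->
  bdr sbd (chains P) (chains Q) n x.
Proof.
move=> hP hQ; elim: k x => [|k IH] x Cx H; first exact: H.
apply: ssd_bdr => //; apply: IH; first exact: ssd_cyc.
by rewrite -iterSr.
Qed.
End Chains.
End SingularChains.

(** * Small chains and Mayer-Vietoris gluing *)

Module SingularHomology.
From mathcomp Require Import all_boot all_order all_algebra ring.
From Stdlib Require Import Classical ClassicalEpsilon FunctionalExtensionality.
Require Import Defs.
Set Implicit Arguments. Unset Strict Implicit. Unset Printing Implicit Defensive.
Import Order.TTheory GRing.Theory Num.Theory.
Import RankTheory PairHomology FreeGroups SimplexGeometry SingularSimplices LinearChains.
Import SingularChains FiniteSpaces.
Local Open Scope ring_scope.

Section Homology.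
Variable X : FinT0Space.
Notation schain := (free (simp X)).
Notation pset := (pt X -> Prop).
Notation sbd := (sbd X).
Notation ssd := (ssd X).
Implicit Types (s : simp X) (x y : schain) (P Q L : pset -> Prop) (A B C U W : pset).

Definition sub A : pset -> Prop := fun I => forall a, I a -> A a.

Lemma sub_hereditary A : hereditary (sub A).
Proof. by move=> I J IJ HJ a /IJ /HJ. Qed.

Lemma or_hereditary P Q : hereditary P -> hereditary Q -> hereditary (fun I => P I \/ Q I).
Proof. by move=> hP hQ I J IJ [H|H]; [left; apply: hP H|right; apply: hQ H]. Qed.

Lemma and_hereditary P Q : hereditary P -> hereditary Q -> hereditary (fun I => P I /\ Q I).
Proof. by move=> hP hQ I J IJ [H H']; split; [apply: hP H|apply: hQ H']. Qed.

Lemma chains_ext P Q : (forall I, P I <-> Q I) -> chains P = chains Q.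
Proof.
move=> H; congr chains; apply: functional_extensionality => I.
exact/boolp.propext.
Qed.

Lemma iter_ssdB n k x y : iter k (ssd n) (x - y) = iter k (ssd n) x - iter k (ssd n) y.
Proof. by elim: k => //= k ->; rewrite raddfB. Qed.

Lemma iter_ssd_chains P n k x : hereditary P -> chains P n x -> chains P n (iter k (ssd n) x).
Proof. by move=> hP Hx; elim: k => //= k; apply: ssd_chains. Qed.

(** Further subdivision preserves [chains P n], so simplices needing [k] and [l] subdivisions can
    both be subdivided [k + l] times. *)
Lemma eventually_chains P n x : hereditary P ->
  supp (fun s => exists k, chains P n (iter k (ssd n) (gen s))) x ->
  exists k, chains P n (iter k (ssd n) x).
Proof.
move=> hP Hx.
apply: (supp_ind (S := fun x => exists k, chains P n (iter k (ssd n) x)) _ _ Hx) => //.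
split=> [|u v [k Hk] [l Hl]]; first by exists 0%N; apply: supp0.
exists (k + l)%N; rewrite iter_ssdB; apply: suppB.
  by rewrite addnC iterD; apply: iter_ssd_chains.
by rewrite iterD; apply: iter_ssd_chains.
Qed.

Lemma small_chains P U W n x : hereditary P -> is_open X U -> is_open X W ->
  (forall I a, P I -> I a -> U a \/ W a) -> chains P n x ->
  exists k, chains (fun I => P I /\ (sub U I \/ sub W I)) n (iter k (ssd n) x).
Proof.
move=> hP oU oW cov Hx.
have hP' : hereditary (fun I => P I /\ (sub U I \/ sub W I)).
  by apply: and_hereditary => //; apply: or_hereditary; apply: sub_hereditary.
apply: eventually_chains => //; apply: supp_cond Hx => s [Ns Cs Ps].
have := continuous_subdivision X n s U W Cs oU oW (fun a => cov _ a Ps).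
(* Generalizing from [basis n] to all affine simplices inside it permits induction on the tree of
   subdivisions. *)
suff G v : vertices_in n n v ->
    eventually (fun v => sub U (image X n (fun t => s (aff v t))) \/
                         sub W (image X n (fun t => s (aff v t)))) n.+1 v ->
    exists k, chains (fun I => P I /\ (sub U I \/ sub W I)) n (iter k (ssd n) (ev n s (gen v))).
  by move=> /(G _ (basis_vertices n)); rewrite ev_basis Ns.
move=> Hv Ev; elim: Ev Hv => {}v.
  move=> Hsm [Hl Hv]; exists 0%N; rewrite /= evE; apply: supp_gen; apply: good_nf.
    exact: (continuous_aff X n n s v Hl Hv Cs).
  by split=> //; exact: (hP _ _ (fun a => image_aff X n n s v a Hl Hv) Ps).
move=> _ IH Hv.
have Hsd : supp (fun w => exists k, chains (fun I => P I /\ (sub U I \/ sub W I)) n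
    (iter k (ssd n) (ev n s (gen w)))) (sd (gen v)).
  apply: supp_cond (sd_pieces Hv.1) => w Hw; apply: IH => //; split.
    exact: (pieces_length _ _ _ Hv.1 Hw).
  exact: (pieces_in _ _ _ _ Hv.1 Hv.2 Hw).
have [k Hk] : exists k, chains (fun I => P I /\ (sub U I \/ sub W I)) n
    (iter k (ssd n) (ev n s (sd (gen v)))).
  apply: (supp_ind (S := fun x : lchain => exists k,
    chains (fun I => P I /\ (sub U I \/ sub W I)) n (iter k (ssd n) (ev n s x))) _ _ Hsd) => //.
  split=> [|u w [k Hk] [l Hl]]; first by exists 0%N; rewrite raddf0; apply: supp0.
  exists (k + l)%N; rewrite raddfB iter_ssdB; apply: suppB.
    by rewrite addnC iterD; apply: iter_ssd_chains.
  by rewrite iterD; apply: iter_ssd_chains.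
exists k.+1; rewrite iterSr ssd_ev //; apply: supp_gen; exact: Hv.1.
Qed.

Lemma acyclic_small P U W : hereditary P -> is_open X U -> is_open X W ->
  (forall I a, P I -> I a -> U a \/ W a) ->
  acyclic sbd (chains P) (chains (fun I => P I /\ (sub U I \/ sub W I))).
Proof.
move=> hP oU oW cov n x Cx.
have hP' : hereditary (fun I => P I /\ (sub U I \/ sub W I)).
  by apply: and_hereditary => //; apply: or_hereditary; apply: sub_hereditary.
have [k Hk] := small_chains hP oU oW cov Cx.1.
by apply: (ssd_iter_bdr (k := k)) => // _; apply: bdr_r => //; apply: chains_sub.
Qed.

Lemma chains_meet P Q L n x : (forall I, P I -> Q I -> L I) ->
  chains P n x -> chains Q n x -> chains L n x.
Proof.
move=> H HP HQ s Hs; have [N Cs Ps] := HP s Hs; have [_ _ Qs] := HQ s Hs.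
by split=> //; apply: H.
Qed.

(* The five lemma for the Mayer-Vietoris sequences of [U] and [W], on the level of chains. *)
Lemma acyclic_glue P L U W : hereditary P -> hereditary L -> is_open X U -> is_open X W ->
  (forall I a, P I -> I a -> U a \/ W a) ->
  let R V I := P I /\ sub V I in
  acyclic sbd (chains (R U)) (chains (fun I => R U I /\ L I)) ->
  acyclic sbd (chains (R W)) (chains (fun I => R W I /\ L I)) ->
  acyclic sbd (chains (R (fun a => U a /\ W a))) (chains (fun I => R (fun a => U a /\ W a) I /\ L I)) ->
  acyclic sbd (chains P) (chains (fun I => P I /\ L I)).
Proof.
move=> hP hL oU oW cov R acU acW acUW n x Cx.
have hPL : hereditary (fun I => P I /\ L I) by apply: and_hereditary.
have hR V : hereditary (R V) by apply: and_hereditary => //; apply: sub_hereditary.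
have cR V := chains_sub (hR V).
have hRL V : hereditary (fun I => R V I /\ L I) by apply: and_hereditary.
have cRL V := chains_sub (hRL V).
have hP' : hereditary (fun I => P I /\ (sub U I \/ sub W I)).
  by apply: and_hereditary => //; apply: or_hereditary; apply: sub_hereditary.
have [k Hk] := small_chains hP oU oW cov Cx.1.
apply: (ssd_iter_bdr (k := k)) => //; move: (iter _ _ _) Hk => {Cx}x Hx [Px Lx].
have {Hx}Hx : chains (fun I => R U I \/ R W I) n x.
  by apply: chains_incl Hx => I [PI [H|H]]; [left|right].
(* The boundary is split along the cover within [L]. The matches make all conditions on boundaries
   void in degree 0. *)
have {Lx} [l1 [l2 [Hl1 Hl2 El]]] : exists l1 l2,
    [/\ match n return schain -> Prop with 0 => fun=> True | m.+1 => chains (fun I => R U I /\ L I) m end l1,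
        match n return schain -> Prop with 0 => fun=> True | m.+1 => chains (fun I => R W I /\ L I) m end l2 &
        match n with 0 => True | m.+1 => sbd m x = l1 + l2 end].
  case: n x Px Lx Hx => [|n] x Px Lx Hx; first by exists 0, 0.
  have Hdx := (chains_sub (or_hereditary (hR U) (hR W))).2 _ _ Hx.
  have : chains (fun I => (R U I /\ L I) \/ (R W I /\ L I)) n (sbd n x).
    by apply: chains_meet Hdx Lx => I; rewrite /R; tauto.
  by rewrite chains_cup => -[l1 [l2 [H1 H2 E]]]; exists l1, l2.
move: Hx; rewrite chains_cup => -[x1 [x2 [Hx1 Hx2 Ex]]].
(* The parts [x1] and [x2] need not be relative cycles. Their defects cancel:
   [sbd n x1 - l1 = l2 - sbd n x2] lives over the intersection, where it is the boundary of some [d]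
   up to [L]. Moving [d] from [x1] to [x2] corrects both. *)
have [d [Hd [He1 He2]]] : exists d, chains (R (fun a => U a /\ W a)) n d /\
   (match n return schain -> Prop with 0 => fun=> True | m.+1 =>
     fun d => chains (fun I => R U I /\ L I) m (sbd m (x1 - d)) end d /\
    match n return schain -> Prop with 0 => fun=> True | m.+1 =>
     fun d => chains (fun I => R W I /\ L I) m (sbd m (x2 + d)) end d).
  case: n x x1 x2 l1 l2 Px Hl1 Hl2 El Hx1 Hx2 Ex => [|n] x x1 x2 l1 l2 Px Hl1 Hl2 El Hx1 Hx2 Ex.
    by exists 0; split=> //; apply: supp0.
  have E : sbd n x1 - l1 = l2 - sbd n x2.
    apply/eqP; rewrite subr_eq addrAC eq_sym subr_eq; apply/eqP.
    by rewrite -raddfD -Ex El addrC.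
  have He : chains (R (fun a => U a /\ W a)) n (sbd n x1 - l1).
    apply: (@chains_meet (R U) (R W)).
    - by move=> I [PI UI] [_ WI]; split=> // a Ia; split; [apply: UI|apply: WI].
    - by apply: suppB; [apply: (cR U).2|apply: chains_incl Hl1 => I []].
    - by rewrite E; apply: suppB; [apply: chains_incl Hl2 => I []|apply: (cR W).2].
  have [d [Hd Hl]] : bdr sbd (chains (R (fun a => U a /\ W a)))
      (chains (fun I => R (fun a => U a /\ W a) I /\ L I)) n (sbd n x1 - l1).
    apply: acUW; split=> //; case: n x x1 x2 l1 l2 Px Hl1 Hl2 El Hx1 Hx2 Ex E He => // n x x1 x2 l1 l2 Px Hl1 Hl2 El Hx1 Hx2 Ex E He.
    apply: (@chains_meet (fun I => R U I /\ L I) (fun I => R W I /\ L I)).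
    - by move=> I [[PI UI] LI] [[_ WI] _]; split=> //; split=> // a Ia; split; [apply: UI|apply: WI].
    - by rewrite raddfB sbd_sbd sub0r; apply: (subN (supp_subgroup _)); apply: (cRL U).2.
    - by rewrite E raddfB sbd_sbd subr0; apply: (cRL W).2.
  exists d; split=> //; split.
    have -> : sbd n (x1 - d) = l1 + (sbd n x1 - l1 - sbd n d) by rewrite raddfB; zmod.
    apply: (subD (supp_subgroup _)) => //.
    by apply: chains_incl Hl => I [[PI H] LI]; split=> //; split=> // a /H [].
  have -> : sbd n (x2 + d) = l2 - (sbd n x1 - l1 - sbd n d) by rewrite E raddfD; zmod.
  apply: suppB => //.
  by apply: chains_incl Hl => I [[PI H] LI]; split=> //; split=> // a /H [].
have RU I : R (fun a => U a /\ W a) I -> R U I by move=> [PI H]; split=> // a /H [].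
have RW I : R (fun a => U a /\ W a) I -> R W I by move=> [PI H]; split=> // a /H [].
have [d1 [Hd1 H1]] : bdr sbd (chains (R U)) (chains (fun I => R U I /\ L I)) n (x1 - d).
  apply: acU; split; first by apply: suppB => //; apply: chains_incl Hd.
  by case: n {Px Hl1 Hl2 El Hx1 Hx2 Ex Hd He2} He1.
have [d2 [Hd2 H2]] : bdr sbd (chains (R W)) (chains (fun I => R W I /\ L I)) n (x2 + d).
  apply: acW; split; first by apply: (subD (supp_subgroup _)) => //; apply: chains_incl Hd.
  by case: n {Px Hl1 Hl2 El Hx1 Hx2 Ex Hd He1 Hd1 H1} He2.
exists (d1 + d2); split.
  by apply: (subD (supp_subgroup _)); [apply: chains_incl Hd1 => I []|apply: chains_incl Hd2 => I []].
have -> : x - sbd n (d1 + d2) = (x1 - d - sbd n d1) + (x2 + d - sbd n d2) by rewrite Ex raddfD; zmod.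
apply: (subD (supp_subgroup _)).
  by apply: chains_incl H1 => I [[]].
by apply: chains_incl H2 => I [[]].
Qed.
End Homology.
End SingularHomology.

(** * Homology of finite spaces *)

Module FiniteSpaceHomology.
From mathcomp Require Import all_boot all_order all_algebra ring.
From Stdlib Require Import Classical ClassicalEpsilon FunctionalExtensionality.
Require Import Defs.
Set Implicit Arguments. Unset Strict Implicit. Unset Printing Implicit Defensive.
Import Order.TTheory GRing.Theory Num.Theory.
Import RankTheory PairHomology FreeGroups SimplexGeometry SingularSimplices LinearChains.
Import SingularChains FiniteSpaces SingularHomology.
Local Open Scope ring_scope.

Section Homology.
Variable X : FinT0Space.
Notation schain := (free (simp X)).
Notation pset := (pt X -> Prop).
Notation sbd := (sbd X).
Implicit Types (s : simp X) (P Q L : pset -> Prop) (A B C U W : pset).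

Section Cone.
Variable a : pt X.

Definition pcone n : {additive schain -> schain} :=
  ext (fun s => gen (nf X n.+1 (cone X a s))).
Definition point : schain := gen (nf X 0 (fun _ => a)).

Lemma pconeE n s : pcone n (gen s) = gen (nf X n.+1 (cone X a s)).
Proof. exact: ext_gen. Qed.

Lemma pcone_nf n s : pcone n (gen (nf X n s)) = pcone n (gen s).
Proof. by rewrite !pconeE; congr gen; apply: agree_nf; apply: cone_agree; apply: nf_agree. Qed.

Lemma sbd_pcone n s : sbd n.+1 (pcone n.+1 (gen s)) =
  gen (nf X n.+1 s) - pcone n (sbd n (gen s)).
Proof.
rewrite pconeE sbd_nf !sbdE /sbd_gen big_ord_recl /= mulr1z; congr (_ + _).
  by congr gen; apply: agree_nf => t Ht; apply: (cone_face0 X n.+1).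
rewrite raddf_sum -sumrN; apply: eq_bigr => i _.
rewrite raddfMz pcone_nf pconeE exprS mulN1r mulrNz; congr (- (gen (nf X _ _) *~ _)).
by apply: functional_extensionality => t; rewrite cone_faceS.
Qed.

Lemma sbd_pcone0 s : sbd 0 (pcone 0 (gen s)) = gen (nf X 0 s) - point.
Proof.
rewrite pconeE sbd_nf !sbdE /sbd_gen !big_ord_recl big_ord0 /= mulr1z addr0.
rewrite expr1 mulrN1z; congr (gen _ - gen _); apply: agree_nf => t Ht.
  exact: (cone_face0 X 0).
exact: cone_face1_vertex.
Qed.

Variable P : pset -> Prop.
Hypothesis hP : hereditary P.
Hypothesis P_nbhd : forall I, P I -> forall y, I y -> minopen X a y.
Hypothesis P_add : forall I, P I -> P (fun y => y = a \/ I y).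

(** [P_nbhd] makes the cone continuous, [P_add] keeps its image admissible. *)
Lemma pcone_chains n x : chains P n x -> chains P n.+1 (pcone n x).
Proof.
move=> Hx; apply: (supp_map (Q := good P n.+1) _ Hx) => s [Ns Cs Ps].
rewrite pconeE; apply: supp_gen; apply: good_nf.
  apply: (continuous_cone X n a s Cs) => U oU Ua y Iy.
  exact: P_nbhd Ps _ Iy U oU Ua.
exact: (hP (image_cone X n a s) (P_add Ps)).
Qed.

Lemma point_chains : P (fun y => y = a) -> chains P 0 point.
Proof.
move=> Pa; apply: supp_gen; apply: good_nf.
  exact: continuous_const.
by apply: hP Pa => y [t [_ <-]].
Qed.

Lemma pcone_homotopy n x : chains P n.+1 x -> sbd n.+1 (pcone n.+1 x) = x - pcone n (sbd n x).
Proof.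
move=> Hx; apply: (supp_ind (S := fun x => sbd n.+1 (pcone n.+1 x) = x - pcone n (sbd n x)) _ _ Hx).
  split=> [|u w E F]; cbv beta in *; first by rewrite !raddf0 addr0.
  by rewrite !raddfB E F; zmod.
by move=> s [Ns _ _]; rewrite sbd_pcone Ns.
Qed.

(** Singular chains are not augmented, so a multiple of the apex survives; [m] is the sum of the
    coefficients of [x]. *)
Lemma pcone_homotopy0 x : chains P 0 x -> exists m : int, sbd 0 (pcone 0 x) = x - point *~ m.
Proof.
move=> Hx; apply: (supp_ind (S := fun x => exists m : int, sbd 0 (pcone 0 x) = x - point *~ m) _ _ Hx).
  split=> [|u w [k E] [l F]]; first by exists 0; rewrite mulr0z !raddf0 addr0.
  by exists (k - l); rewrite !raddfB E F; zmod.
by move=> s [Ns _ _]; exists 1; rewrite sbd_pcone0 Ns.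
Qed.

(** The contraction leaves rank at most one in degree 0 and rank zero above. *)
Lemma finite_type_cone : P (fun y => y = a) -> finite_type sbd (chains P) (@zeroc schain).
Proof.
move=> Pa.
have cP := chains_sub hP.
have H n : exists r, hrank sbd (chains P) (@zeroc schain) n r /\ (r <= (n == 0))%N.
  have sB : subgroup (bdr sbd (chains P) (@zeroc schain) n).
    by apply: bdr_subgroup => //; apply: zeroc_sub.
  case: n sB => [|n] sB.
    have [r r1 Hr] : exists2 r, (r <= 1)%N & hrank sbd (chains P) (@zeroc schain) 0 r.
      apply: rank_exists; apply: (spans_bound sB (g := fun _ => point)) => x [Px _].
      have [m Hm] := pcone_homotopy0 Px.
      exists 1, (fun _ => m); split=> //; exists (pcone 0 x); split; first exact: pcone_chains.
      by rewrite big_ord1 mulr1z Hm subrr.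
    by exists r.
  exists 0%N; split=> //; apply: rank0 => // x [Px Dx]; exists (pcone n.+1 x); split.
    exact: pcone_chains.
  by rewrite (pcone_homotopy Px) Dx raddf0 subr0 /zeroc subrr.
have [f Hf] := choice _ H; exists f; split=> [n|]; first exact: (Hf n).1.
by exists 1%N => -[|n] // _; move: (Hf n.+1).2; rewrite leqn0 => /eqP.
Qed.
End Cone.

(** One contraction to [a] works for both complexes. It carries the boundary of a relative cycle
    into [Q], and in degree 0 the surviving apex is already in [Q]. *)
Lemma acyclic_cone a P Q : hereditary P -> hereditary Q -> (forall I, Q I -> P I) ->
  (forall I, P I -> forall y, I y -> minopen X a y) ->
  (forall I, P I -> P (fun y => y = a \/ I y)) ->
  (forall I, Q I -> Q (fun y => y = a \/ I y)) -> Q (fun y => y = a) ->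
  acyclic sbd (chains P) (chains Q).
Proof.
move=> hP hQ QP Pn Padd Qadd Qa [|n] x [Px Qx].
  have [m Hm] := pcone_homotopy0 a Px; exists (pcone a 0 x); split.
    exact: pcone_chains.
  by rewrite Hm subKr; apply: suppMz; apply: point_chains.
exists (pcone a n.+1 x); split; first exact: pcone_chains.
by rewrite (pcone_homotopy a Px) subKr; apply: pcone_chains => // I /QP /Pn.
Qed.

Lemma acyclic_of_incl P Q : hereditary P -> hereditary Q -> (forall I, P I -> Q I) ->
  acyclic sbd (chains P) (chains Q).
Proof.
move=> hP hQ PQ n x [Px _]; apply: bdr_r; first exact: chains_sub.
exact: chains_incl Px.
Qed.

(** Localizing to an open [U] enables [open_ind]. Over [minopen x], if [x] is missing from [B] then
    [B] does not meet the neighbourhood at all, and every simplex lies in [C]; likewise with [B] and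
    [C] exchanged. *)
Lemma closed_excision_open B C U : is_closed X B -> is_closed X C -> is_open X U ->
  let P I := sub (fun a => B a \/ C a) I /\ sub U I in
  acyclic sbd (chains P) (chains (fun I => P I /\ (sub B I \/ sub C I))).
Proof.
move=> clB clC.
set Y := sub (fun a => B a \/ C a); set L := fun I => sub B I \/ sub C I.
have hL : hereditary L by apply: or_hereditary; apply: sub_hereditary.
have hP V : hereditary (fun I => Y I /\ sub V I) by apply: and_hereditary; apply: sub_hereditary.
have hPL V : hereditary (fun I => (Y I /\ sub V I) /\ L I) by apply: and_hereditary.
move: U; apply: open_ind.
- move=> P; apply: acyclic_of_incl; [exact: hP|exact: hPL|] => I [YI EI].
  by split=> //; left=> a /EI.
- move=> x P.
  case: (classic (B x)) => Bx; last first.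
    apply: acyclic_of_incl; [exact: hP|exact: hPL|] => I [YI UI]; split=> //; right=> a Ia.
    by case: (YI a Ia) => // Ba; case: Bx; apply: (proj1 (closed_iff X B) clB) Ba (UI a Ia).
  case: (classic (C x)) => Cx; last first.
    apply: acyclic_of_incl; [exact: hP|exact: hPL|] => I [YI UI]; split=> //; left=> a Ia.
    by case: (YI a Ia) => // Ca; case: Cx; apply: (proj1 (closed_iff X C) clC) Ca (UI a Ia).
  (* Here [x] lies in both [B] and [C], so adding the apex respects lying in [B] as well as lying in
     [C]. *)
  have Padd I : P I -> P (fun y => y = x \/ I y).
    move=> [YI UI]; split=> a [->|Ia]; [by left|exact: YI| |exact: UI].
    exact: minopen_refl.
  have PLadd I : P I /\ L I -> P (fun y => y = x \/ I y) /\ L (fun y => y = x \/ I y).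
    by move=> [/Padd PI [LI|LI]]; split=> //; [left|right] => a [->|/LI].
  have Ppt : P (fun y => y = x).
    by split=> a ->; [left|exact: minopen_refl].
  have PLpt : P (fun y => y = x) /\ L (fun y => y = x) by split=> //; left=> a ->.
  have Pn I : P I -> forall y, I y -> minopen X x y by move=> [].
  apply: (@acyclic_cone x) => //.
  + exact: hP.
  + exact: hPL.
  + by move=> I [].
- move=> U W oU oW acU acW acUW P.
  (* Gluing restricts [P] further to [V], while the induction hypotheses restrict [Y] directly; for
     [V] inside the union this is the same condition. *)
  have EV V : (forall b, V b -> U b \/ W b) ->
      (fun I => P I /\ sub V I) = (fun I => Y I /\ sub V I).
    move=> H; apply: functional_extensionality => I; apply: boolp.propext.
    by split=> [[[YI _] VI]|[YI VI]]; split=> //; split=> // a /VI /H.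
  have tr V : (forall b, V b -> U b \/ W b) ->
      acyclic sbd (chains (fun I => Y I /\ sub V I)) (chains (fun I => (Y I /\ sub V I) /\ L I)) ->
      acyclic sbd (chains (fun I => P I /\ sub V I)) (chains (fun I => (P I /\ sub V I) /\ L I)).
    move=> H; have E := EV V H.
    have E' := f_equal (fun (F : pset -> Prop) I => F I /\ L I) E.
    by rewrite /= in E'; rewrite E E'.
  apply: (@acyclic_glue X P L U W) => //; first exact: hP.
  + by move=> I a [_ UI] /UI.
  + by apply: tr acU => b; left.
  + by apply: tr acW => b; right.
  + by apply: tr acUW => b []; left.
Qed.

Lemma closed_excision B C : is_closed X B -> is_closed X C ->
  acyclic sbd (chains (sub (fun a => B a \/ C a))) (sumc (chains (sub B)) (chains (sub C))).
Proof.
move=> clB clC; rewrite -chains_cup.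
have EP : chains (sub (fun a => B a \/ C a)) =
    chains (fun I => sub (fun a => B a \/ C a) I /\ sub (fun _ => True) I).
  by apply: chains_ext => I; split=> [|[]].
have EQ : chains (fun I => sub B I \/ sub C I) = chains (fun I =>
    (sub (fun a => B a \/ C a) I /\ sub (fun _ => True) I) /\ (sub B I \/ sub C I)).
  apply: chains_ext => I; split=> [H|[_]] //; split=> //; split=> // a Ia.
  by case: H => H; [left|right]; apply: H.
by rewrite EP EQ; apply: (closed_excision_open clB clC (open_full X)).
Qed.

Lemma finite_type_zero : finite_type sbd (@zeroc schain) (@zeroc schain).
Proof.
exists (fun _ => 0%N); split; last by exists 0%N.
move=> n; have c0 := zeroc_sub sbd; apply: rank0; first exact: bdr_subgroup.
by move=> x [-> _]; apply: sub0; apply: bdr_subgroup.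
Qed.

Lemma finite_type_iff P Q (D : nat -> schain -> Prop) : (forall I, P I <-> Q I) ->
  finite_type sbd (chains P) D -> finite_type sbd (chains Q) D.
Proof. by move=> /chains_ext ->. Qed.

(** Induction over open sets: [C] within [minopen x] is empty or a cone with apex [x], and unions
    are handled by Mayer-Vietoris in the form of excision. *)
Lemma finite_type_closed C : is_closed X C -> finite_type sbd (chains (sub C)) (@zeroc schain).
Proof.
move=> clC; pose P V := fun I => sub C I /\ sub V I.
have hP V : hereditary (P V) by apply: and_hereditary; apply: sub_hereditary.
have cP V := chains_sub (hP V).
suff H V : is_open X V -> finite_type sbd (chains (P V)) (@zeroc schain).
  by apply: finite_type_iff (H _ (open_full X)) => I; split=> [[]|].
have empty V' : (forall a, C a -> V' a -> False) -> finite_type sbd (chains (P V')) (@zeroc schain).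
  move=> H; have -> : chains (P V') = @zeroc schain; last exact: finite_type_zero.
  rewrite -(chains_empty X); apply: chains_ext => I; split=> [[CI UI] a Ia|H'].
    exact: H (CI _ Ia) (UI _ Ia).
  by split=> a /H'.
move: V; apply: open_ind; first by apply: empty.
- move=> x; case: (classic (C x)) => Cx; last first.
    by apply: empty => a Ca Ua; apply: Cx; apply: (proj1 (closed_iff X C) clC) Ca Ua.
  apply: (finite_type_cone (a := x)) => //; first by move=> I [].
    by move=> I [CI UI]; split=> a [->|Ia] //; [exact: CI|exact: UI].
  by split=> a -> //.
- move=> U W oU oW fU fW fUW.
  have c0 := zeroc_sub sbd.
  have EI : chains (P (fun a => U a /\ W a)) = capc (chains (P W)) (chains (P U)).
    rewrite -chains_cap; apply: chains_ext => I; split=> [[CI H]|[[CI H1] [_ H2]]].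
      by split; split=> // a /H [].
    by split=> // a Ia; split; [exact: H2|exact: H1].
  (* From the pair of [W] and the intersection, excision passes to the pair of the sum and [U], and
     then [U] is added back. *)
  have f1 : finite_type sbd (chains (P W)) (capc (chains (P W)) (chains (P U))).
    rewrite -EI; apply: finite_type_pair => //; first exact: sbd_sbd.
    by apply: chains_incl => I [CI H]; split=> // a /H [].
  have f2 : finite_type sbd (sumc (chains (P W)) (chains (P U))) (chains (P U)).
    have [f [Hf f0]] := f1; exists f; split=> // n.
    by apply/hrank_excision => //; exact: sbd_sbd.
  have f3 : finite_type sbd (sumc (chains (P W)) (chains (P U))) (@zeroc schain).
    apply: (finite_type_total _ _ _ _ fU) => //; first exact: sbd_sbd.
      exact: sumc_sub.
    move=> n x Hx; exists 0, x; split; rewrite ?add0r //; exact: supp0.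
  have [f [Hf f0]] := f3; exists f; split=> // n.
  (* Small chains identify the homology of the sum with that of the union. *)
  have := acyclic_small (hP (fun a => U a \/ W a)) oU oW (fun I a H => H.2 a).
  set Q := fun I => _ /\ _ => ac.
  have EQ : chains Q = sumc (chains (P W)) (chains (P U)).
    rewrite -chains_cup; apply: chains_ext => I; split.
      by move=> [[CI _] [H|H]]; [right|left].
    by move=> [[CI H]|[CI H]]; (split; [split=> // a /H; tauto|tauto]).
  rewrite EQ in ac; apply: (proj1 (@hrank_acyclic_l _ sbd (@sbd_sbd X) _ _ _ n (f n) _ _ _ _ _ ac) (Hf n)) => //.
  + exact: sumc_sub.
  + by apply: incl0; apply: sumc_sub.
  + by rewrite -EQ; apply: chains_incl => I [].
Qed.
End Homology.
End FiniteSpaceHomology.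

(** * Comparison with chains given as lists *)

Module ListChains.
From mathcomp Require Import all_boot all_order all_algebra ring ssrZ zify boolp.
From Stdlib Require Import Classical ClassicalEpsilon FunctionalExtensionality.
Require Import Defs.
Set Implicit Arguments. Unset Strict Implicit. Unset Printing Implicit Defensive.
Import Order.TTheory GRing.Theory Num.Theory.
Import RankTheory PairHomology FreeGroups SimplexGeometry SingularSimplices LinearChains.
Import SingularChains FiniteSpaces SingularHomology FiniteSpaceHomology.
Local Open Scope ring_scope.

Section Translation.
Variable X : FinT0Space.
Notation schain := (free (simp X)).
Notation pset := (pt X -> Prop).
Notation sbd := (sbd X).
Implicit Types (c e : chain X) (Y Z : pset).

(* Normal forms select one generator per [agree] class, so that [chain_eq] becomes equality. *)
Definition fc n c : schain := \sum_(p <- c) gen (nf X n p.2) *~ int_of_Z p.1.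

Lemma fc_cat n c e : fc n (c ++ e)%list = fc n c + fc n e.
Proof. exact: big_cat. Qed.

Lemma fc_cons n p c : fc n (p :: c) = gen (nf X n p.2) *~ int_of_Z p.1 + fc n c.
Proof. exact: big_cons. Qed.

Lemma cf_fc n c s : cf s (fc n c) = if asbool (nf X n s = s) then int_of_Z (coef X n c s) else 0.
Proof.
elim: c => [|[k s'] c IH]; first by rewrite /fc big_nil raddf0 if_same.
rewrite fc_cons raddfD /= IH raddfMz /= cf_gen.
case: (asboolP (nf X n s = s)) => E; last first.
  by case: asboolP => [E'|_]; [case: E; rewrite -E' nf_idem|rewrite mul0rz add0r].
case: excluded_middle_informative => [H|H].
  case: asboolP => [_|[]]; first by rewrite intz -raddfD.
  by rewrite -[RHS]E; apply: agree_nf.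
case: asboolP => [E'|_]; last by rewrite mul0rz add0r.
by case: H; apply: nf_eq_agree; rewrite E'.
Qed.

Lemma chain_eq_fc n c e : chain_eq X n c e <-> fc n c = fc n e.
Proof.
split=> [H|H s]; first by apply: cf_eq => s; rewrite !cf_fc H.
(* Coefficients are constant on [agree] classes, so comparing them at normal forms suffices. *)
have Ha c' : coef X n c' s = coef X n c' (nf X n s).
  elim: c' => //= p c' ->; congr (BinInt.Z.add _ _).
  have Hag : agree X n p.2 s <-> agree X n p.2 (nf X n s).
    by split=> H1 t Ht; have := H1 t Ht; rewrite nf_in.
  by do 2!case: excluded_middle_informative => //; tauto.
have := cf_fc n c (nf X n s); rewrite H cf_fc nf_idem.
case: asboolP => // _ /(can_inj int_of_ZK); by rewrite -!Ha.
Qed.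

Lemma even_odd i : PeanoNat.Nat.even i = ~~ odd i.
Proof.
suff : PeanoNat.Nat.even i = ~~ odd i /\ PeanoNat.Nat.even i.+1 = odd i by case.
by elim: i => [|i [IH1 IH2]]; split=> //=; rewrite ?IH2 ?IH1 ?negbK.
Qed.

Lemma fc_bd n c : fc n (bd X n c) = sbd n (fc n.+1 c).
Proof.
elim: c => [|[k s] c IH]; first by rewrite /fc !big_nil raddf0.
rewrite fc_cons raddfD -IH raddfMz sbd_nf sbdE /sbd_gen.
have -> : bd X n ((k, s) :: c) = (map (fun i => ((if PeanoNat.Nat.even i then k else BinInt.Z.opp k),
   fun t => s (face i t))) (iota 0 n.+2) ++ bd X n c)%list by [].
rewrite fc_cat; congr (_ + _); rewrite /fc big_map mulrz_suml.
rewrite -[iota _ _]/(index_iota 0 n.+2) big_mkord; apply: eq_bigr => i _ /=.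
rewrite -mulrzA; congr (_ *~ _); rewrite even_odd -signr_odd.
by case: (odd i); rewrite /= ?expr1 ?mulN1r ?mul1r // -raddfN.
Qed.

Lemma fc_chains n Y c : valid X n c -> supported X n Y c -> chains (sub Y) n (fc n c).
Proof.
elim: c => [|[k s] c IH]; first by move=> _ _; rewrite /fc big_nil; apply: supp0.
move=> /List.Forall_cons_iff[/= Cs Vc] /List.Forall_cons_iff[/= Ys Sc].
rewrite fc_cons; apply: (subD (supp_subgroup _)); last exact: IH.
by apply: suppMz; apply: supp_gen; apply: good_nf => //= a [t [Ht <-]]; apply: Ys.
Qed.

Lemma fc_scale n k c : fc n (scale X k c) = fc n c *~ int_of_Z k.
Proof.
elim: c => [|p c IH]; first by rewrite /fc !big_nil mul0rz.
rewrite /= !fc_cons IH mulrzDl -mulrzA; congr (_ *~ _ + _).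
by rewrite /= -[BinInt.Z.mul _ _]/(k * p.1) rmorphM mulrC.
Qed.

Lemma fc_onto n Y x : chains (sub Y) n x ->
  exists c, [/\ valid X n c, supported X n Y c & fc n c = x].
Proof.
move=> Hx; pose S x := exists c, [/\ valid X n c, supported X n Y c & fc n c = x].
apply: (supp_ind (S := S) _ _ Hx).
  split=> [|u w [c [Vc Sc <-]] [e [Ve Se <-]]].
    by exists nil; split; [exact: List.Forall_nil|exact: List.Forall_nil|rewrite /fc big_nil].
  exists (c ++ scale X (-1) e)%list; rewrite fc_cat fc_scale mulrN1z; split=> //.
    by apply/List.Forall_app; split=> //; apply/List.Forall_map.
  by apply/List.Forall_app; split=> //; apply/List.Forall_map.
move=> s [Ns Cs Ys]; exists [:: (1, s)]; split.
- by apply: List.Forall_cons.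
- by apply: List.Forall_cons => //= t Ht; apply: Ys; exists t.
- by rewrite /fc big_seq1 /= Ns mulr1z.
Qed.

Section Pair.
Variables Y Z : pset.
Notation CY := (chains (sub Y)).
Notation CZ := (chains (sub Z)).

Lemma rel_cycle_fc n c : rel_cycle X n Y Z c -> cyc sbd CY CZ n (fc n c).
Proof.
move=> [Vc [Sc H]]; split; first exact: fc_chains.
case: n c Vc Sc H => // n c Vc Sc [e [Ve [Se /chain_eq_fc E]]].
by rewrite -fc_bd E; apply: fc_chains.
Qed.

Lemma cyc_rel_cycle n x : cyc sbd CY CZ n x -> exists2 c, rel_cycle X n Y Z c & fc n c = x.
Proof.
move=> [/fc_onto [c [Vc Sc <-]] H]; exists c => //; split=> //; split=> //.
case: n c Vc Sc H => // n c Vc Sc; rewrite -fc_bd => /fc_onto [e [Ve Se /esym E]].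
by exists e; split=> //; split=> //; apply/chain_eq_fc.
Qed.

Lemma rel_bdry_fc n c : rel_bdry X n Y Z c <-> bdr sbd CY CZ n (fc n c).
Proof.
split=> [[d [e [Vd [Sd [Ve [Se /chain_eq_fc E]]]]]]|[y [/fc_onto [d [Vd Sd <-]] /fc_onto [e [Ve Se E]]]]].
  exists (fc n.+1 d); split; first exact: fc_chains.
  by rewrite E fc_cat fc_bd addrAC subrr add0r; apply: fc_chains.
exists d, e; do 4!(split=> //); apply/chain_eq_fc.
by rewrite fc_cat fc_bd E addrC subrK.
Qed.

Lemma fc_lincomb n ks fam : length ks = length fam ->
  fc n (lincomb X ks fam) =
  \sum_(i < length fam) fc n (List.nth i fam nil) *~ int_of_Z (List.nth i ks BinNums.Z0).
Proof.
elim: ks fam => [|k ks IH] [|c fam] //=; first by rewrite /fc /lincomb /= big_nil big_ord0.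
move=> [H]; rewrite big_ord_recl /= -IH // /lincomb /= fc_cat fc_scale //.
Qed.

Lemma list_of_ord T r (f : 'I_r -> T) :
  exists2 l : list T, length l = r & forall i d, List.nth (nat_of_ord i) l d = f i.
Proof.
elim: r f => [|r IH] f; first by exists nil => // -[].
have [l Hl Hn] := IH (fun i => f (lift ord0 i)).
exists (f ord0 :: l) => [|i d]; first by rewrite /= Hl.
by case: (unliftP ord0 i) => [j|] -> //=; exact: Hn.
Qed.

Lemma hom_indep_iff n r :
  (exists fam, length fam = r /\ hom_indep X n Y Z fam) <->
  (exists f : 'I_r -> schain, indep (cyc sbd CY CZ n) (bdr sbd CY CZ n) f).
Proof.
split=> [[fam [Hl [Hc Hi]]]|[f [Hc Hi]]].
  exists (fun i => fc n (List.nth i fam nil)); split=> [i|k Bk i].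
    apply: rel_cycle_fc; apply: (proj1 (List.Forall_nth _ _) Hc).
    by rewrite Hl; apply/ssrnat.ltP.
  have [ks Hks Hn] := list_of_ord (fun i => Z_of_int (k i)).
  have := Hi ks (etrans Hks (esym Hl)); rewrite rel_bdry_fc fc_lincomb ?Hks ?Hl // => H.
  have /List.Forall_nth /(_ (nat_of_ord i) BinNums.Z0) : List.Forall (fun k => k = BinNums.Z0) ks.
    by apply: H; under eq_bigr do rewrite Hn Z_of_intK.
  rewrite Hn Hks => /(_ (elimT ssrnat.ltP (ltn_ord i))) E.
  by apply: (can_inj Z_of_intK); rewrite E.
have H i : exists c, rel_cycle X n Y Z c /\ fc n c = f i.
  by have [c Rc Ec] := cyc_rel_cycle (Hc i); exists c.
have [g Hg] := fin_all_exists H.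
have [fam Hl Hn] := list_of_ord g.
exists fam; split=> //; split=> [|ks Hks].
  apply/List.Forall_nth => i d; rewrite Hl => /ssrnat.ltP Hir.
  by rewrite (Hn (Ordinal Hir)); have [] := Hg (Ordinal Hir).
rewrite rel_bdry_fc fc_lincomb // Hl => Hb.
apply/List.Forall_nth => i d; rewrite Hks Hl => /ssrnat.ltP Hir.
have E : int_of_Z (List.nth i ks BinNums.Z0) = 0.
  apply: (Hi (fun i => int_of_Z (List.nth i ks BinNums.Z0)) _ (Ordinal Hir)).
  by under eq_bigr => j _ do rewrite -(Hg j).2 -(Hn j nil).
rewrite (List.nth_indep _ d BinNums.Z0); last by rewrite Hks Hl; apply/ssrnat.ltP.
by apply: (can_inj int_of_ZK); rewrite E.
Qed.

Lemma hom_rank_hrank n r : hrank sbd CY CZ n r -> hom_rank X n Y Z r.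
Proof. by move=> [H1 H2]; split; rewrite hom_indep_iff. Qed.

Lemma acyclic_of_not_nonzero : (forall n, ~ hom_nonzero X n Y Z) -> acyclic sbd CY CZ.
Proof.
move=> H n x /cyc_rel_cycle [c Rc <-]; apply/rel_bdry_fc; apply: NNPP => Nb.
by apply: (H n); exists c.
Qed.
End Pair.
End Translation.
End ListChains.

(** * The Morse equation and connections *)

Module MorseEquation.
From mathcomp Require Import all_boot all_order all_algebra ring zify.
From Stdlib Require Import Classical ClassicalEpsilon.
Require Import Defs.
Set Implicit Arguments. Unset Strict Implicit. Unset Printing Implicit Defensive.
Import Order.TTheory GRing.Theory Num.Theory.
Import RankTheory PairHomology FreeGroups SingularSimplices SingularChains.
Import FiniteSpaces SingularHomology FiniteSpaceHomology ListChains AttractorRepeller.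
Local Open Scope ring_scope.

Section Morse.
Variables (X : FinT0Space) (F : MVField X) (A : pt X -> Prop).
Hypotheses (hX : invariant X F (fun _ => True)) (hA : attractor X F A).
Notation schain := (free (simp X)).
Notation pset := (pt X -> Prop).
Notation sbd := (sbd X).
Notation R := (repeller X F A).
Notation coR := (fun x => ~ repeller X F A x).
Notation CC Y := (chains (sub Y)).
Implicit Types (B C Y : pset).

Let clA : is_closed X A := attractor_closed X F A hA.
Let clR : is_closed X coR := corepeller_closed X F A hX hA.
Let cS Y : subcomplex sbd (CC Y) := chains_sub (@sub_hereditary X Y).

Lemma CC_incl B C : (forall x, B x -> C x) -> incl (CC B) (CC C).
Proof. by move=> BC; apply: chains_incl => I BI a /BI /BC. Qed.

Lemma CC_cap B C Y : (forall x, Y x <-> B x /\ C x) -> capc (CC B) (CC C) = CC Y.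
Proof.
move=> H; rewrite -chains_cap; apply: chains_ext => I; split=> [[BI CI] a Ia|YI].
  by apply/H; split; [apply: BI|apply: CI].
by split=> a /YI /H [].
Qed.

Lemma CC_sum_incl B C Y : (forall x, B x \/ C x -> Y x) -> incl (sumc (CC B) (CC C)) (CC Y).
Proof. by move=> H; rewrite -chains_cup; apply: chains_incl => I [BI a /BI|CI a /CI] ?; apply: H; [left|right]. Qed.

Lemma CC_empty Y : (forall x, ~ Y x) -> CC Y = @zeroc schain.
Proof.
move=> H; rewrite -(chains_empty X); apply: chains_ext => I; split=> [YI a /YI|HI a /HI] //.
exact: H.
Qed.

Lemma excision_cover B C Y : is_closed X B -> is_closed X C -> (forall x, Y x <-> B x \/ C x) ->
  acyclic sbd (CC Y) (sumc (CC B) (CC C)).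
Proof.
move=> cB cC H; have -> : Y = (fun x => B x \/ C x) by apply: pset_ext.
exact: closed_excision.
Qed.

(* [B] and [cl [p]] are closed with union [B u [p]] and intersection [mo [p]]. *)
Lemma acyclic_attach B p : forward_inv X F B -> regular X (mv F p) -> ~ B p ->
  is_closed X (fun y => B y \/ mv F p y) ->
  acyclic sbd (CC (fun y => B y \/ mv F p y)) (CC B).
Proof.
move=> fB reg Bp cl'.
have [clB cmp] := proj1 (forward_inv_iff X F B) fB.
have clV := cl_closed X (mv F p).
have VB y : cl X (mv F p) y -> B y \/ mv F p y by move=> Hy; apply: (Hy _ cl') => z; right.
have disj y : mv F p y -> ~ B y.
  by case: (cmp p) => H; [apply: H|case: Bp; apply: H; apply: mv_refl].
have acV : acyclic sbd (CC (cl X (mv F p))) (CC (mo X (mv F p))).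
  by apply: acyclic_of_not_nonzero => n Hn; apply: reg; exists n.
have capE : capc (CC (cl X (mv F p))) (CC B) = CC (mo X (mv F p)).
  apply: CC_cap => x; split=> [[Vx nx]|[Vx Bx]]; split=> //.
    by case: (VB x Vx).
  by move/disj.
have ac1 : acyclic sbd (sumc (CC (cl X (mv F p))) (CC B)) (CC B).
  by apply: acyclic_excision => //; rewrite capE.
have ac2 : acyclic sbd (CC (fun y => B y \/ mv F p y)) (sumc (CC (cl X (mv F p))) (CC B)).
  apply: excision_cover => // x; split=> [[Bx|Vx]|[/VB //|Bx]]; try by [right|left].
  by left; apply: cl_incl.
apply: acyclic_trans ac2 ac1 => //; first exact: sbd_sbd.
- exact: sumc_sub.
- by move=> n x Hx; exists 0, x; rewrite add0r; split=> //; apply: supp0.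
- by apply: CC_sum_incl => x [/VB|]; [|left].
Qed.

Lemma acyclic_corepeller : acyclic sbd (CC coR) (CC A).
Proof.
(* The inclusion of [A] is carried through the induction, as composing the steps by [acyclic_trans]
   requires it. *)
have [//] : acyclic sbd (CC coR) (CC A) /\ (forall x, A x -> ~ R x).
apply: (filtration_ind X F A hX hA (fun B => acyclic sbd (CC B) (CC A) /\ (forall x, A x -> B x))).
  by split=> //; apply: acyclic_refl.
move=> B p fB [acB AB] reg Bp cl'; split; last by move=> x /AB; left.
apply: (acyclic_trans _ _ _ _ _ _ (acyclic_attach fB reg Bp cl') acB) => //.
- exact: sbd_sbd.
- exact: CC_incl.
- by apply: CC_incl => x; left.
Qed.

Notation XX := (fun _ : pt X => True).

(** The repeller is open, but its closure and its complement are closed sets that cover [X] and meet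
    in [mo X R], so closed excision applies to them. *)
Lemma hrank_repeller n r :
  hrank sbd (CC XX) (CC A) n r -> hrank sbd (CC (cl X R)) (CC (mo X R)) n r.
Proof.
move=> H.
have acR : acyclic sbd (CC XX) (sumc (CC (cl X R)) (CC coR)).
  apply: excision_cover => //; first exact: cl_closed.
  move=> x; split=> // _; case: (classic (R x)) => Rx; [left|by right].
  exact: cl_incl.
have capE : capc (CC (cl X R)) (CC coR) = CC (mo X R) by apply: CC_cap => x.
rewrite -capE.
apply/(@hrank_excision _ sbd _ _ n r (cS _) (cS _)).
have QS : incl (CC coR) (sumc (CC (cl X R)) (CC coR)).
  by move=> m x Hx; exists 0, x; rewrite add0r; split=> //; apply: supp0.
apply/(hrank_acyclic_l _ n r _ _ _ _ _ acR) => //.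
- exact: sbd_sbd.
- exact: sumc_sub.
- exact: CC_sum_incl.
apply/(hrank_acyclic_r _ n r _ _ _ _ _ acyclic_corepeller) => //.
- exact: sbd_sbd.
- by apply: CC_incl => x Ax Rx; apply: (repeller_disjoint X F A x Rx).
- exact: CC_incl.
Qed.

(** For closed [C] the mouth is empty and carries no simplices, so the pair homology is absolute. *)
Lemma betti_closed C n r : is_closed X C -> hrank sbd (CC C) (@zeroc schain) n r -> betti X C n r.
Proof.
move=> clC H; apply: hom_rank_hrank; rewrite (closed_cl X C clC) (@CC_empty (mo X C)) //.
by move=> x []; rewrite closed_cl.
Qed.

Lemma morse_equation : exists q : nat -> nat,
  (exists N, forall i, (N <= i)%coq_nat -> q i = 0%N) /\
  (forall i, exists bA bS bX, betti X A i bA /\ betti X R i bS /\ betti X XX i bX /\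
     (bA + bS = bX + q i + match i with O => 0 | S j => q j end)%coq_nat) /\
  ((exists i, q i <> 0%N) -> exists x, connection_set X F R A x).
Proof.
have AX : incl (CC A) (CC XX) by apply: CC_incl.
have fA := finite_type_closed clA.
have fX := finite_type_closed (closed_full X).
have fXA := finite_type_pair (@sbd_sbd X) (cS XX) (cS A) AX fA fX.
case: fA fX fXA => [a [Ha [Na a0]]] [x [Hx [Nx x0]]] [s [Hs [Ns s0]]].
have [q [Hq Eq]] := les_rank (@sbd_sbd X) (cS XX) (cS A) AX Ha Hx Hs.
exists q; split; [|split].
(* Once [a i] and [s i] vanish, the rank equation forces [q i = 0]. *)
- exists (Na + Ns)%N => i Hi; have := Eq i; rewrite a0 ?s0; lia.
- move=> i; exists (a i), (s i), (x i); split; first exact: betti_closed.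
  split; first by apply: hom_rank_hrank; apply: hrank_repeller.
  split; last by have := Eq i; case: i => [|i]; lia.
  by apply: betti_closed => //; apply: closed_full.
- move=> [i qi]; apply: NNPP => Hno; apply: qi.
  have cov := no_connection_cover X F A hX hA Hno.
  have clR' := no_connection_closed X F A hX hA Hno.
  apply: rank_unique (Hq i) _; apply: (@conn_zero _ _ (@sbd_sbd X) _ _ _ (CC R)) => //.
  + exact: CC_incl.
  (* A singular simplex has nonempty image, so none lies in both of two disjoint sets. *)
  + move=> m y Ay Ry.
    suff : @zeroc schain m y by [].
    rewrite -(chains_empty X); apply: chains_meet Ay Ry => I AI RI b Ib.
    exact: (repeller_disjoint X F A b (RI b Ib)) (AI b Ib).
  + by apply: excision_cover => // y; split=> // _; apply: cov.
Qed.
End Morse.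
End MorseEquation.

Require Import Defs.
From Stdlib Require Import Reals ZArith List Arith Classical ClassicalEpsilon.

Theorem theorem7p9 (X : FinT0Space) (F : MVField X) (A : pt X -> Prop) :
  invariant X F (fun _ => True) ->
  attractor X F A ->
  let Astar := Inv X F (fun x => ~ A x) in
  exists q : nat -> nat,
    (exists N, forall i, (N <= i)%nat -> q i = 0%nat) /\
    (forall i, exists bA bS bX,
        betti X A i bA /\ betti X Astar i bS /\ betti X (fun _ => True) i bX /\
        (bA + bS = bX + q i + match i with O => 0 | S j => q j end)%nat) /\
    ((exists i, q i <> 0%nat) -> exists x, connection_set X F Astar A x).
Proof.
  intros hX hA Astar; exact (MorseEquation.morse_equation hX hA).
Qed.
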